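(* For $r,s,p,q\in[1,+\infty)$: (1) $E(\ell_r,p)\le_B E(L_r,p)$; (2) $E(\ell_p,p)\sim_B\mathbb R^{\mathbb N}/\ell_p\le_B E(\ell_r,p)$; (3) $E(\ell_2,p)\sim_B E(L_2,p)\le_B E(L_r,p)$; (4) if $s\le r\le2$, then $E(L_r,p)\le_B E(L_s,p)$; (5) if $\frac rp=\frac sq$ and $p\le q$, then $E(\ell_r,p)\le_B E(\ell_s,q)$ and $E(L_r,p)\le_B E(L_s,q)$.
   Context: $L_r=L_r[0,1]$. For a separable Banach space $X$ and $p\in[1,\infty)$, $E(X,p)$ is the equivalence relation on $X^{\mathbb N}$ with $(x,y)\in E(X,p)\iff\sum_n\|x(n)-y(n)\|_X^p<+\infty$; $\mathbb R^{\mathbb N}/\ell_p=E(\mathbb R,p)$. $E\le_B F$ means there is a Borel map $\theta$ with $(x,y)\in E\iff(\theta(x),\theta(y))\in F$, and $E\sim_B F$ means $E\le_BF$ and $F\le_BE$. *)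

(* Defs.v *)
From HB Require Import structures.
From mathcomp Require Import all_boot all_order all_algebra.
From mathcomp Require Import all_classical all_reals all_analysis.
From mathcomp Require Import measurable_realfun ess_sup_inf.

Set Implicit Arguments.
Unset Strict Implicit.
Unset Printing Implicit Defensive.

Import Order.TTheory GRing.Theory Num.Theory.
Import numFieldNormedType.Exports.

Local Open Scope classical_set_scope.
Local Open Scope ring_scope.

(* The library's [LspaceType mu p1] carries no algebraic structure yet: it is
   made a normed module here, all operations being computed on representatives
   ([Lspace_repr]) and sent back to a.e.-classes ([Lspace_pi]). *)
Section Lspace_normed.
Context d (T : measurableType d) (R : realType).
Variables (mu : {measure set T -> \bar R}) (p : \bar R) (p1 : (1 <= p)%E).

Local Notation fn := (LfunType mu p1).
Local Notation W := (LspaceType mu p1).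
Local Open Scope quotient_scope.

HB.instance Definition _ := gen_eqMixin W.
HB.instance Definition _ := gen_choiceMixin W.

Lemma ae_eq_Lnorm (f g : T -> R) :
  measurable_fun setT f -> measurable_fun setT g -> f = g %[ae mu] ->
  'N[mu]_p[EFin \o f]%E = 'N[mu]_p[EFin \o g]%E.
Proof.
have mE (h : T -> R) (r : R) : measurable_fun setT h ->
    measurable_fun setT (fun x => `|(h x)%:E| `^ r)%E.
  move=> mh; apply: (@measurableT_comp _ _ _ _ _ _ (fun x => x `^ r)%E) => /=.
    exact: measurable_poweR.
  by apply: measurableT_comp => //; apply: measurableT_comp.
move=> mf mg fg; rewrite unlock /Lnorm; case: p p1 => [r r1||//].
- congr (_ `^ _)%E; apply: ae_eq_integral; [by []|exact: mE|exact: mE|].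
  by apply: filterS fg => x /= /[apply] ->.
- move=> _; case: ifPn => // _; apply: eq_ess_sup.
  by apply: filterS fg => x /= ->.
Qed.

Local Notation mfunq := {mfun_ mu, T >-> measurableTypeR R}.

Lemma ae_eq_repr_pi (f : {mfun T >-> measurableTypeR R}) :
  repr (\pi_mfunq f) = f %[ae mu].
Proof. by apply/asboolP; have /eqmodP := reprK (\pi_mfunq f). Qed.

Lemma Lspace_repr_subproof (w : W) : (repr (w : mfunq) : T -> R) \in Lfun mu p.
Proof.
apply/andP; split; rewrite inE /=.
  exact: (@measurable_funPT _ _ _ _ (repr (w : mfunq))).
exact: (@Lebesgue_finite _ _ _ _ _ _ w).
Qed.

Definition Lspace_repr (w : W) : fn := Lfun_Sub p1 (Lspace_repr_subproof w).

Lemma Lfun_mfun_subproof (f : fn) :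
  @isMeasurableFun d _ T (measurableTypeR R) (f : T -> R).
Proof. by constructor; exact: (@measurable_funPT _ _ _ _ f). Qed.

Definition Lfun_mfun (f : fn) : {mfun T >-> measurableTypeR R} :=
  HB.pack (f : T -> measurableTypeR R) (Lfun_mfun_subproof f).

Lemma Lspace_pi_subproof (f : fn) :
  finite_norm mu p (\pi_mfunq (Lfun_mfun f) : mfunq).
Proof.
rewrite /finite_norm (@ae_eq_Lnorm _ f).
- exact: Lfunction_finite.
- exact: (@measurable_funPT _ _ _ _ (repr (\pi_mfunq (Lfun_mfun f)))).
- exact: (@measurable_funPT _ _ _ _ f).
- exact: (ae_eq_repr_pi (Lfun_mfun f)).
Qed.

Definition Lspace_pi (f : fn) : W :=
  HB.pack_for W (\pi_mfunq (Lfun_mfun f) : mfunq)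
    (isFinLebesgue.Build d T R mu p p1 _ (Lspace_pi_subproof f)).

Lemma Lspace_sort_inj (v w : W) : (v : mfunq) = w -> v = w.
Proof.
case: v w => [v [[vp]]] [w [[wp]]] /= vw; case: _ / vw in wp *.
by rewrite (Prop_irrelevance vp wp).
Qed.

Lemma Lspace_reprK (w : W) : Lspace_pi (Lspace_repr w) = w.
Proof.
apply: Lspace_sort_inj; rewrite -[RHS]reprK; apply/eqmodP/asboolP.
exact: ae_eq_refl.
Qed.

Lemma Lspace_piK (f : fn) : Lspace_repr (Lspace_pi f) = f %[ae mu].
Proof. exact: (ae_eq_repr_pi (Lfun_mfun f)). Qed.

Lemma eq_Lspace_pi (f g : fn) : f = g %[ae mu] -> Lspace_pi f = Lspace_pi g.
Proof. by move=> fg; apply/Lspace_sort_inj/eqmodP/asboolP. Qed.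

Definition Lspace_zero : W := Lspace_pi 0.
Definition Lspace_opp (v : W) : W := Lspace_pi (- Lspace_repr v).
Definition Lspace_add (v w : W) : W :=
  Lspace_pi (Lspace_repr v + Lspace_repr w).
Definition Lspace_scale (a : R) (v : W) : W := Lspace_pi (a *: Lspace_repr v).
Definition Lspace_norm (v : W) : R := fine 'N[mu]_p[EFin \o Lspace_repr v]%E.

Lemma Lspace_piN f : Lspace_pi (- f) = Lspace_opp (Lspace_pi f).
Proof.
apply: eq_Lspace_pi; apply: filterS (Lspace_piK f) => x e Ix.
exact: (congr1 -%R (esym (e Ix))).
Qed.

Lemma Lspace_piD f g :
  Lspace_pi (f + g) = Lspace_add (Lspace_pi f) (Lspace_pi g).
Proof.
apply: eq_Lspace_pi.
apply: filterS2 (Lspace_piK f) (Lspace_piK g) => x ef eg Ix.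
exact: (congr2 +%R (esym (ef Ix)) (esym (eg Ix))).
Qed.

Lemma Lspace_piZ a f : Lspace_pi (a *: f) = Lspace_scale a (Lspace_pi f).
Proof.
apply: eq_Lspace_pi; apply: filterS (Lspace_piK f) => x e Ix.
exact: (congr1 ( *%R a) (esym (e Ix))).
Qed.

Lemma Lspace_addA : associative Lspace_add.
Proof.
move=> u v w; rewrite -[u]Lspace_reprK -[v]Lspace_reprK -[w]Lspace_reprK.
by rewrite -!Lspace_piD addrA.
Qed.

Lemma Lspace_addC : commutative Lspace_add.
Proof. by move=> u v; rewrite /Lspace_add addrC. Qed.

Lemma Lspace_add0 : left_id Lspace_zero Lspace_add.
Proof. by move=> u; rewrite -[u]Lspace_reprK -Lspace_piD add0r. Qed.

Lemma Lspace_addN : left_inverse Lspace_zero Lspace_opp Lspace_add.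
Proof.
by move=> u; rewrite -[u]Lspace_reprK -Lspace_piN -Lspace_piD addNr.
Qed.

HB.instance Definition _ := GRing.isZmodule.Build W
  Lspace_addA Lspace_addC Lspace_add0 Lspace_addN.

Lemma Lspace_scaleA a b v :
  Lspace_scale a (Lspace_scale b v) = Lspace_scale (a * b) v.
Proof. by rewrite -[v]Lspace_reprK -!Lspace_piZ scalerA. Qed.

Lemma Lspace_scale1 : left_id 1 Lspace_scale.
Proof. by move=> v; rewrite -[v]Lspace_reprK -Lspace_piZ scale1r. Qed.

Lemma Lspace_scaleDr : right_distributive Lspace_scale +%R.
Proof.
move=> a v w; rewrite -[v]Lspace_reprK -[w]Lspace_reprK.
rewrite -[LHS]/(Lspace_scale a (Lspace_add _ _)) -!(Lspace_piD, Lspace_piZ).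
by rewrite scalerDr Lspace_piD.
Qed.

Lemma Lspace_scaleDl v : {morph Lspace_scale^~ v : a b / a + b}.
Proof.
by move=> a b; rewrite -[v]Lspace_reprK -!Lspace_piZ scalerDl Lspace_piD.
Qed.

HB.instance Definition _ := GRing.Zmodule_isLmodule.Build R W
  Lspace_scaleA Lspace_scale1 Lspace_scaleDr Lspace_scaleDl.

Lemma Lspace_norm_pi (f : fn) :
  Lspace_norm (Lspace_pi f) = fine 'N[mu]_p[EFin \o f]%E.
Proof.
by rewrite /Lspace_norm (ae_eq_Lnorm _ _ (Lspace_piK f)).
Qed.

Lemma Lspace_normD v w : Lspace_norm (v + w) <= Lspace_norm v + Lspace_norm w.
Proof.
rewrite -[v]Lspace_reprK -[w]Lspace_reprK -[_ + _ in leLHS]Lspace_piD.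
by rewrite !Lspace_norm_pi ler_LnormD.
Qed.

Lemma Lspace_normZ a v : Lspace_norm (a *: v) = `|a| * Lspace_norm v.
Proof.
rewrite -[v]Lspace_reprK -[_ *: _]Lspace_piZ !Lspace_norm_pi.
apply: EFin_inj; rewrite EFinM !finite_norm_fine; exact: LnormZ.
Qed.

Lemma Lspace_norm_eq0 v : Lspace_norm v = 0 -> v = 0.
Proof.
rewrite -[v]Lspace_reprK Lspace_norm_pi => /fine_Lnormr_eq0 v0.
exact: eq_Lspace_pi.
Qed.

HB.instance Definition _ := Lmodule_isNormed.Build R W
  Lspace_normD Lspace_normZ Lspace_norm_eq0.

End Lspace_normed.

Section ell_Lunit.
Context {R : realType}.

Lemma lee1_fin (r : R) : 1 <= r -> (1 <= r%:E)%E.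
Proof. by rewrite lee_fin. Qed.

(* $\ell_r$ is $L_r$ of the counting measure on nat; see [ell_normE], [ell_eqP]
   and [ell_mem] for its description by sequences. *)
Definition ell (r : R) (r1 : 1 <= r) : normedModType R :=
  LspaceType (counting : {measure set nat -> \bar R})
    (lee1_fin r1).

(* $L_r[0,1]$ is taken over the whole line for the measure A |-> |A `&` [0, 1]|:
   the values of a representative outside [0, 1] are irrelevant. *)
Definition Lunit (r : R) (r1 : 1 <= r) : normedModType R :=
  LspaceType (mrestr (@lebesgue_measure R) (measurable_itv `[0 : R, 1]))
    (lee1_fin r1).

Lemma ell_normE (r : R) (r1 : 1 <= r) (x : ell r1) :
  `|x|%:E = ((\sum_(k <oo) (`|Lspace_repr x k| `^ r)%:E) `^ r^-1)%E.
Proof.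
rewrite [LHS]finite_norm_fine Lnorm_counting ?(lt_le_trans ltr01)//.
Qed.

Lemma ell_eqP (r : R) (r1 : 1 <= r) (x y : ell r1) :
  x = y <-> forall k, Lspace_repr x k = Lspace_repr y k.
Proof.
split=> [->//|xy]; rewrite -[x]Lspace_reprK -[y]Lspace_reprK.
by congr Lspace_pi; apply/LfuneqP.
Qed.

Lemma ell_mem (r : R) (r1 : 1 <= r) (u : R^nat) :
  (\sum_(k <oo) (`|u k| `^ r)%:E < +oo)%E ->
  exists x : ell r1, forall k, Lspace_repr x k = u k.
Proof.
move=> ur; have uL : u \in Lfun (counting : {measure set nat -> \bar R}) r%:E.
  apply/andP; split; rewrite inE//= /finite_norm.
  by rewrite Lnorm_counting ?(lt_le_trans ltr01)// poweR_lty.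
exists (Lspace_pi (Lfun_Sub (lee1_fin r1) uL)) => k.
have [N [_ N0 subN]] := Lspace_piK (Lfun_Sub (lee1_fin r1) uL).
apply: contrapT => neq; have Nk : N k by apply: subN => /= /(_ Logic.I).
move: N0; rewrite /= /counting; case: asboolP => // fN [] /eqP.
rewrite pnatr_eq0 finmap.cardfs_eq0 => /eqP /(fset_set_set0 fN) N0.
by rewrite N0 in Nk.
Qed.

End ell_Lunit.

Section borel_reducibility.

Definition borel_map (X Y : topologicalType) (f : X -> Y) :=
  forall B : set Y, <<s open >> B -> <<s open >> (f @^-1` B).

Definition borel_reducible (X Y : topologicalType)
    (E : set (X * X)) (F : set (Y * Y)) :=
  exists theta : X -> Y, borel_map theta /\
    forall x y, E (x, y) <-> F (theta x, theta y).

Definition borel_bireducible (X Y : topologicalType)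
    (E : set (X * X)) (F : set (Y * Y)) :=
  borel_reducible E F /\ borel_reducible F E.

End borel_reducibility.

Definition Esum {R : realType} (X : normedModType R) (p : R) :
    set ({ptws nat -> X} * {ptws nat -> X}) :=
  [set xy | (\sum_(n <oo) (`|xy.1 n - xy.2 n| `^ p)%:E < +oo)%E].
Arguments Esum {R} X p _ : assert.

(* Main.v *)
(** A map T : X -> Y with |T x - T y|^b comparable to |x - y|^a, applied
    coordinatewise, reduces E(X, p) to E(Y, q) as soon as a / p = b / q; all
    reductions but one come from such embeddings.

    Bi-Lipschitz embeddings: l_r sits in L_r on disjoint intervals, R sits in
    every l_r, L_2 is isometric to a subspace of l_2 by Haar coefficients
    (Parseval), and l_2 embeds in every L_s by Rademacher sums (Khintchine).
    For s < r < 2 the space L_r embeds in L_s through the random sums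
      sum_k e_k w_k f(U_k),  w_k = 2^(-i/r) for 2^i <= k < 2^(i+1),
    where the signs e_k and the uniform points U_k are independent; they replace
    the r-stable random measure, of which they are the series representation.
    The moment of order s is bounded above through the sum over k of
    E min(|w_k f(U_k)|^2, |w_k f(U_k)|^s), and below because with probability
    at least 1/3 some |w_k f(U_k)| is not small (second moment method).

    Snowflakes: for r < s, x |-> (sin, cos)-functions at all the dyadic scales
    maps the line with the metric |x - y|^(r/s) into l_s; applied pointwise to
    functions, this gives T : L_r -> L_s(l_s) with |T f - T g|^s comparable to
    |f - g|^r, and L_s(l_s) embeds isometrically in L_s.

    The exception is E(l_p, p), which is R^N / l_p along an enumeration of the
    double sequence of coordinates. *)
Require Import Defs.
From HB Require Import structures.
From mathcomp Require Import all_boot all_order all_algebra.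
From mathcomp Require Import all_classical all_reals all_analysis.
From mathcomp Require Import measurable_realfun ring lra.
Import Order.TTheory GRing.Theory Num.Theory.
Import numFieldNormedType.Exports.
Local Open Scope classical_set_scope.
Local Open Scope ring_scope.

Set Implicit Arguments.
Unset Strict Implicit.
Unset Printing Implicit Defensive.

(** * Borel reductions *)

(** All randomness has to be manufactured on [0, 1], where the target spaces live. Everything rests
    on [psi1] and [psi2], which split the binary digits of a point into two independent uniform
    points; iterating them yields the signs, the sample points and room for countably many copies of
    the interval. The random sums are infinite, and they evaluate f at points, which has no meaning
    on classes. Hence the finite stages, well defined up to null sets because every sample point is
    uniform, and a limit in the complete space L_s. A stage is bounded below only from a rank
    depending on f; this suffices, as the limit is taken with x and y fixed. The weights come from
    the series of a stable variable: the Poisson arrival times are replaced by k rounded down to a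
    power of 2, so that all sums over k become geometric. These sums behave like sum_i
    min(u_i^(2-r), u_i^(s-r)) along a geometric progression u_i, which is bounded only for s < r <
    2; at r = 2 the Haar and Rademacher systems take over. The snowflakes meet the same sum with
    exponents s - r and -r, whence r < s there. *)

Lemma borel_map_continuous (X Y : topologicalType) (f : X -> Y) :
  continuous f -> borel_map f.
Proof.
move=> /continuousP cf B; apply: (@smallest_sub _ _ _ [set B | <<s open >> (f @^-1` B)]).
  split=> /=.
  - by rewrite preimage_set0; exact: sigma_algebra0.
  - move=> A sA; rewrite setTD preimage_setC -setTD; exact: (sigma_algebraCD sA).
  - by move=> F sF; rewrite preimage_bigcup; exact: sigma_algebra_bigcup.
by move=> A oA /=; apply: sub_sigma_algebra; exact: cf.
Qed.

Lemma borel_reducible_trans (X Y Z : topologicalType)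
    (E : set (X * X)) (F : set (Y * Y)) (G : set (Z * Z)) :
  borel_reducible E F -> borel_reducible F G -> borel_reducible E G.
Proof.
move=> [f [bf fE]] [g [bg gF]]; exists (g \o f); split.
  by move=> B sB; rewrite comp_preimage; apply: bf; exact: bg.
by move=> x y; rewrite fE gF.
Qed.

Section Esum_reducible.
Context {R : realType}.

Lemma continuous_ptws (X : topologicalType) (Y : normedModType R)
    (f : X -> {ptws nat -> Y}) :
  (forall n, continuous (fun x => f x n)) -> continuous f.
Proof.
move=> cf x; apply/(@pointwise_cvgP nat Y) => n.
exact: cf.
Qed.

Lemma continuous_ptws_eval (Y : normedModType R) n :
  continuous (fun x : {ptws nat -> Y} => x n).
Proof. exact: (@proj_continuous nat (fun=> Y) n). Qed.

Lemma holder_continuous (X Y : normedModType R) (p q C : R) (T : X -> Y) :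
  0 < p -> 0 < q ->
  (forall x y, `|T x - T y| `^ q <= C * `|x - y| `^ p) -> continuous T.
Proof.
move=> p0 q0 TC x.
wlog C0 : C TC / 0 < C.
  move=> /(_ (Num.max C 1)); apply; last by rewrite lt_max ltr01 orbT.
  move=> u v; rewrite (le_trans (TC u v))// ler_wpM2r ?powR_ge0//.
  by rewrite le_max lexx.
apply/cvgrPdist_le => e e0; near=> y.
have : `|x - y| <= (C^-1 * e `^ q) `^ p^-1.
  near: y; apply: cvgr_dist_le => //.
  by rewrite powR_gt0// mulr_gt0 ?invr_gt0// powR_gt0.
move=> xy; rewrite leNgt; apply/negP => eT.
have : e `^ q < `|T x - T y| `^ q.
  by rewrite gt0_ltr_powR ?nnegrE//; exact: ltW.
rewrite ltNge => /negP; apply; apply: (le_trans (TC _ _)).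
rewrite -ler_pdivlMl//.
have -> : C^-1 * e `^ q = ((C^-1 * e `^ q) `^ p^-1) `^ p.
  rewrite -powRrM mulVf ?gt_eqF// powRr1//.
  by rewrite mulr_ge0 ?powR_ge0// invr_ge0 ltW.
by rewrite ge0_ler_powR ?nnegrE ?powR_ge0// ltW.
Unshelve. all: by end_near. Qed.

(** The two series are compared term by term, each inequality giving one implication. The upper one
    also makes [T] continuous, so that its coordinatewise extension is continuous for pointwise
    convergence, hence Borel. *)
Lemma Esum_reducible_holder (X Y : normedModType R) (p q c C : R) (T : X -> Y) :
  0 < p -> 0 < q -> 0 < c -> 0 <= C ->
  (forall x y, c * `|x - y| `^ p <= `|T x - T y| `^ q) ->
  (forall x y, `|T x - T y| `^ q <= C * `|x - y| `^ p) ->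
  borel_reducible (Esum X p) (Esum Y q).
Proof.
move=> p0 q0 c0 C0 Tc TC.
have cT : continuous T := holder_continuous p0 q0 TC.
exists (fun x => (fun n => T (x n))); split.
  apply: borel_map_continuous; apply: continuous_ptws => n x.
  apply: (@continuous_comp _ _ _ (fun x : {ptws nat -> X} => x n) T).
    exact: continuous_ptws_eval.
  exact: cT.
move=> x y; rewrite /Esum/=; split.
- move=> xy; apply: (@le_lt_trans _ _
    (\sum_(n <oo) (C%:E * (`|x n - y n| `^ p)%:E))%E).
    by apply: lee_nneseries => n _; rewrite ?lee_fin ?powR_ge0// -EFinM lee_fin.
  rewrite nneseriesZl; last by move=> *; rewrite lee_fin powR_ge0.
  by rewrite lte_mul_pinfty.
- move=> xy; apply: (@le_lt_trans _ _
    (\sum_(n <oo) (c^-1%:E * (`|T (x n) - T (y n)| `^ q)%:E))%E).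
    apply: lee_nneseries => n _; first by rewrite lee_fin powR_ge0.
    by rewrite -EFinM lee_fin ler_pdivlMl.
  rewrite nneseriesZl; last by move=> *; rewrite lee_fin powR_ge0.
  by rewrite lte_mul_pinfty// lee_fin invr_ge0 ltW.
Qed.
End Esum_reducible.

(** * The spaces of functions and sequences *)

Section Lspace.
Context d (T : measurableType d) (R : realType).
Variables (mu : {measure set T -> \bar R}) (s : R) (s1 : 1 <= s).

Let L : normedModType R := LspaceType mu (lee1_fin s1).

Lemma measurable_Lspace_repr (x : L) : measurable_fun setT (Lspace_repr x : T -> R).
Proof. exact: (@measurable_funPT _ _ _ _ (Lspace_repr x)). Qed.

Lemma measurable_powR_norm (f : T -> R) : measurable_fun setT f ->
  measurable_fun setT (fun t => (`|f t| `^ s)%:E).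
Proof.
move=> mf; apply/measurable_EFinP.
apply: (@measurableT_comp _ _ _ _ _ _ (fun x : R => x `^ s)).
  exact: measurable_powR.
exact: measurableT_comp.
Qed.

Lemma Lspace_normE (x : L) :
  ((`|x| `^ s)%:E = \int[mu]_t (`|Lspace_repr x t| `^ s)%:E)%E.
Proof.
have s0 : s != 0 by rewrite gt_eqF// (lt_le_trans ltr01).
rewrite -poweR_EFin -[`|x|]/(Lspace_norm x) /Lspace_norm finite_norm_fine.
by rewrite poweR_Lnorm.
Qed.

Lemma Lspace_reprB (x y : L) :
  {ae mu, forall t, Lspace_repr (x - y) t = Lspace_repr x t - Lspace_repr y t}.
Proof.
(* Subtraction adds the opposite class, so a representative is chosen twice and two null sets have
   to be discarded. *)
rewrite -[x - y]/(Lspace_pi (Lspace_repr x + Lspace_repr (Lspace_pi (- Lspace_repr y)))).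
apply: filterS2 (Lspace_piK (Lspace_repr x + Lspace_repr (Lspace_pi (- Lspace_repr y))))
  (Lspace_piK (- Lspace_repr y)) => t /(_ I) -> /(_ I) /= e.
exact: (congr1 (fun z => Lspace_repr x t + z) e).
Qed.

Lemma Lspace_distE (x y : L) (f g : T -> R) :
  measurable_fun setT f -> measurable_fun setT g ->
  {ae mu, forall t, Lspace_repr x t = f t} ->
  {ae mu, forall t, Lspace_repr y t = g t} ->
  ((`|x - y| `^ s)%:E = \int[mu]_t (`|f t - g t| `^ s)%:E)%E.
Proof.
move=> mf mg xf yg; rewrite Lspace_normE; apply: ae_eq_integral => //.
- exact/measurable_powR_norm/measurable_Lspace_repr.
- by apply: measurable_powR_norm; exact: measurable_funB.
apply: filterS3 (Lspace_reprB x y) xf yg => t e1 e2 e3 _ /=.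
by congr (`|_| `^ _)%:E; rewrite -e2 -e3.
Qed.

Lemma Lspace_ex (f : T -> R) : measurable_fun setT f ->
  (\int[mu]_t (`|f t| `^ s)%:E < +oo)%E ->
  exists x : L, {ae mu, forall t, Lspace_repr x t = f t}.
Proof.
move=> mf If.
have s0 : s != 0 by rewrite gt_eqF// (lt_le_trans ltr01).
have fL : f \in Lfun mu s%:E.
  apply/andP; split; rewrite inE//= /finite_norm.
  by rewrite unlock /Lnorm poweR_lty.
exists (Lspace_pi (Lfun_Sub (lee1_fin s1) fL)).
by apply: filterS (Lspace_piK (Lfun_Sub (lee1_fin s1) fL)) => t /(_ I).
Qed.

End Lspace.

Section ge0_ae.
Context d (T : measurableType d) (R : realType) (mu : {measure set T -> \bar R}).
Local Open Scope ereal_scope.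

(** The limit exists only almost everywhere, so [g] is first replaced by the lower limit of the
    [f n], which is measurable and defined everywhere. *)
Lemma fatou_le (f : (T -> \bar R)^nat) (g : T -> \bar R) (B : \bar R) :
  (forall n, measurable_fun setT (f n)) -> measurable_fun setT g ->
  (forall n t, 0 <= f n t) ->
  {ae mu, forall t, f n t @[n --> \oo] --> g t} ->
  (forall n, \int[mu]_t f n t <= B) -> \int[mu]_t g t <= B.
Proof.
move=> mf mg f0 fg fB.
have -> : \int[mu]_t g t = \int[mu]_t limn_einf (f^~ t).
  apply: ae_eq_integral => //.
    rewrite (_ : (fun t => _) = (fun t => - limn_esup (-%E \o f^~ t)))%E.
      apply: measurableT_comp => //.
      apply: (measurable_fun_limn_esup (f := fun n t => - f n t)%E) => n.
      exact: measurableT_comp.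
    by apply/funext => t; rewrite limn_esupN oppeK.
  by apply: filterS fg => t /cvg_limn_einf_sup [-> _].
apply: (le_trans (fatou mu measurableT mf (fun n t _ => f0 n t))).
rewrite limn_einf_lim; apply: lime_le; first exact: is_cvg_einfs.
apply: nearW => n; apply: (le_trans _ (fB n)).
by apply: ereal_inf_lbound; exists n => /=.
Qed.

Lemma ge0_integral_lty_ae (f : T -> \bar R) :
  measurable_fun setT f -> (forall t, 0 <= f t) ->
  \int[mu]_t f t < +oo -> {ae mu, forall t, f t < +oo}.
Proof.
move=> mf f0 fi; have /integrable_ae : mu.-integrable setT f.
  apply/integrableP; split => //.
  by under eq_integral do rewrite gee0_abs//.
move=> /(_ measurableT); apply: filterS => t /(_ I).
by rewrite ge0_fin_numE.
Qed.

Lemma measurable_nneseries (h : nat -> T -> \bar R) :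
  (forall k t, 0 <= h k t) -> (forall k, measurable_fun setT (h k)) ->
  measurable_fun setT (fun t => \sum_(k <oo) h k t).
Proof.
move=> h0 mh; apply: (emeasurable_fun_cvg (fun n t => \sum_(0 <= k < n) h k t)).
  by move=> n; exact: emeasurable_sum.
by move=> t _; apply: is_cvg_nneseries.
Qed.

End ge0_ae.

Lemma cvg_geometric_increments (R : realType) (u : R^nat) (M : R) :
  (forall k, 2 ^+ k * `|u k.+1 - u k| <= M) -> cvgn u.
Proof.
move=> uM; rewrite (_ : u = (fun n => u 0%N + series (telescope u) n)); last first.
  by apply/funext => n; rewrite -eq_sum_telescope.
apply: is_cvgD; first exact: is_cvg_cst.
apply: normed_cvg; apply: (@series_le_cvg _ _ (geometric M 2^-1)) => //.
- by move=> n; exact: normr_ge0.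
- move=> n; rewrite /geometric/= mulr_ge0 ?exprn_ge0//.
  by apply: le_trans (uM 0%N); rewrite mulr_ge0// exprn_ge0.
- move=> n; rewrite /geometric/= exprVn ler_pdivlMr ?exprn_gt0//.
  by rewrite mulrC.
- by apply: is_cvg_geometric_series; rewrite ger0_norm ?invr_ge0// invf_lt1// ltr1n.
Qed.

Section nneseries_bounds.
Context {R : realType}.
Local Open Scope ereal_scope.

Lemma nneseries_le (u : (\bar R)^nat) (B : \bar R) : (forall n, 0 <= u n) ->
  (forall n, \sum_(0 <= k < n) u k <= B) -> \sum_(k <oo) u k <= B.
Proof.
move=> u0 uB; apply: lime_le; last exact: nearW.
by apply: is_cvg_nneseries => *; exact: u0.
Qed.

Lemma nneseries_ge (u : (\bar R)^nat) n : (forall n, 0 <= u n) ->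
  \sum_(0 <= k < n) u k <= \sum_(k <oo) u k.
Proof. by move=> u0; apply: nneseries_lim_ge => *; exact: u0. Qed.

Lemma nneseries_term_le (u : (\bar R)^nat) n : (forall n, 0 <= u n) ->
  u n <= \sum_(k <oo) u k.
Proof.
move=> u0; apply: (le_trans _ (nneseries_ge n.+1 u0)).
by rewrite big_nat_recr//= leeDr// sume_ge0.
Qed.

End nneseries_bounds.

Section powR_norm.
Context {R : realType} (s : R).
Hypothesis s0 : 0 < s.

Lemma cvg_powR_norm (u : R^nat) (l : R) :
  u n @[n --> \oo] --> l -> `|u n| `^ s @[n --> \oo] --> `|l| `^ s.
Proof.
(* Derivability of the power gives continuity away from 0 only; at 0 the estimate is made by
   hand. *)
move=> /cvg_norm ul; have [l0|l0] := eqVneq l 0; last first.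
  apply: (@continuous_cvg _ _ _ _ _ (fun n => `|u n|) (fun x : R => x `^ s) _ _ ul).
  apply/differentiable_continuous/derivable1_diffP.
  by apply: derivable_powR; rewrite in_itv/= normr_gt0 l0.
rewrite l0 normr0 powR0 ?gt_eqF//; apply/cvgrPdist_le => e e0.
rewrite l0 normr0 in ul; near=> n.
rewrite sub0r normrN ger0_norm ?powR_ge0//.
have : `|u n| <= e `^ s^-1.
  near: n; have /cvgrPdist_le := ul; move=> /(_ (e `^ s^-1)).
  rewrite powR_gt0// => /(_ isT); apply: filterS => n.
  by rewrite sub0r normrN normr_id.
move=> H; rewrite [leRHS](_ : e = (e `^ s^-1) `^ s).
  by rewrite ge0_ler_powR ?nnegrE ?powR_ge0 ?(ltW s0).
by rewrite -powRrM mulVf ?gt_eqF// powRr1// ltW.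
Unshelve. all: by end_near. Qed.

Lemma powR_normD_le (a b : R) :
  `|a + b| `^ s <= 2 `^ s * (`|a| `^ s + `|b| `^ s).
Proof.
wlog ab : a b / `|a| <= `|b|.
  move=> H; have [/H//|/ltW/H] := leP `|a| `|b|.
  by rewrite addrC [X in _ * X]addrC.
apply: (@le_trans _ _ ((2 * `|b|) `^ s)).
  rewrite ge0_ler_powR ?nnegrE ?(ltW s0)// ?mulr_ge0//.
  by rewrite (le_trans (ler_normD _ _))// mulr_natl mulr2n lerD2r.
by rewrite powRM// ler_wpM2l ?powR_ge0// lerDr powR_ge0.
Qed.

End powR_norm.

(** * Completeness of L_s *)

Section Lspace_complete.
Context d (T : measurableType d) (R : realType).
Variables (mu : {measure set T -> \bar R}) (s : R) (s1 : 1 <= s).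

Let L : normedModType R := LspaceType mu (lee1_fin s1).

Let s0 : 0 < s. Proof. exact: lt_le_trans s1. Qed.

(** The increments remain summable in norm after multiplication by 2^k, since 4^-k * 2^k = 2^-k. So
    almost everywhere 2^k |f_(k+1) - f_k| is bounded in k, and the increments decay
    geometrically. *)
Lemma fast_Cauchy_cvg_ae (f : (T -> R)^nat) :
  (forall k, measurable_fun setT (f k)) ->
  (forall k, (\int[mu]_t (`|f k.+1 t - f k t| `^ s)%:E <= ((4^-1 ^+ k) `^ s)%:E)%E) ->
  {ae mu, forall t, cvgn (f ^~ t)}.
Proof.
move=> mf fi.
pose h k t := ((2 ^+ k * `|f k.+1 t - f k t|) `^ s)%:E.
have h0 k t : (0 <= h k t)%E by rewrite lee_fin powR_ge0.
have mh k : measurable_fun setT (h k).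
  apply: (eq_measurable_fun (fun t => (`|2 ^+ k * (f k.+1 t - f k t)| `^ s)%:E)).
    by move=> t _; rewrite normrM ger0_norm// exprn_ge0.
  by apply: measurable_powR_norm; apply: measurable_funM => //; exact: measurable_funB.
have : (\int[mu]_t (\sum_(k <oo) h k t) < +oo)%E.
  rewrite integral_nneseries//.
  apply: (@le_lt_trans _ _ 2%:E); last by rewrite ltry.
  apply: nneseries_le; first by move=> k; exact: integral_ge0.
  move=> n; apply: (@le_trans _ _ (series (geometric 1 2^-1) n)%:E); last first.
    rewrite lee_fin; apply: (le_trans (geometric_le_lim _ _ _ _)) => //.
      by rewrite ger0_norm ?invr_ge0// invf_lt1// ltr1n.
    by rewrite le_eqVlt; apply/orP; left; apply/eqP; field.
  rewrite /series/= -sumEFin; apply: lee_sum => k _.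
  rewrite /h; under eq_integral do rewrite powRM ?exprn_ge0// EFinM.
  rewrite ge0_integralZl_EFin//.
  - apply: (@le_trans _ _ (((2 ^+ k) `^ s)%:E * ((4^-1 ^+ k) `^ s)%:E)%E).
      by rewrite lee_wpmul2l ?lee_fin ?powR_ge0.
    rewrite -EFinM lee_fin -powRM ?exprn_ge0 ?invr_ge0// -exprMn.
    rewrite mul1r (_ : 2 * 4^-1 = 2^-1 :> R); last by field.
    by rewrite ge1r_powR// exprn_gt0 ?invr_gt0//= exprn_ile1 ?invr_ge0// invf_le1// ler1n.
  by apply: measurable_powR_norm; exact: measurable_funB.
have mS : measurable_fun setT (fun t =>
    \sum_(k <oo) h k t)%E.
  exact: measurable_nneseries.
have S0 t : (0 <= \sum_(k <oo) h k t)%E by apply: nneseries_ge0.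
move=> /(ge0_integral_lty_ae mS S0); apply: filterS => t ht.
apply: (@cvg_geometric_increments _ _ (fine (\sum_(k <oo) h k t) `^ s^-1)) => k.
have -> : 2 ^+ k * `|f k.+1 t - f k t| = ((2 ^+ k * `|f k.+1 t - f k t|) `^ s) `^ s^-1.
  by rewrite -powRrM mulfV ?gt_eqF// powRr1// mulr_ge0// exprn_ge0.
rewrite ge0_ler_powR ?nnegrE ?invr_ge0 ?(ltW s0) ?powR_ge0 ?fine_ge0//.
rewrite -lee_fin fineK ?ge0_fin_numE//.
exact: (nneseries_term_le k (fun n => h0 n t)).
Qed.

Lemma Lspace_complete (x : nat -> L) :
  (forall e, 0 < e -> exists N, forall m n, (N <= m)%N -> (N <= n)%N -> `|x m - x n| <= e) ->
  exists l, forall e, 0 < e -> exists N, forall n, (N <= n)%N -> `|x n - l| <= e.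
Proof.
move=> xC.
have e0 k : 0 < 4^-1 ^+ k :> R by rewrite exprn_gt0 ?invr_gt0.
have /choice[phi phiP] : forall k, exists N, forall m n, (N <= m)%N -> (N <= n)%N ->
  `|x m - x n| <= 4^-1 ^+ k by move=> k; exact: xC.
(* Both [nk k] and [nk k.+1] dominate [phi k], so consecutive terms of the subsequence are 4^-k
   close; [nk k] also dominates [k], so the subsequence goes to infinity. *)
pose nk k := maxn k (\max_(i < k.+1) phi i).
have nkk k : (k <= nk k)%N by rewrite leq_maxl.
have nkphi k : (phi k <= nk k)%N.
  by rewrite (leq_trans _ (leq_maxr _ _))// (leq_bigmax (@ord_max k)).
have nkphiS k : (phi k <= nk k.+1)%N.
  rewrite (leq_trans _ (leq_maxr _ _))//.
  exact: (leq_bigmax (widen_ord (leqnSn _) (@ord_max k))).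
pose f k : T -> R := Lspace_repr (x (nk k)).
have mf k : measurable_fun setT (f k) by exact: measurable_Lspace_repr.
have aerefl n : {ae mu, forall t, Lspace_repr (x n) t = Lspace_repr (x n) t}.
  exact: aeW.
have fcv : {ae mu, forall t, cvgn (f ^~ t)}.
  apply: fast_Cauchy_cvg_ae => // k.
  rewrite -(Lspace_distE (mf _) (mf _) (aerefl _) (aerefl _)).
  rewrite lee_fin ge0_ler_powR ?nnegrE ?(ltW s0)//; last first.
    exact: phiP.
(* The upper limit is measurable on the whole space, while the limit itself exists only almost
   everywhere. *)
pose F t := fine (limn_esup (fun k => (f k t)%:E)).
have mF : measurable_fun setT F.
  apply: measurableT_comp => //; apply: measurable_fun_limn_esup => k.
  exact/measurable_EFinP.
have fF : {ae mu, forall t, f k t @[k --> \oo] --> F t}.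
  apply: filterS fcv => t ft; rewrite /F.
  have /cvg_limn_einf_sup [_ ->] // : (f k t)%:E @[k --> \oo] --> (limn (f ^~ t))%:E.
  by apply: cvg_EFin => //; exact: nearW.
(* Fatou along the subsequence: the Cauchy bound between [x n] and the later terms passes to the
   limit function. *)
have main e N : 0 < e -> (forall m n, (N <= m)%N -> (N <= n)%N -> `|x m - x n| <= e) ->
    forall n, (N <= n)%N ->
    (\int[mu]_t (`|F t - Lspace_repr (x n) t| `^ s)%:E <= (e `^ s)%:E)%E.
  move=> e_gt0 NP n Nn.
  have mx : measurable_fun setT (Lspace_repr (x n) : T -> R) by exact: measurable_Lspace_repr.
  apply: (@fatou_le _ _ _ _ (fun k t => (`|f (k + N)%N t - Lspace_repr (x n) t| `^ s)%:E)).
  - by move=> k; apply: measurable_powR_norm; exact: measurable_funB.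
  - by apply: measurable_powR_norm; exact: measurable_funB.
  - by move=> k t; rewrite lee_fin powR_ge0.
  - apply: filterS fF => t ft; apply: cvg_EFin; first exact: nearW.
    apply: cvg_powR_norm => //; apply: cvgB; last exact: cvg_cst.
    by rewrite (cvg_shiftn N (f ^~ t)).
  - move=> k; rewrite -(Lspace_distE (mf _) mx (aerefl _) (aerefl _)).
    rewrite lee_fin ge0_ler_powR ?nnegrE ?(ltW s0)//; first exact: ltW.
    by rewrite NP// (leq_trans _ (nkk _))// leq_addl.
have [N0 N0P] := xC 1 ltr01.
have [l lF] : exists l : L, {ae mu, forall t, Lspace_repr l t = F t}.
  apply: Lspace_ex => //.
  pose g := Lspace_repr (x N0) : T -> R.
  have mg : measurable_fun setT g by exact: measurable_Lspace_repr.
  apply: (@le_lt_trans _ _ (\int[mu]_t ((2 `^ s)%:E *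
      ((`|F t - g t| `^ s)%:E + (`|g t| `^ s)%:E)))%E).
    apply: ge0_le_integral => //.
    + exact: measurable_powR_norm.
    + apply: measurable_funeM; apply: emeasurable_funD.
        by apply: measurable_powR_norm; exact: measurable_funB.
      exact: measurable_powR_norm.
    + by move=> t _; rewrite -EFinD -EFinM lee_fin -[F t in leLHS](subrK (g t)) powR_normD_le.
  have mFg : measurable_fun setT (fun t => (`|F t - g t| `^ s)%:E).
    by apply: measurable_powR_norm; exact: measurable_funB.
  have mg' : measurable_fun setT (fun t => (`|g t| `^ s)%:E) by exact: measurable_powR_norm.
  rewrite ge0_integralZl_EFin ?powR_ge0//; last exact: emeasurable_funD.
  rewrite ge0_integralD// lte_mul_pinfty ?lee_fin ?powR_ge0// lte_add_pinfty//.
      by apply: (le_lt_trans (main 1 N0 ltr01 N0P N0 (leqnn _))); exact: ltry.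
  rewrite -(@Lspace_normE _ _ _ mu s s1 (x N0)); exact: ltry.
  by move=> t _; rewrite adde_ge0 ?lee_fin ?powR_ge0.
exists l => e e_gt0; have [N NP] := xC e e_gt0; exists N => n Nn.
rewrite distrC.
have := main e N e_gt0 NP n Nn.
rewrite -(Lspace_distE mF (measurable_Lspace_repr _) lF (aerefl _)) lee_fin.
rewrite leNgt => H; rewrite leNgt; apply: contra H => H.
by rewrite gt0_ltr_powR ?nnegrE// ltW.
Qed.
End Lspace_complete.

Section power_embedding.
Context {R : realType}.

(* [a] and [b] are the exponents of the snowflake: for [a = b = 1] this is a
   bi-Lipschitz embedding. *)
Definition power_embeds (X Y : normedModType R) (a b : R) :=
  exists T : X -> Y, exists c C : R, [/\ 0 < c, 0 <= C &
    forall x y, c * `|x - y| `^ a <= `|T x - T y| `^ b <= C * `|x - y| `^ a].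

Lemma Esum_reducible_power (X Y : normedModType R) (a b p q : R) :
  0 < a -> 0 < b -> 0 < p -> 0 < q -> a / p = b / q ->
  power_embeds X Y a b -> borel_reducible (Esum X p) (Esum Y q).
Proof.
move=> a0 b0 p0 q0 ab [T [c [C [c0 C0 TcC]]]].
(* Raising the two-sided bound to the power [k] turns the exponents a, b into p, q; the equality of
   ratios is what lets a single [k] serve both sides. *)
have [k [k0 aqb bqb]] : exists k, [/\ 0 <= k, a * k = p & b * k = q].
  exists (q / b); split; first by rewrite divr_ge0 ?ltW.
    apply: (@mulfI _ (b / q)); first by rewrite mulf_neq0 ?invr_neq0 ?gt_eqF.
    rewrite -{2}ab divfK ?gt_eqF//; field.
    by rewrite !gt_eqF.
  by rewrite mulrCA mulfV ?gt_eqF// mulr1.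
apply: (@Esum_reducible_holder _ X Y p q (c `^ k) (C `^ k) T) => //.
- exact: powR_gt0.
- exact: powR_ge0.
- move=> x y; have /andP[h _] := TcC x y.
  rewrite -{1}aqb -{1}bqb !powRrM -powRM ?powR_ge0 ?(ltW c0)//.
  by rewrite ge0_ler_powR// nnegrE ?mulr_ge0 ?powR_ge0 ?(ltW c0).
- move=> x y; have /andP[_ h] := TcC x y.
  rewrite -{1}bqb -{1}aqb !powRrM -powRM ?powR_ge0 ?(ltW c0)//.
  by rewrite ge0_ler_powR// nnegrE ?mulr_ge0 ?powR_ge0 ?(ltW c0).
Qed.

End power_embedding.

Section Lspace_maps.
Context d (T : measurableType d) d' (T' : measurableType d') (R : realType).
Variables (mu : {measure set T -> \bar R}) (nu : {measure set T' -> \bar R}).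
Variables (r s : R) (r1 : 1 <= r) (s1 : 1 <= s).

Let X : normedModType R := LspaceType mu (lee1_fin r1).
Let Y : normedModType R := LspaceType nu (lee1_fin s1).

Let r0 : 0 < r. Proof. exact: lt_le_trans r1. Qed.
Let s0 : 0 < s. Proof. exact: lt_le_trans s1. Qed.

Let aerefl (x : X) : {ae mu, forall t, Lspace_repr x t = Lspace_repr x t}.
Proof. exact: aeW. Qed.

Lemma Lspace_fin (x : X) : (\int[mu]_t (`|Lspace_repr x t| `^ r)%:E < +oo)%E.
Proof. by rewrite -(@Lspace_normE _ _ _ mu r r1 x); exact: ltry. Qed.

Lemma Lspace_lift (Phi : (T -> R) -> (T' -> R)) :
  (forall f, measurable_fun setT f -> measurable_fun setT (Phi f)) ->
  (forall f : T -> R, measurable_fun setT f ->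
    (\int[mu]_t (`|f t| `^ r)%:E < +oo)%E ->
    (\int[nu]_t (`|Phi f t| `^ s)%:E < +oo)%E) ->
  exists F : X -> Y, forall x,
    {ae nu, forall t, Lspace_repr (F x) t = Phi (Lspace_repr x) t}.
Proof.
move=> mPhi PhiC.
have H (x : X) : exists y : Y,
  {ae nu, forall t, Lspace_repr y t = Phi (Lspace_repr x) t}.
  apply: Lspace_ex; first exact/mPhi/measurable_Lspace_repr.
  by apply: PhiC; [exact: measurable_Lspace_repr|exact: Lspace_fin].
by have [F FP] := choice H; exists F.
Qed.

(** [Phi 0 = 0] is there so that the upper bound against the zero function shows that [Phi] maps L_r
    into L_s. *)
Lemma Lspace_power_embeds (Phi : (T -> R) -> (T' -> R)) (c C : R) :
  0 < c -> 0 <= C ->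
  (forall f, measurable_fun setT f -> measurable_fun setT (Phi f)) ->
  Phi (fun=> 0) = (fun=> 0) ->
  (forall f g : T -> R, measurable_fun setT f -> measurable_fun setT g ->
    (\int[mu]_t (`|f t| `^ r)%:E < +oo)%E -> (\int[mu]_t (`|g t| `^ r)%:E < +oo)%E ->
    (c%:E * \int[mu]_t (`|f t - g t| `^ r)%:E <= \int[nu]_t (`|Phi f t - Phi g t| `^ s)%:E
      <= C%:E * \int[mu]_t (`|f t - g t| `^ r)%:E)%E) ->
  power_embeds X Y r s.
Proof.
move=> c0 C0 mPhi Phi0 PhicC.
have [|F FPhi] := @Lspace_lift Phi mPhi.
  move=> f mf fin.
  have fin0 : (\int[mu]_t (`|0 : R| `^ r)%:E < +oo)%E.
    under eq_integral do rewrite normr0 powR0 ?gt_eqF//.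
    by rewrite integral0 ltry.
  have /andP[_] := PhicC f (fun=> 0) mf (measurable_cst _) fin fin0.
  rewrite Phi0; under eq_integral do rewrite subr0.
  under [in X in (_ <= _ * X)%E -> _]eq_integral do rewrite subr0.
  by move=> /le_lt_trans; apply; rewrite lte_mul_pinfty.
exists F, c, C; split => // x y; rewrite -!lee_fin.
have m (z : X) : measurable_fun setT (Lspace_repr z : T -> R).
  exact: measurable_Lspace_repr.
rewrite (Lspace_distE (mPhi _ (m x)) (mPhi _ (m y)) (FPhi x) (FPhi y)).
rewrite !EFinM (Lspace_distE (m x) (m y) (aerefl x) (aerefl y)).
by apply: PhicC => //; exact: Lspace_fin.
Qed.

(* The maps [Phi n] are additive and uniformly bounded, so that the pointwise
   limit of their lifts is bi-Lipschitz as soon as it is bounded below. *)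
Lemma Lspace_limit_embeds (Phi : nat -> (T -> R) -> (T' -> R)) (c C : R) :
  0 < c -> 0 <= C ->
  (forall n f, measurable_fun setT f -> measurable_fun setT (Phi n f)) ->
  (forall n f g t, Phi n f t - Phi n g t = Phi n (fun t => f t - g t) t) ->
  (forall n (f g : T -> R), measurable_fun setT f -> measurable_fun setT g ->
    {ae mu, forall t, f t = g t} ->
    \int[nu]_t (`|Phi n f t| `^ s)%:E = \int[nu]_t (`|Phi n g t| `^ s)%:E)%E ->
  (forall (f : T -> R) (A : R) n, measurable_fun setT f -> 0 <= A ->
    (\int[mu]_t (`|f t| `^ r)%:E = (A `^ r)%:E)%E ->
    (\int[nu]_t (`|Phi n f t| `^ s)%:E <= ((C * A) `^ s)%:E)%E) ->
  (forall (f : T -> R) (A : R), measurable_fun setT f -> 0 < A ->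
    (\int[mu]_t (`|f t| `^ r)%:E = (A `^ r)%:E)%E ->
    exists N, forall n, (N <= n)%N ->
    (((c * A) `^ s)%:E <= \int[nu]_t (`|Phi n f t| `^ s)%:E)%E) ->
  (forall f : T -> R, measurable_fun setT f ->
    (\int[mu]_t (`|f t| `^ r)%:E < +oo)%E -> forall e : R, 0 < e ->
    exists N, forall m n, (N <= m)%N -> (N <= n)%N ->
    (\int[nu]_t (`|Phi m f t - Phi n f t| `^ s)%:E <= e%:E)%E) ->
  power_embeds X Y 1 1.
Proof.
move=> c0 C0 mPhi PhiB Phiae PhiC Phic PhiCauchy.
have m (z : X) : measurable_fun setT (Lspace_repr z : T -> R).
  exact: measurable_Lspace_repr.
have /choice[F FPhi] n : exists F : X -> Y, forall x,
    {ae nu, forall t, Lspace_repr (F x) t = Phi n (Lspace_repr x) t}.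
  apply: Lspace_lift; first exact: mPhi.
  move=> f mf fin.
  have If0 : (0 <= \int[mu]_t (`|f t| `^ r)%:E)%E by exact: integral_ge0.
  apply: (@le_lt_trans _ _ ((C * (fine (\int[mu]_t (`|f t| `^ r)%:E) `^ r^-1)) `^ s)%:E)%E;
    last exact: ltry.
  apply: PhiC => //; first exact: powR_ge0.
  rewrite -powRrM mulVf ?gt_eqF// powRr1 ?fine_ge0//.
  by rewrite fineK// ge0_fin_numE.
have FdE n x y : ((`|F n x - F n y| `^ s)%:E =
    \int[nu]_t (`|Phi n (Lspace_repr (x - y)) t| `^ s)%:E)%E.
  rewrite (Lspace_distE (mPhi n _ (m x)) (mPhi n _ (m y)) (FPhi n x) (FPhi n y)).
  under eq_integral do rewrite PhiB.
  apply: Phiae => //; first exact: measurable_funB.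
  by apply: filterS (Lspace_reprB x y) => t ->.
have FC n x y : `|F n x - F n y| <= C * `|x - y|.
  have : ((`|F n x - F n y| `^ s)%:E <= ((C * `|x - y|) `^ s)%:E)%E.
    by rewrite FdE PhiC// -(@Lspace_normE _ _ _ mu r r1 (x - y)).
  rewrite lee_fin => H; rewrite leNgt; apply/negP => H'.
  by move: H; rewrite leNgt gt0_ltr_powR ?nnegrE ?mulr_ge0.
have Fc x y : x != y -> exists N, forall n, (N <= n)%N -> c * `|x - y| <= `|F n x - F n y|.
  move=> xy; have xy0 : 0 < `|x - y| by rewrite normr_gt0 subr_eq0.
  have [N NP] := Phic _ _ (m (x - y)) xy0 (esym (@Lspace_normE _ _ _ mu r r1 (x - y))).
  exists N => n /NP; rewrite -FdE lee_fin => H; rewrite leNgt; apply/negP => H'.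
  by move: H; rewrite leNgt gt0_ltr_powR ?nnegrE ?mulr_ge0// ltW.
have /choice[G GF] (x : X) : exists l : Y, forall e, 0 < e ->
    exists N, forall n, (N <= n)%N -> `|F n x - l| <= e.
  apply: Lspace_complete => e e0.
  have [N NP] := PhiCauchy _ (m x) (Lspace_fin x) (e `^ s) (powR_gt0 _ e0).
  exists N => k l Nk Nl; have := NP k l Nk Nl.
  rewrite -(Lspace_distE (mPhi k _ (m x)) (mPhi l _ (m x)) (FPhi k x) (FPhi l x)).
  rewrite lee_fin => H; rewrite leNgt; apply/negP => H'.
  by move: H; rewrite leNgt gt0_ltr_powR ?nnegrE// ltW.
have FG x y e : 0 < e -> exists N, forall n, (N <= n)%N ->
    `| (F n x - F n y) - (G x - G y)| <= e.
  move=> e0; have e20 : 0 < e / 2 by rewrite divr_gt0.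
  have [N1 N1P] := GF x _ e20; have [N2 N2P] := GF y _ e20.
  exists (maxn N1 N2) => n; rewrite geq_max => /andP[/N1P h1 /N2P h2].
  rewrite (_ : _ - _ = (F n x - G x) - (F n y - G y)); last first.
    by rewrite !opprB [G y - G x]addrC addrACA [- F n y + _]addrC.
  by rewrite (le_trans (ler_normB _ _))// [e]splitr lerD.
exists G, c, C; split => // x y; rewrite !powRr1//; apply/andP; split.
- have [->|xy] := eqVneq x y; first by rewrite !subrr !normr0 mulr0.
  (* The rank of the lower bound depends on the pair x, y, which is harmless since the pair is fixed
     while the stage grows. *)
  apply/ler_addgt0Pr => e e0.
  have [N1 N1P] := Fc _ _ xy; have [N2 N2P] := FG x y e e0.
  apply: (le_trans (N1P (maxn N1 N2) (leq_maxl _ _))).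
  rewrite -lerBlDl; apply: le_trans (N2P (maxn N1 N2) (leq_maxr _ _)).
  exact: lerB_dist.
- apply/ler_addgt0Pr => e e0; have [N NP] := FG x y e e0.
  apply: (@le_trans _ _ (`|F N x - F N y| + e)); last by rewrite lerD2r.
  rewrite -lerBlDl; apply: le_trans (NP N (leqnn _)).
  by rewrite [leRHS]distrC lerB_dist.
Qed.
End Lspace_maps.

(** * A measure isomorphism of the interval and the square *)

Definition image_measure d1 d2 (T1 : measurableType d1) (T2 : measurableType d2)
    (R : realType) (m : {measure set T1 -> \bar R}) (f : T1 -> T2)
    (mf : measurable_fun setT f) : {measure set T2 -> \bar R} :=
  measure_function_pushforward__canonical__measure_function_Measure m mf.

Section unit_interval.
Context {R : realType}.
Local Notation TR := (measurableTypeR R).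
Local Notation lambda := (@lebesgue_measure R).

Definition unif : set TR -> \bar R := mrestr lambda (measurable_itv `[0 : R, 1]).

HB.instance Definition _ := Measure.on unif.

Lemma unif_setT : unif setT = 1%E.
Proof.
by rewrite /unif /mrestr setTI lebesgue_measure_itv/= lte_fin ltr01 sube0.
Qed.

HB.instance Definition _ := Measure_isProbability.Build _ _ _ unif unif_setT.

Lemma lebesgue_measure_affine (c : R) (A : set TR) : measurable A ->
  lambda [set t | A (2 * t - c)] = (2^-1%:E * lambda A)%E.
Proof.
move=> mA.
have mphi : measurable_fun setT (fun t : TR => (2 * t - c : TR)).
  by apply: measurable_funB => //; exact: measurable_funM.
pose m : {measure set TR -> \bar R} := mscale (NngNum (ler0n R 2)) (image_measure lambda mphi).
suff -> : lambda A = m A.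
  by rewrite /m /mscale/= muleA -EFinM mulVf// mul1e.
apply: lebesgue_measure_unique => // _ [[a b] _ <-].
rewrite -[RHS]/(2%:E * lambda ((fun t : TR => (2 * t - c : TR)%R) @^-1` `]a, b]))%E.
rewrite (_ : _ @^-1` _ = `](a + c) / 2, (b + c) / 2])%classic; last first.
  by apply/seteqP; split=> t; rewrite /= !in_itv/= => /andP[? ?]; apply/andP; split; lra.
rewrite !lebesgue_measure_itv/= !lte_fin.
have -> : ((a + c) / 2 < (b + c) / 2) = (a < b) by apply/idP/idP => ?; lra.
case: ifP => _; rewrite ?mule0// -!EFinB -EFinM; congr EFin; by field.
Qed.

Lemma unif_fin (A : set TR) : measurable A -> (unif A <= 1)%E.
Proof. exact: probability_le1. Qed.

(** The first binary digit of a point of [0, 1[; [dbl] is the doubling map, which deletes that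
    digit. *)
Definition hi (t : R) : bool := 2^-1 <= t.
Definition dbl (t : R) : R := 2 * t - (hi t)%:R.

Lemma measurable_hi : measurable [set t : TR | hi t].
Proof.
rewrite (_ : [set t | hi t] = `[2^-1, +oo[)%classic//.
by apply/seteqP; split=> t; rewrite /= in_itv/= andbT.
Qed.

Lemma measurable_hir : measurable_fun setT (fun t : TR => (hi t)%:R : TR).
Proof.
rewrite (_ : (fun _ => _) = \1_[set t | hi t]); first exact: measurable_indic measurable_hi.
by apply/funext => t; rewrite indicE; case: (boolP (hi t)) => h;
  [rewrite mem_set|rewrite memNset//; exact/negP].
Qed.

Lemma measurable_dbl : measurable_fun setT (dbl : TR -> TR).
Proof.
by apply: measurable_funB; [exact: measurable_funM|exact: measurable_hir].
Qed.

Lemma unif_dbl (e : bool) (A : set TR) : measurable A ->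
  unif [set t | hi t = e /\ A (dbl t)] = (2^-1%:E * unif A)%E.
Proof.
move=> mA; rewrite /unif /mrestr; case: e.
  rewrite -(lebesgue_measure_affine 1); last exact: measurableI.
  congr (lambda _); apply/seteqP; split => t /=; rewrite !in_itv/=.
    rewrite /dbl/hi => -[[h At] /andP[t0 t1]]; rewrite h in At; split => //.
    by apply/andP; split; lra.
  rewrite /dbl /hi => -[At /andP[t0 t1]].
  have h : 2^-1 <= t by lra.
  by rewrite h; split => //; apply/andP; split; lra.
(* The lower branch of the doubling map reaches [0, 1[ only: the preimage 1/2 of the endpoint 1 has
   first digit 1. The endpoint is dropped as a null set. *)
have -> : lambda (A `&` `[0, 1]) = lambda (A `&` `[0, 1[).
  have -> : A `&` `[0, 1] = (A `&` `[0, 1[) `|` (A `&` [set 1]).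
    by rewrite -setIUr setUitv1// bnd_simp.
  apply: measureU0; [exact: measurableI|exact: measurableI|].
  apply/eqP; rewrite -measure_le0 -[leRHS](lebesgue_measure_set1 1).
  by apply: le_measure; rewrite ?inE//; exact: measurableI.
rewrite -(lebesgue_measure_affine 0); last exact: measurableI.
congr (lambda _); apply/seteqP; split => t /=; rewrite !in_itv/=.
  rewrite /dbl/hi => -[[h At] /andP[t0 t1]]; rewrite h in At; split => //.
  by apply/andP; split; [lra|]; rewrite leNgt in h; move/negbFE: h => h; lra.
rewrite /dbl /hi => -[At /andP[t0 t1]].
have h : (2^-1 <= t) = false by rewrite leNgt; apply/negbTE; rewrite negbK; lra.
by rewrite h; split => //; apply/andP; split; lra.
Qed.

End unit_interval.

Section bit_splitting.
Context {R : realType}.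
Local Notation TR := (measurableTypeR R).
Local Notation unif := (@unif R).
Local Notation hi := (@hi R).
Local Notation dbl := (@dbl R).

Definition even_bits (t : R) : R^nat :=
  series (fun j => (hi (iter j.*2 dbl t))%:R / 2 ^+ j.+1).

(** The digits of [t] in positions 0, 2, 4, ... make up [psi1 t], those in positions 1, 3, 5, ...
    make up [psi2 t]. *)
Definition psi1 (t : R) : R := limn (even_bits t).
Definition psi2 (t : R) : R := psi1 (dbl t).

Lemma even_bits_bound t n : 0 <= even_bits t n <= 1.
Proof.
apply/andP; split; first by apply: sumr_ge0 => i _; rewrite divr_ge0 ?exprn_ge0.
apply: (@le_trans _ _ (series (geometric 2^-1 2^-1) n)).
  apply: ler_sum => i _; rewrite /geometric/= -exprVn -exprS exprVn.
  rewrite ler_piMl ?invr_ge0 ?exprn_ge0//.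
  by case: (hi _).
apply: (le_trans (geometric_le_lim _ _ _ _)) => //.
  by rewrite ger0_norm ?invr_ge0// invf_lt1// ltr1n.
by rewrite le_eqVlt; apply/orP; left; apply/eqP; field.
Qed.

Lemma cvg_even_bits t : even_bits t n @[n --> \oo] --> psi1 t.
Proof.
apply: nondecreasing_is_cvgn.
  apply/nondecreasing_seqP => n; rewrite /even_bits /series/= big_nat_recr//= lerDl.
  by rewrite divr_ge0 ?exprn_ge0.
by exists 1 => _ [n _ <-]; have /andP[] := even_bits_bound t n.
Qed.

Lemma psi1_bound t : 0 <= psi1 t <= 1.
Proof.
apply/andP; split.
  by apply: limr_ge; [apply/cvg_ex; exists (psi1 t); exact: cvg_even_bits|
    apply: nearW => n; have /andP[] := even_bits_bound t n].
by apply: limr_le; [apply/cvg_ex; exists (psi1 t); exact: cvg_even_bits|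
  apply: nearW => n; have /andP[] := even_bits_bound t n].
Qed.

Lemma psi1_rec t : psi1 t = ((hi t)%:R + psi2 (dbl t)) / 2.
Proof.
have h1 : even_bits t n.+1 @[n --> \oo] --> psi1 t.
  by have := @cvg_even_bits t; rewrite -(cvg_shiftS (even_bits t)).
have h2 : even_bits t n.+1 @[n --> \oo] --> ((hi t)%:R + psi2 (dbl t)) / 2.
  rewrite (_ : (fun n => _) = (fun n => ((hi t)%:R + even_bits (dbl (dbl t)) n) / 2)).
    apply: cvgM; last exact: cvg_cst.
    by apply: cvgD; [exact: cvg_cst|exact: cvg_even_bits].
  apply/funext => n; rewrite /even_bits /series/= big_nat_recl//= expr1.
  rewrite mulrDl; congr (_ + _); rewrite mulr_suml; apply: eq_bigr => i _.
  by rewrite -!iterSr exprS invfM -mulrA [2^-1 * _]mulrC.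
exact: cvg_unique h1 h2.
Qed.

Lemma measurable_iter_dbl n : measurable_fun setT (iter n dbl : TR -> TR).
Proof.
elim: n => [|n IH]; first exact: measurable_id.
by apply: measurableT_comp => //; exact: measurable_dbl.
Qed.

Lemma measurable_psi1 : measurable_fun setT (psi1 : TR -> TR).
Proof.
apply: (measurable_fun_cvg (h := fun n t => even_bits t n)) => [n|t _]; last exact: cvg_even_bits.
apply: measurable_sum => j; apply: measurable_funM => //.
by apply: (measurableT_comp measurable_hir); exact: measurable_iter_dbl.
Qed.

Lemma measurable_psi2 : measurable_fun setT (psi2 : TR -> TR).
Proof. by apply: measurableT_comp; [exact: measurable_psi1|exact: measurable_dbl]. Qed.

Let S (a b : R) : set TR := [set t | a < psi1 t /\ b < psi2 t].

Let mS a b : measurable (S a b).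
Proof.
rewrite (_ : S a b = psi1 @^-1` `]a, +oo[ `&` psi2 @^-1` `]b, +oo[)%classic.
  apply: measurableI; rewrite -[X in measurable X]setTI.
    exact: measurable_psi1.
  exact: measurable_psi2.
by apply/seteqP; split => t /=; rewrite !in_itv/= !andbT.
Qed.

Let G a b : R := fine (unif (S a b)).

Let GE a b : unif (S a b) = (G a b)%:E.
Proof. by rewrite fineK// fin_num_measure. Qed.

(** Deleting the first digit exchanges the two subsequences of digits: [psi2 t] is [psi1 (dbl t)],
    and [psi1 t] is half of the deleted digit plus [psi2 (dbl t)]. Hence the swapped arguments. *)
Let G_rec a b : G a b = (G b (2 * a) + G b (2 * a - 1)) / 2.
Proof.
apply: EFin_inj; rewrite -GE.
have -> : S a b = [set t | hi t = false /\ S b (2 * a) (dbl t)] `|`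
                  [set t | hi t = true /\ S b (2 * a - 1) (dbl t)].
  apply/seteqP; split => t; rewrite /S/=.
    rewrite psi1_rec -/(psi2 t).
    case: (hi t) => /= -[h1 h2]; [right|left]; split => //; split => //; lra.
  rewrite [psi1 t]psi1_rec -[psi1 (dbl t)]/(psi2 t).
  by move=> [] [-> [h1 h2]]; split => //=; lra.
have mT e A : measurable A -> measurable [set t : TR | hi t = e /\ A (dbl t)].
  move=> mA.
  have -> : [set t : TR | hi t = e /\ A (dbl t)] =
      (if e then [set t | hi t] else ~` [set t | hi t]) `&` (dbl @^-1` A).
    by case: e; apply/seteqP; split => t /= [h1 h2]; split => //; rewrite ?h1//; apply/negbTE/negP.
  apply: measurableI.
    by case: e; [|apply: measurableC]; exact: measurable_hi.
  by rewrite -[X in measurable X]setTI; apply: measurable_dbl.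
rewrite measureU; [|exact: (mT false _ (mS _ _))|exact: (mT true _ (mS _ _))|].
  transitivity ((2^-1%:E * unif (S b (2 * a))) + (2^-1%:E * unif (S b (2 * a - 1)%R)))%E.
    by congr (_ + _)%E; [exact: (unif_dbl false (mS _ _))|exact: (unif_dbl true (mS _ _))].
  rewrite !GE.
  by rewrite -!EFinM -EFinD; congr EFin; lra.
by apply/seteqP; split => t //= -[[-> _] []].
Qed.

Let u (x : R) : R := Num.min 1 (Num.max 0 (1 - x)).

Let u_rec a : u a = (u (2 * a) + u (2 * a - 1)) / 2.
Proof.
rewrite /u /Num.min /Num.max.
by repeat case: ifP => //; lra.
Qed.

(** [u x] is the measure of the ray above x. The product of two such measures solves the recursion
    of [G], so the defect [D] solves it too, and iterating the recursion forces it to 0. *)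
Let D a b := G a b - u a * u b.

Let D_rec a b : D a b = (D b (2 * a) + D b (2 * a - 1)) / 2.
Proof. by rewrite /D G_rec (u_rec a); lra. Qed.

Let S0 a b : (1 <= a) || (1 <= b) -> S a b = set0.
Proof.
move=> ab; apply/seteqP; split => t // -[].
have /andP[_ h1] := psi1_bound t; have /andP[_ h2] := psi1_bound (dbl t).
by rewrite /psi2; case/orP: ab; lra.
Qed.

Let ST a b : a < 0 -> b < 0 -> S a b = setT.
Proof.
move=> a0 b0; apply/seteqP; split => t // _; split.
  by have /andP[h1 _] := psi1_bound t; lra.
by have /andP[h1 _] := psi1_bound (dbl t); rewrite /psi2; lra.
Qed.

Let u1 a : 1 <= a -> u a = 0.
Proof. by rewrite /u /Num.min /Num.max; repeat case: ifP => //; lra. Qed.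

Let u0 a : a < 0 -> u a = 1.
Proof. by rewrite /u /Num.min /Num.max; repeat case: ifP => //; lra. Qed.

Let u01 a : 0 <= u a <= 1.
Proof. by rewrite /u /Num.min /Num.max; repeat case: ifP => //; lra. Qed.

Let D0 a b : (1 <= a) || (1 <= b) -> D a b = 0.
Proof.
move=> ab; rewrite /D /G S0// measure0/=.
by case/orP: ab => /u1 ->; rewrite ?mulr0 ?mul0r subr0.
Qed.

Let D1 a b : a < 0 -> b < 0 -> D a b = 0.
Proof. by move=> a0 b0; rewrite /D /G ST// unif_setT/= !u0// mulr1 subrr. Qed.

(* Two steps of the recursion reach only one or two of the four dyadic
   quarters on which [D] does not vanish identically. *)
Let D_le n a b : `|D a b| <= (3 / 4) ^+ n.
Proof.
elim: n a b => [|n IH] a b.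
  have /andP[u1_ u2_] := u01 a; have /andP[v1_ v2_] := u01 b.
  have G0 : 0 <= G a b by rewrite fine_ge0.
  have G1 : G a b <= 1 by rewrite -lee_fin -GE; exact: unif_fin.
  rewrite expr0 ler_norml /D; apply/andP; split; nra.
have M0 : 0 <= (3 / 4 : R) ^+ n by rewrite exprn_ge0.
have half x y : 1 <= x -> `|D x y| <= 0 by move=> h; rewrite D0 ?h// normr0.
rewrite exprS D_rec normrM normfV [`|2|]ger0_norm// ler_pdivrMr//.
apply: (le_trans (ler_normD _ _)).
have IH1 := IH b (2 * a); have IH2 := IH b (2 * a - 1).
have [a2|a2] := leP 2^-1 a.
  by rewrite D0 ?normr0; [lra|apply/orP; right; lra].
have [b2|b2] := leP 2^-1 b.
  have h x : `|D b x| <= (3 / 4) ^+ n / 2.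
    rewrite D_rec normrM normfV [`|2|]ger0_norm// ler_pdivrMr//.
    apply: (le_trans (ler_normD _ _)).
    rewrite D0 ?normr0; last by apply/orP; right; lra.
    by have := IH x (2 * b - 1); lra.
  by have := h (2 * a); have := h (2 * a - 1); lra.
(* Worst case, a and b below 1/2: both 2a - 1 and 2b - 1 are negative, so one of the two terms is
   halved by a second step and the bound becomes (1 + 1/2) / 2 = 3/4. *)
have : `|D b (2 * a - 1)| <= (3 / 4) ^+ n / 2.
  rewrite D_rec normrM normfV [`|2|]ger0_norm// ler_pdivrMr//.
  apply: (le_trans (ler_normD _ _)).
  rewrite [D _ (2 * b - 1)]D1 ?normr0; [|lra|lra].
  by have := IH (2 * a - 1) (2 * b); lra.
lra.
Qed.

Let D_eq0 a b : D a b = 0.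
Proof.
apply/eqP; rewrite -normr_le0.
have h : (3 / 4 : R) ^+ n @[n --> \oo] --> (0 : R).
  by apply: cvg_expr; rewrite ger0_norm; lra.
by apply: (cvgr_to_ge h); apply: nearW => n; exact: D_le.
Qed.

Let clip (x : R) : unif `]x, +oo[%classic = (u x)%:E.
Proof.
rewrite /unif /mrestr /u /Num.min /Num.max.
have [x1|x1] := leP 1 x.
  rewrite (_ : _ `&` _ = set0) ?measure0.
    by congr EFin; repeat case: ifP => //; lra.
  by apply/seteqP; split => t //=; rewrite !in_itv/= andbT => -[?] /andP[]; lra.
have [x0|x0] := ltP x 0.
  rewrite (_ : _ `&` _ = `[0, 1]%classic).
    rewrite lebesgue_measure_itv/= lte_fin ltr01 oppr0 adde0.
    by congr EFin; repeat case: ifP => //; lra.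
  apply/seteqP; split => t /=; rewrite !in_itv/= andbT; first by case.
  move=> /andP[t0 t1]; split; [lra|exact/andP].
rewrite (_ : _ `&` _ = `]x, 1]%classic).
  rewrite lebesgue_measure_itv/= lte_fin x1 -EFinB.
  by congr EFin; repeat case: ifP => //; lra.
apply/seteqP; split => t /=; rewrite !in_itv/= ?andbT.
  by move=> [? /andP[? ?]]; apply/andP; split; lra.
by move=> /andP[? ?]; split; [lra|apply/andP; split; lra].
Qed.

Let unif_S a b : unif (S a b) = (unif `]a, +oo[%classic * unif `]b, +oo[%classic)%E.
Proof.
rewrite GE !clip -EFinM; congr EFin.
by apply/eqP; rewrite -subr_eq0; apply/eqP; exact: D_eq0.
Qed.

Let rays_unique (m1 m2 : {measure set TR -> \bar R}) : (m1 setT < +oo)%E ->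
  (forall x : R, m1 `]x, +oo[%classic = m2 `]x, +oo[%classic) ->
  forall A, measurable A -> m1 A = m2 A.
Proof.
move=> m1T m12 A mA.
apply: (@measure_unique _ R TR (@RGenOInfty.G R) (fun k => `]- k%:R, +oo[%classic)) => //.
- exact: (RGenOInfty.measurableE R).
- move=> _ _ [x ->] [y ->]; exists (Num.max x y).
  apply/seteqP; split => t /=; rewrite !in_itv/= !andbT gt_max.
    by move=> [-> ->].
  by move=> /andP[].
- by move=> k; exists (- k%:R).
- rewrite -subTset => t _; exists (Num.truncn `|t|).+1 => //=.
  rewrite in_itv/= andbT ltrNl (le_lt_trans (ler_norm _))// normrN.
  exact: truncnS_gt.
- by move=> _ [x ->]; exact: m12.
- move=> k; apply: (le_lt_trans _ m1T).
  by apply: le_measure; rewrite ?inE.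
Qed.

Let mpre (f : TR -> TR) (B : set TR) : measurable_fun setT f -> measurable B ->
  measurable (f @^-1` B).
Proof. by move=> mf mB; rewrite -[X in measurable X]setTI; exact: mf. Qed.

Lemma unif_psi (A B : set TR) : measurable A -> measurable B ->
  unif (psi1 @^-1` A `&` psi2 @^-1` B) = (unif A * unif B)%E.
Proof.
have m1 := measurable_psi1; have m2 := measurable_psi2.
(* Uniqueness on rays is used one coordinate at a time: the first set becomes arbitrary while the
   second is still a ray. *)
have step1 (b : R) C : measurable C ->
    unif (psi1 @^-1` C `&` psi2 @^-1` `]b, +oo[) = (unif C * unif `]b, +oo[%classic)%E.
  move=> mC.
  pose n1 := image_measure (mrestr unif (mpre m2 (measurable_itv `]b, +oo[))) m1.
  have ub0 : 0 <= fine (unif `]b, +oo[%classic) by rewrite fine_ge0.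
  pose n2 : {measure set TR -> \bar R} := mscale (NngNum ub0) unif.
  have n2E E : n2 E = (unif E * unif `]b, +oo[%classic)%E.
    rewrite muleC -[LHS]/((fine (unif `]b, +oo[%classic))%:E * unif E)%E.
    by rewrite fineK// fin_num_measure.
  rewrite -n2E; apply: (rays_unique (m1 := n1)) => //.
    apply: (@le_lt_trans _ _ 1%E); last exact: ltry.
    by apply: unif_fin; apply: measurableI; exact: mpre.
  move=> x; rewrite n2E -unif_S; congr (unif _).
  by apply/seteqP; split => t /=; rewrite !in_itv/= !andbT.
move=> mA mB.
pose n1 := image_measure (mrestr unif (mpre m1 mA)) m2.
have uA0 : 0 <= fine (unif A) by rewrite fine_ge0.
pose n2 : {measure set TR -> \bar R} := mscale (NngNum uA0) unif.
have n2E E : n2 E = (unif A * unif E)%E.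
  rewrite -[LHS]/((fine (unif A))%:E * unif E)%E.
  by rewrite fineK// fin_num_measure.
rewrite -n2E setIC; apply: (rays_unique (m1 := n1)) => //.
  apply: (@le_lt_trans _ _ 1%E); last exact: ltry.
  by apply: unif_fin; apply: measurableI; exact: mpre.
by move=> x; rewrite n2E -step1// setIC.
Qed.

(* [(psi1, psi2)] maps the unit interval onto the unit square, preserving
   measure. *)
Lemma integral_psi (H : TR * TR -> \bar R) : measurable_fun setT H ->
  (forall z, 0 <= H z)%E ->
  (\int[unif]_t H (psi1 t, psi2 t) = \int[unif]_x \int[unif]_y H (x, y))%E.
Proof.
move=> mH H0; rewrite -(fubini_tonelli1 H)//.
have mpsi : measurable_fun setT (fun t : TR => (psi1 t : TR, psi2 t : TR)).
  exact: measurable_fun_pair measurable_psi1 measurable_psi2.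
rewrite (eq_measure_integral (image_measure unif mpsi)).
  by rewrite ge0_integral_pushforward.
move=> C mC _; apply: product_measure_unique => // A B mA mB.
exact: unif_psi.
Qed.

End bit_splitting.

(** * Rademacher sums *)

Section rademacher.
Context {R : realType}.
Local Notation TR := (measurableTypeR R).
Local Notation unif := (@unif R).
Implicit Types (a : R^nat) (n k : nat).

(** Splitting off [psi1] and splitting the rest again turns one uniform point into a sequence of
    independent uniform points. *)
Definition coord k (t : R) : R := psi1 (iter k psi2 t).
Definition sign (t : R) : R := if hi t then -1 else 1.
Definition rad k (t : R) : R := sign (coord k t).
Definition rsum n a (t : R) : R := \sum_(k < n) a k * rad k t.

Lemma measurable_iter_psi2 n : measurable_fun setT (iter n psi2 : TR -> TR).
Proof.
elim: n => [|n IH]; first exact: measurable_id.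
by apply: measurableT_comp => //; exact: measurable_psi2.
Qed.

Lemma measurable_coord k : measurable_fun setT (coord k : TR -> TR).
Proof. by apply: measurableT_comp; [exact: measurable_psi1|exact: measurable_iter_psi2]. Qed.

Lemma measurable_sign : measurable_fun setT (sign : TR -> TR).
Proof.
rewrite (_ : sign = fun t => 1 - 2 * (hi t)%:R); last first.
  by by apply/funext => t; rewrite /sign; case: hi => /=; lra.
by apply: measurable_funB => //; apply: measurable_funM => //; exact: measurable_hir.
Qed.

Lemma measurable_rad k : measurable_fun setT (rad k : TR -> TR).
Proof. by apply: measurableT_comp; [exact: measurable_sign|exact: measurable_coord]. Qed.

Lemma measurable_rsum n a : measurable_fun setT (rsum n a : TR -> TR).
Proof.
by apply: measurable_sum => k; apply: measurable_funM => //; exact: measurable_rad.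
Qed.

Lemma rsumS n a t :
  rsum n.+1 a t = a 0%N * sign (psi1 t) + rsum n (a \o succn) (psi2 t).
Proof.
rewrite /rsum big_ord_recl; congr (_ + _); apply: eq_bigr => k _.
by rewrite /rad /coord lift0 -iterSr.
Qed.

Lemma rsumB n a b t : rsum n a t - rsum n b t = rsum n (fun k => a k - b k) t.
Proof. by rewrite /rsum -sumrB; apply: eq_bigr => k _; rewrite mulrBl. Qed.

Lemma rsumZ n (c : R) a t : rsum n (fun k => c * a k) t = c * rsum n a t.
Proof. by rewrite /rsum mulr_sumr; apply: eq_bigr => k _; rewrite mulrA. Qed.

Lemma integral_unif_cst (c : \bar R) : (\int[unif]_t c = c)%E.
Proof.
rewrite (integral_cst unif measurableT c).
exact: etrans (congr1 (fun z => c * z)%E unif_setT) (mule1 c).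
Qed.

Lemma integral_sign (F : R -> \bar R) : (forall x, 0 <= F x)%E ->
  (\int[unif]_x F (sign x) = 2^-1%:E * F 1%R + 2^-1%:E * F (-1)%R)%E.
Proof.
move=> F0; have mh := @measurable_hi R.
have half e : unif [set t | hi t = e] = 2^-1%:E.
  rewrite -[RHS]mule1 -(@unif_setT R) -(unif_dbl e) //; last first.
    by congr (unif _); apply/seteqP; split => t //= [].
have mE e : measurable [set t : TR | hi t = e].
  case: e => //; rewrite (_ : [set _ | _] = ~` [set t | hi t]); first exact: measurableC.
  by apply/seteqP; split => t /=; [move=> ->|move/negP/negbTE].
have -> : (\int[unif]_x F (sign x) =
   \int[unif]_(x in [set t | hi t = false] `|` [set t | hi t = true]) F (sign x))%E.
  congr (integral _ _ _); apply/seteqP; split => t // _ /=.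
  by case: (hi t); [right|left].
have cst e : (\int[unif]_(x in [set t | hi t = e]) F (sign x) =
    2^-1%:E * F (if e then -1 else 1)%R)%E.
  rewrite (eq_integral (fun=> F (if e then -1 else 1))).
    by rewrite integral_cst// muleC; congr (_ * _)%E; exact: half.
  by move=> x; rewrite inE /sign/= => ->.
rewrite ge0_integral_setU// ?cst//.
  apply/measurable_funU => //; split.
    by apply: (eq_measurable_fun (fun _ : TR => F 1)) => // x; rewrite inE /sign/= => ->.
  by apply: (eq_measurable_fun (fun _ : TR => F (-1))) => // x; rewrite inE /sign/= => ->.
by apply/disj_setPS => t [/= ->].
Qed.

(** The first sign depends on [psi1 t] and the remaining sum on [psi2 t], which are independent; the
    first sign is averaged out. Every moment below is an induction on [n] through this formula. *)
Lemma integral_rsumS n a (phi : R -> R) :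
  measurable_fun setT (phi : TR -> TR) -> (forall x, 0 <= phi x) ->
  (\int[unif]_t (phi (rsum n.+1 a t))%:E =
   \int[unif]_t (2^-1 * (phi (a 0%N + rsum n (a \o succn) t) +
                         phi (- a 0%N + rsum n (a \o succn) t)))%:E)%E.
Proof.
move=> mphi phi0; set b := a \o succn.
pose H (z : TR * TR) := (phi (a 0%N * sign z.1 + rsum n b z.2))%:E.
have mH : measurable_fun setT H.
  apply/measurable_EFinP; apply: measurableT_comp => //; apply: measurable_funD.
    apply: measurable_funM => //.
    by apply: (measurableT_comp measurable_sign); exact: measurable_fst.
  by apply: (measurableT_comp (measurable_rsum n b)); exact: measurable_snd.
have H0 z : (0 <= H z)%E by rewrite lee_fin.
transitivity (\int[unif]_t H (psi1 t, psi2 t))%E.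
  by apply: eq_integral => t _; rewrite /H/= rsumS.
rewrite integral_psi//.
have mc c : measurable_fun setT (fun t => (phi (c + rsum n b t))%:E).
  apply/measurable_EFinP; apply: measurableT_comp => //; apply: measurable_funD => //.
  exact: measurable_rsum.
rewrite (integral_sign (F := fun c => \int[unif]_y (phi (a 0%N * c + rsum n b y))%:E)%E).
  rewrite -ge0_integralZl_EFin//; [|by move=> *; rewrite lee_fin|exact: mc].
  rewrite -ge0_integralZl_EFin//; [|by move=> *; rewrite lee_fin|exact: mc].
  rewrite -ge0_integralD//.
  - by apply: eq_integral => t _; rewrite mulr1 mulrN1 -!EFinM -EFinD mulrDr.
  - by move=> t _; rewrite mule_ge0 ?lee_fin.
  - by apply: measurable_funeM; exact: mc.
  - by move=> t _; rewrite mule_ge0 ?lee_fin.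
  - by apply: measurable_funeM; exact: mc.
by move=> c; apply: integral_ge0 => t _; rewrite lee_fin.
Qed.

Lemma integral_rsum_sqr n a :
  (\int[unif]_t (rsum n a t ^+ 2)%:E = (\sum_(k < n) a k ^+ 2)%:E)%E.
Proof.
elim: n a => [|n IH] a.
  rewrite big_ord0 (eq_integral (cst 0%E)) ?integral0// => t _.
  by rewrite /rsum big_ord0 expr0n.
rewrite (integral_rsumS n a (phi := fun x => x ^+ 2))//; last first.
  by move=> x; exact: sqr_ge0.
transitivity (\int[unif]_t ((a 0%N ^+ 2)%:E + (rsum n (a \o succn) t ^+ 2)%:E))%E.
  by apply: eq_integral => t _; rewrite -EFinD; congr EFin; field.
rewrite ge0_integralD//.
- by rewrite integral_unif_cst IH -EFinD big_ord_recl.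
- by move=> *; rewrite lee_fin sqr_ge0.
- by move=> *; rewrite lee_fin sqr_ge0.
- by apply/measurable_EFinP; apply: measurable_funX; exact: measurable_rsum.
Qed.

(** Averaging over the first sign can only lower the integral: with x = a_0 and S the rest, |x + S|
    + |S - x| is at least both 2|x| and 2|S|. The first bound isolates the coefficient of index 0,
    the second drops it. *)
Lemma integral_rsum_abs_ge n a k : (k < n)%N ->
  (`|a k|%:E <= \int[unif]_t `|rsum n a t|%:E)%E.
Proof.
elim: n a k => [//|n IH] a k kn.
rewrite (integral_rsumS n a (phi := fun x => `|x|))//.
case: k kn => [_|k kn].
  apply: (@le_trans _ _ (\int[unif]_t `|a 0%N|%:E)%E).
    by rewrite integral_unif_cst.
  apply: ge0_le_integral => //.
    apply/measurable_EFinP; apply: measurable_funM => //; apply: measurable_funD;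
      by apply: measurableT_comp => //; apply: measurable_funD => //; exact: measurable_rsum.
  move=> t _; rewrite lee_fin.
  have := ler_normB (a 0%N + rsum n (a \o succn) t) (- a 0%N + rsum n (a \o succn) t).
  have -> : a 0%N + rsum n (a \o succn) t - (- a 0%N + rsum n (a \o succn) t) = 2 * a 0%N.
    by ring.
  by rewrite normrM ger0_norm//; lra.
apply: (le_trans (IH (a \o succn) k kn)).
apply: ge0_le_integral => //.
- by apply/measurable_EFinP; apply: measurableT_comp => //; exact: measurable_rsum.
- apply/measurable_EFinP; apply: measurable_funM => //; apply: measurable_funD;
    by apply: measurableT_comp => //; apply: measurable_funD => //; exact: measurable_rsum.
move=> t _; rewrite lee_fin.
have := ler_normD (a 0%N + rsum n (a \o succn) t) (- a 0%N + rsum n (a \o succn) t).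
have -> : a 0%N + rsum n (a \o succn) t + (- a 0%N + rsum n (a \o succn) t) =
  2 * rsum n (a \o succn) t by ring.
by rewrite normrM ger0_norm//; lra.
exact: normr_measurable.
Qed.

Lemma cosh_le (x : R) : 2^-1 * (expR x + expR (- x)) <= expR (2 * x ^+ 2).
Proof.
wlog x0 : x / 0 <= x.
  move=> H; have [/H//|x0] := leP 0 x.
  by have := H (- x); rewrite opprK sqrrN addrC; apply; lra.
(* For x >= 1/2 already x <= 2x^2. Below, e^x <= 1 / (1 - x) <= 1 + x + 2x^2, whose last inequality
   amounts to x <= 1/2; the nonoptimal factor 2 pays for this. *)
have [x2|x2] := leP x 2^-1; last first.
  apply: (@le_trans _ _ (expR x)).
    have : expR (- x) <= expR x by rewrite ler_expR; lra.
    by lra.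
  by rewrite ler_expR; nra.
apply: (@le_trans _ _ (1 + 2 * x ^+ 2)); last exact: expR_ge1Dx.
have e1 : expR x <= 1 + x + 2 * x ^+ 2.
  have h : 1 - x <= expR (- x) by have := expR_ge1Dx (- x).
  rewrite -[expR x]invrK -expRN.
  rewrite -[leRHS]invrK lef_pV2 ?posrE ?expR_gt0//; last by rewrite invr_gt0; nra.
  apply: le_trans h; rewrite -[leLHS]mul1r ler_pdivrMr; nra.
have e2 : expR (- x) <= 1 - x + 2 * x ^+ 2.
  have h : 1 + x <= expR x by exact: expR_ge1Dx.
  rewrite expRN -[leRHS]invrK lef_pV2 ?posrE ?expR_gt0//; last by rewrite invr_gt0; nra.
  apply: le_trans h; rewrite -[leLHS]mul1r ler_pdivrMr; nra.
lra.
Qed.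

Lemma integral_rsum_exp n a :
  (\int[unif]_t (expR (rsum n a t))%:E <= (expR (2 * \sum_(k < n) a k ^+ 2))%:E)%E.
Proof.
elim: n a => [|n IH] a.
  rewrite big_ord0 mulr0 expR0 (eq_integral (cst 1%E)).
    by rewrite integral_unif_cst.
  by move=> t _; rewrite /rsum big_ord0 expR0.
rewrite (integral_rsumS n a (phi := @expR R))//.
under eq_integral do rewrite !expRD -mulrDl mulrA EFinM.
rewrite ge0_integralZl_EFin//.
- rewrite big_ord_recl (mulrDr 2) expRD [leRHS]EFinM; apply: lee_pmul => //.
  + by apply: integral_ge0 => *; rewrite lee_fin expR_ge0.
  + by rewrite lee_fin cosh_le.
- by apply/measurable_EFinP; apply: measurableT_comp => //; exact: measurable_rsum.
Qed.

End rademacher.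

(** * Khintchine inequalities *)

Section powR_bounds.
Context {R : realType}.

Lemma powR_tangent (s l x : R) : 1 <= s -> 0 < l -> 0 <= x ->
  l `^ (s - 1) * x <= x `^ s + l `^ s.
Proof.
move=> s1 l0 x0; have s0 : 0 < s by rewrite (lt_le_trans _ s1).
have [xl|lx] := leP x l.
  rewrite -(mulr_powRB1 (ltW l0) s0) mulrC.
  rewrite (@le_trans _ _ (l * l `^ (s - 1)))// ?ler_wpM2r ?powR_ge0//.
  by rewrite lerDr powR_ge0.
rewrite -(mulr_powRB1 x0 s0) mulrC (@le_trans _ _ (x * x `^ (s - 1)))//.
  rewrite ler_wpM2l// ge0_ler_powR ?nnegrE ?subr_ge0 ?(ltW l0)//.
  exact: ltW.
by rewrite lerDl powR_ge0.
Qed.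

Lemma powR_le_expR (s x : R) : 0 < s -> 0 <= x -> x `^ s <= s `^ s * expR x.
Proof.
move=> s0 x0; have -> : x = s * (x / s) by field; rewrite gt_eqF.
rewrite powRM ?divr_ge0 ?(ltW s0)// ler_wpM2l ?powR_ge0//.
rewrite [s * (x / s)]mulrC expRM ge0_ler_powR ?nnegrE ?(ltW s0) ?divr_ge0 ?expR_ge0 ?(ltW s0)//.
by apply: le_trans (expR_ge1Dx _); rewrite lerDr.
Qed.

Lemma norm_powR_le_expR (s x : R) : 0 < s ->
  `|x| `^ s <= s `^ s * (expR x + expR (- x)).
Proof.
move=> s0; apply: (le_trans (powR_le_expR s0 (normr_ge0 x))).
rewrite ler_wpM2l ?powR_ge0//; case: (ger0P x) => _.
  by rewrite lerDl expR_ge0.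
by rewrite lerDr expR_ge0.
Qed.

End powR_bounds.

Section lower_moment.
Context d (T : measurableType d) (R : realType) (P : probability T R).

Lemma integral_cst_probability (c : \bar R) : (\int[P]_x c = c)%E.
Proof.
rewrite (integral_cst P measurableT c).
exact: etrans (congr1 (fun z => c * z)%E (probability_setT P)) (mule1 c).
Qed.

(** A weak form of Jensen: integrating [powR_tangent] at l = t gives 2 t^s <= E|f|^s + t^s, so the
    price is the factor 2 in the hypothesis. *)
Lemma Lp_ge_L1 (f : T -> R) (s t : R) : measurable_fun setT f -> 1 <= s -> 0 < t ->
  ((2 * t)%:E <= \int[P]_x `|f x|%:E)%E ->
  ((t `^ s)%:E <= \int[P]_x (`|f x| `^ s)%:E)%E.
Proof.
move=> mf s1 t0 tf.
have mfs : measurable_fun setT (fun x => (`|f x| `^ s)%:E) by exact: measurable_powR_norm.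
have h : ((t `^ (s - 1) * (2 * t))%:E <= \int[P]_x (`|f x| `^ s)%:E + (t `^ s)%:E)%E.
  rewrite EFinM; apply: (@le_trans _ _ ((t `^ (s - 1))%:E * \int[P]_x `|f x|%:E)%E).
    by rewrite lee_wpmul2l ?lee_fin ?powR_ge0.
  have mnf : measurable_fun setT (fun x => `|f x|%:E).
    by apply/measurable_EFinP; apply: measurableT_comp.
  rewrite -ge0_integralZl_EFin ?powR_ge0//.
  apply: (@le_trans _ _ (\int[P]_x ((`|f x| `^ s)%:E + (t `^ s)%:E))%E).
    apply: ge0_le_integral => //.
    - by move=> x _; rewrite mule_ge0 ?lee_fin ?powR_ge0.
    - exact: measurable_funeM.
    - exact: emeasurable_funD.
    - by move=> x _; rewrite -EFinM -EFinD lee_fin powR_tangent.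
  rewrite ge0_integralD//.
  by rewrite integral_cst_probability.
  by move=> x _; rewrite lee_fin powR_ge0.
have : ((t `^ s)%:E + (t `^ s)%:E <= \int[P]_x (`|f x| `^ s)%:E + (t `^ s)%:E)%E.
  apply: le_trans h; rewrite -EFinD lee_fin -(mulr_powRB1 (ltW t0) (lt_le_trans ltr01 s1)).
  by rewrite le_eqVlt; apply/orP; left; apply/eqP; ring.
by rewrite leeD2rE.
Qed.

End lower_moment.

Section khintchine.
Context {R : realType}.
Local Notation TR := (measurableTypeR R).
Local Notation unif := (@unif R).
Implicit Types (a : R^nat) (n k : nat).

(** For coefficients of square sum at most 1, |X|^s <= s^s (e^X + e^-X), and each exponential has
    mean at most e^2. *)
Definition khintchine_cst (s : R) : R := s `^ s * (2 * expR 2).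

Lemma khintchine_cst_gt0 s : 0 < s -> 0 < khintchine_cst s.
Proof. by move=> s0; rewrite mulr_gt0 ?powR_gt0// mulr_gt0// expR_gt0. Qed.

Lemma rsumN n a t : rsum n (fun k => - a k) t = - rsum n a t.
Proof. by rewrite /rsum -sumrN; apply: eq_bigr => k _; rewrite mulNr. Qed.

Lemma measurable_rsum_powR n a (s : R) :
  measurable_fun setT (fun t : TR => (`|rsum n a t| `^ s)%:E).
Proof. by apply: measurable_powR_norm; exact: measurable_rsum. Qed.

Let khintchine_norm1 n a s : 0 < s -> \sum_(k < n) a k ^+ 2 <= 1 ->
  (\int[unif]_t (`|rsum n a t| `^ s)%:E <= (khintchine_cst s)%:E)%E.
Proof.
move=> s0 a1; have mr := measurable_rsum n a.
have mp : measurable_fun setT (fun t : TR => (expR (rsum n a t))%:E).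
  by apply/measurable_EFinP; apply: measurableT_comp.
have mm : measurable_fun setT (fun t : TR => (expR (- rsum n a t))%:E).
  by apply/measurable_EFinP; apply: measurableT_comp => //; exact: measurableT_comp.
apply: (@le_trans _ _ (\int[unif]_t ((s `^ s)%:E *
    ((expR (rsum n a t))%:E + (expR (- rsum n a t))%:E)))%E).
  apply: ge0_le_integral => //.
  - exact: measurable_rsum_powR.
  - by apply: measurable_funeM; exact: emeasurable_funD.
  - by move=> t _; rewrite -EFinD -EFinM lee_fin norm_powR_le_expR.
rewrite ge0_integralZl_EFin ?powR_ge0//; last 2 first.
  by move=> t _; rewrite adde_ge0 ?lee_fin ?expR_ge0.
  exact: emeasurable_funD.
rewrite ge0_integralD//.
rewrite /khintchine_cst EFinM lee_wpmul2l ?lee_fin ?powR_ge0//.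
rewrite (_ : 2 * _ = expR 2 + expR 2)%R; last by ring.
rewrite EFinD leeD//.
  by apply: (le_trans (integral_rsum_exp n a)); rewrite lee_fin ler_expR; lra.
under eq_integral do rewrite -rsumN.
apply: (le_trans (integral_rsum_exp n _)); rewrite lee_fin ler_expR.
by under eq_bigr do rewrite sqrrN; lra.
Qed.

Lemma khintchine_le n a (s A : R) : 0 < s -> 0 <= A ->
  \sum_(k < n) a k ^+ 2 <= A ^+ 2 ->
  (\int[unif]_t (`|rsum n a t| `^ s)%:E <= (khintchine_cst s * A `^ s)%:E)%E.
Proof.
move=> s0; rewrite le_eqVlt => /predU1P[<-|A0] aA.
  rewrite powR0 ?gt_eqF// mulr0 (eq_integral (cst 0%E)) ?integral0// => t _.
  suff -> : rsum n a t = 0 by rewrite normr0 powR0 ?gt_eqF.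
  rewrite expr0n/= in aA.
  rewrite /rsum big1// => k _; suff -> : a k = 0 by rewrite mul0r.
  apply/eqP; rewrite -sqrf_eq0 -[_ == 0]orbF eq_le sqr_ge0 andbT orbF.
  by apply: le_trans aA; rewrite (bigD1 k)//= lerDl sumr_ge0// => *; rewrite sqr_ge0.
have -> : (\int[unif]_t (`|rsum n a t| `^ s)%:E =
    (A `^ s)%:E * \int[unif]_t (`|rsum n (fun k => A^-1 * a k) t| `^ s)%:E)%E.
  rewrite -ge0_integralZl_EFin ?powR_ge0//; last exact: measurable_rsum_powR.
  apply: eq_integral => t _; rewrite -EFinM -powRM ?(ltW A0)// rsumZ normrM.
  by rewrite mulrA ger0_norm ?invr_ge0 ?(ltW A0)// mulfV ?gt_eqF// mul1r.
rewrite mulrC EFinM lee_wpmul2l ?lee_fin ?powR_ge0//.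
apply: khintchine_norm1 => //.
under eq_bigr do rewrite exprMn; rewrite -mulr_sumr exprVn.
by rewrite mulrC ler_pdivrMr ?exprn_gt0// mul1r.
Qed.

(* Fourth moments: [x ^+ 2 <= l * `|x| + x ^+ 4 / l ^+ 2] bounds the first moment
   from below in terms of the second one. *)
Lemma khintchine_ge (s : R) : 1 <= s -> exists2 c : R, 0 < c & forall n a A, 0 < A ->
  A ^+ 2 / 2 <= \sum_(k < n) a k ^+ 2 <= A ^+ 2 ->
  (((c * A) `^ s)%:E <= \int[unif]_t (`|rsum n a t| `^ s)%:E)%E.
Proof.
move=> s1.
have K0 : 0 < khintchine_cst 4%:R by exact: khintchine_cst_gt0.
(* With l^2 = 4K, K the fourth moment constant, the fourth moment term is A^2 / 4, half of the lower
   bound A^2 / 2 for the second moment. So E|X| >= A / (4l), and [Lp_ge_L1] halves this to A /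
   (8l). *)
have [l l0 lK] : exists2 l : R, 0 < l & l ^+ 2 = 4 * khintchine_cst 4%:R.
  exists (Num.sqrt (4 * khintchine_cst 4%:R)).
    by rewrite sqrtr_gt0 mulr_gt0.
  by rewrite sqr_sqrtr// mulr_ge0// ltW.
exists (8 * l)^-1; first by rewrite invr_gt0 mulr_gt0.
move=> n a A A0 /andP[aA1 aA2].
have mr := measurable_rsum n a.
apply: Lp_ge_L1 => //; first by rewrite mulr_gt0 ?invr_gt0 ?mulr_gt0.
have l20 : 0 < (l * A) ^+ 2 by rewrite exprn_gt0 ?mulr_gt0.
have pw (x : R) : x ^+ 2 <= (l * A) * `|x| + ((l * A) ^+ 2)^-1 * `|x| `^ 4%:R.
  rewrite powR_mulrn// -real_normK ?num_real//.
  have x0 := normr_ge0 x; have lA : 0 < l * A by rewrite mulr_gt0.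
  have [xl|lx] := leP `|x| (l * A).
    rewrite (@le_trans _ _ ((l * A) * `|x|))//; first by rewrite expr2 ler_wpM2r.
    by rewrite lerDl mulr_ge0 ?invr_ge0 ?exprn_ge0// ltW.
  apply: (@le_trans _ _ (((l * A) ^+ 2)^-1 * `|x| ^+ 4)).
    rewrite mulrC ler_pdivlMr// (_ : `|x| ^+ 4 = `|x| ^+ 2 * `|x| ^+ 2); last by rewrite -exprD.
    by rewrite ler_wpM2l ?exprn_ge0// lerXn2r ?nnegrE ?(ltW lA)// ltW.
  by rewrite lerDr mulr_ge0 ?(ltW lA).
have I2 : ((A ^+ 2 / 2)%:E <= \int[unif]_t (rsum n a t ^+ 2)%:E)%E.
  by rewrite integral_rsum_sqr lee_fin.
have I4 : (\int[unif]_t (`|rsum n a t| `^ 4%:R)%:E <= (khintchine_cst 4%:R * A `^ 4%:R)%:E)%E.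
  by apply: khintchine_le => //; exact: ltW.
have mn : measurable_fun setT (fun t : TR => `|rsum n a t|%:E).
  by apply/measurable_EFinP; apply: measurableT_comp.
have I3 : (\int[unif]_t (rsum n a t ^+ 2)%:E <= (l * A)%:E * \int[unif]_t `|rsum n a t|%:E +
    (((l * A) ^+ 2)^-1)%:E * \int[unif]_t (`|rsum n a t| `^ 4%:R)%:E)%E.
  have m4 := measurable_rsum_powR n a 4%:R.
  have l0' : 0 <= l * A by rewrite mulr_ge0 ?ltW.
  have l2' : 0 <= ((l * A) ^+ 2)^-1 by rewrite invr_ge0 ltW.
  rewrite -!ge0_integralZl_EFin//.
  rewrite -ge0_integralD//.
  - apply: ge0_le_integral => //.
    + by move=> t _; rewrite lee_fin sqr_ge0.
    + by apply/measurable_EFinP; apply: measurable_funX.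
    + by apply: emeasurable_funD; exact: measurable_funeM.
    + by move=> t _; rewrite -!EFinM -EFinD lee_fin pw.
  - by move=> t _; rewrite mule_ge0 ?lee_fin.
  - exact: measurable_funeM.
  - by move=> t _; rewrite mule_ge0 ?lee_fin ?powR_ge0.
  - exact: measurable_funeM.
have I5 : ((A ^+ 2 / 2)%:E <= (l * A)%:E * \int[unif]_t `|rsum n a t|%:E + (A ^+ 2 / 4)%:E)%E.
  apply: (le_trans I2); apply: (le_trans I3); rewrite leeD2l//.
  apply: (@le_trans _ _ ((((l * A) ^+ 2)^-1)%:E * (khintchine_cst 4%:R * A `^ 4%:R)%:E)%E).
    by rewrite lee_wpmul2l// lee_fin invr_ge0 ltW.
  rewrite -EFinM lee_fin powR_mulrn ?(ltW A0)// exprMn lK.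
  rewrite le_eqVlt; apply/orP; left; apply/eqP; field.
  by rewrite !gt_eqF.
have I0 : (0 <= \int[unif]_t `|rsum n a t|%:E)%E by exact: integral_ge0.
move: I5 I0; case: (\int[unif]_t `|rsum n a t|%:E)%E => [x| |].
- rewrite -EFinM -EFinD !lee_fin => h _.
  have -> : 2 * ((8 * l)^-1 * A) = (A ^+ 2 / 4) / (l * A) by field; rewrite !gt_eqF.
  by rewrite ler_pdivrMr ?mulr_gt0//; lra.
- by move=> _ _; rewrite leey.
- by rewrite leeNy_eq.
Qed.

End khintchine.

Lemma counting_aeP (R : realType) (P : nat -> Prop) :
  {ae (@counting nat R : {measure set nat -> \bar R}), forall k, P k} -> forall k, P k.
Proof.
move=> [N [_ N0 subN]] k.
apply: contrapT => neq; have Nk : N k by apply: subN => /=.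
move: N0; rewrite /= /counting; case: asboolP => // fN [] /eqP.
rewrite pnatr_eq0 finmap.cardfs_eq0 => /eqP /(fset_set_set0 fN) N0.
by rewrite N0 in Nk.
Qed.

Lemma nneseries_partial (R : realType) (u : R^nat) (B : R) : (forall k, 0 <= u k) ->
  (\sum_(k <oo) (u k)%:E = B%:E)%E ->
  (forall n, \sum_(k < n) u k <= B) /\
  (forall e, 0 < e -> exists N, forall n, (N <= n)%N -> B - e <= \sum_(k < n) u k).
Proof.
move=> u0 uB.
have u0E k : (0 <= (u k)%:E)%E by rewrite lee_fin.
have le_n n : \sum_(k < n) u k <= B.
  by rewrite -lee_fin -uB -sumEFin -(big_mkord xpredT (fun k => (u k)%:E)) nneseries_ge.
split=> // e e0.
have [N hN] : exists N, B - e <= \sum_(k < N) u k.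
  apply: contrapT => /forallNP H.
  have : (B%:E <= (B - e)%:E)%E.
    rewrite -uB; apply: nneseries_le => // n.
    rewrite big_mkord sumEFin lee_fin leNgt; apply/negP => h.
    by apply: (H n); exact: ltW.
  by rewrite lee_fin; lra.
exists N => n Nn; apply: (le_trans hN).
rewrite -!(big_mkord xpredT u) (big_cat_nat _ Nn)//= lerDl.
by apply: sumr_ge0.
Qed.

(** * The embedding of l_2 in L_r *)

Section ell2_Lunit.
Context {R : realType}.
Local Notation TR := (measurableTypeR R).
Local Notation unif := (@unif R).

(** A difference of partial sums is again a Rademacher sum, with vanishing head, so that
    Khintchine's upper bound yields the Cauchy property. *)
Lemma rsum_nat_diff (m n : nat) (a : R^nat) t : (m <= n)%N ->
  rsum n a t - rsum m a t = rsum n (fun k => if (m <= k)%N then a k else 0) t.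
Proof.
move=> mn; rewrite /rsum -!(big_mkord xpredT (fun k => a k * rad k t)).
rewrite -(big_mkord xpredT (fun k => (if (m <= k)%N then a k else 0) * rad k t)).
rewrite (big_cat_nat _ mn)//= [RHS](big_cat_nat _ mn)//= addrAC subrr add0r.
rewrite [X in _ = X + _]big1_seq ?add0r.
  by rewrite !big_nat; apply: eq_bigr => k /andP[-> _].
by move=> k; rewrite mem_index_iota /= => km; rewrite leqNgt km mul0r.
Qed.

Lemma ell2_embeds (r : R) (r1 : 1 <= r) :
  power_embeds (ell (ler1n R 2)) (Lunit r1) 1 1.
Proof.
have r0 : 0 < r by exact: lt_le_trans r1.
have [c c0 cP] := khintchine_ge r1.
pose C := khintchine_cst r `^ r^-1.
have C0 : 0 <= C by exact: powR_ge0.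
have Cr : C `^ r = khintchine_cst r.
  by rewrite -powRrM mulVf ?gt_eqF// powRr1// ltW// khintchine_cst_gt0.
have sumE (f : R^nat) : (\int[counting]_k (`|f k| `^ 2)%:E = \sum_(k <oo) (f k ^+ 2)%:E)%E.
  rewrite ge0_integral_count//; apply: eq_eseriesr => k _.
  by rewrite powR_mulrn// real_normK// num_real.
have sqr0 (f : R^nat) k : 0 <= f k ^+ 2 by exact: sqr_ge0.
apply: (@Lspace_limit_embeds _ nat _ TR R counting unif 2 r _ r1
   (fun n a => rsum n a) c C c0 C0).
- by move=> n f _; exact: measurable_rsum.
- by move=> n f g t; rewrite rsumB.
- move=> n f g _ _ /counting_aeP fg; apply: eq_integral => t _.
  by congr (`|_| `^ _)%:E; apply: eq_bigr => k _; rewrite fg.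
- move=> f A n _ A0; rewrite sumE powR_mulrn// => /(nneseries_partial (sqr0 f))[fA _].
  by rewrite powRM// Cr; exact: khintchine_le.
- move=> f A _ A0; rewrite sumE powR_mulrn ?(ltW A0)// => /(nneseries_partial (sqr0 f))[fA].
  (* Khintchine's lower bound asks for only half of the total square sum, which the partial sums
     exceed from some rank on. *)
  have A2 : 0 < A ^+ 2 / 2 by rewrite divr_gt0// exprn_gt0.
  move=> /(_ _ A2)[N NP]; exists N => n Nn; apply: cP => //.
  by rewrite fA andbT; have := NP n Nn; lra.
- move=> f _; rewrite sumE => fin e e0.
  have [B BE] : exists B : R, (\sum_(k <oo) (f k ^+ 2)%:E = B%:E)%E.
    exists (fine (\sum_(k <oo) (f k ^+ 2)%:E)%E); rewrite fineK// ge0_fin_numE//.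
    by apply: nneseries_ge0 => *; rewrite lee_fin.
  have [fB BN] := nneseries_partial (sqr0 f) BE.
  (* Chosen so that the upper Khintchine bound for a tail of square sum at most A^2 is exactly
     [e]. *)
  pose A := (e / khintchine_cst r) `^ r^-1.
  have A0 : 0 < A by rewrite powR_gt0// divr_gt0// khintchine_cst_gt0.
  have [N NP] := BN (A ^+ 2) (exprn_gt0 _ A0).
  exists N => m n Nm Nn.
  wlog mn : m n Nm Nn / (m <= n)%N.
    move=> H; have [/H|/ltnW nm] := leqP m n; first exact.
    by under eq_integral do rewrite distrC; exact: H.
  under eq_integral do rewrite distrC rsum_nat_diff//.
  apply: (@le_trans _ _ (khintchine_cst r * A `^ r)%:E).
    apply: khintchine_le => //; first exact: ltW.
    have : \sum_(k < n) (if (m <= k)%N then f k else 0) ^+ 2 + \sum_(k < m) f k ^+ 2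
        = \sum_(k < n) f k ^+ 2.
      rewrite -!(big_mkord xpredT (fun k => f k ^+ 2)).
      rewrite -(big_mkord xpredT (fun k => (if (m <= k)%N then f k else 0) ^+ 2)).
      rewrite (big_cat_nat _ mn)//= [RHS](big_cat_nat _ mn)//=.
      rewrite (@big1_seq _ _ _ _ (index_iota 0 m)) ?add0r; last first.
        by move=> k; rewrite mem_index_iota /= => km; rewrite leqNgt km expr0n.
      rewrite addrC.
      congr (_ + _); rewrite !big_nat; apply: eq_bigr => k /andP[-> _] //.
    by have := NP m Nm; have := fB n; lra.
  rewrite lee_fin -powRrM mulVf ?gt_eqF// powRr1; last first.
    by rewrite ltW// divr_gt0// khintchine_cst_gt0.
  by rewrite mulrC divfK// gt_eqF// khintchine_cst_gt0.
Qed.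

End ell2_Lunit.

(** * The Haar system *)

Section haar.
Context {R : realType}.
Local Notation TR := (measurableTypeR R).
Local Notation unif := (@unif R).
Local Notation lambda := (@lebesgue_measure R).
Implicit Types (m i n : nat) (h : R -> R).

(* Dyadic intervals, indexed by a real number in order to cover the whole line. *)
Definition dyadic m (k : R) : set TR := `[k / 2 ^+ m, (k + 1) / 2 ^+ m[%classic.

Definition dint h m i : R := \int[unif]_(t in dyadic m i%:R) h t.

(* The coefficients are enumerated by the nodes of the dyadic tree:
   [n = 2 ^ m + i] stands for the [i]-th interval of level [m]. *)
Definition haar h n : R :=
  if n == 0%N then dint h 0 0 else
  let m := trunc_log 2 n in let i := (n - 2 ^ m)%N in
  Num.sqrt 2 ^+ m * (dint h m.+1 i.*2 - dint h m.+1 i.*2.+1).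

Lemma haar_node h m i : (i < 2 ^ m)%N -> haar h (2 ^ m + i) =
  Num.sqrt 2 ^+ m * (dint h m.+1 i.*2 - dint h m.+1 i.*2.+1).
Proof.
move=> im; rewrite /haar -[_ == _]negbK -lt0n addn_gt0 expn_gt0/=.
suff -> : trunc_log 2 (2 ^ m + i) = m by rewrite addKn.
by apply: trunc_log_eq => //; rewrite leq_addr expnS mul2n -addnn ltn_add2l.
Qed.

Lemma measurable_dyadic m k : measurable (dyadic m k).
Proof. exact: measurable_itv. Qed.

Lemma dyadic_split m k :
  dyadic m k = dyadic m.+1 (2 * k) `|` dyadic m.+1 (2 * k + 1).
Proof.
have e2 : 0 < 2 ^+ m :> R by rewrite exprn_gt0.
have h1 x : x / 2 ^+ m = 2 * x / 2 ^+ m.+1 :> R.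
  by rewrite exprS; field; rewrite gt_eqF.
rewrite /dyadic (h1 k) (h1 (k + 1)); apply/seteqP; split => t /=; rewrite !in_itv/=.
  move=> /andP[t1 t2]; have [H|H] := ltP t ((2 * k + 1) / 2 ^+ m.+1).
    by left; rewrite t1.
  by right => /=; apply: (lt_le_trans t2); rewrite ler_pM2r ?invr_gt0 ?exprn_gt0//; lra.
have i0 : 0 < (2 ^+ m.+1)^-1 :> R by rewrite invr_gt0 exprn_gt0.
move=> [|] /andP[t1 t2]; apply/andP; split => //.
- by apply: (lt_trans t2); rewrite ltr_pM2r//; lra.
- by apply: le_trans t1; rewrite ler_pM2r//; lra.
- by apply: (lt_le_trans t2); rewrite ler_pM2r//; lra.
Qed.

Lemma dyadic_disj m k l t : dyadic m k t -> dyadic m l t -> k < l + 1.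
Proof.
rewrite /dyadic/= !in_itv/= => /andP[k1 _] /andP[_ l2].
by have := le_lt_trans k1 l2; rewrite ltr_pM2r// invr_gt0 exprn_gt0.
Qed.

Lemma dyadic_sub01 m i : (i < 2 ^ m)%N -> dyadic m i%:R `<=` `[0, 1[%classic.
Proof.
move=> im t; rewrite /dyadic/= !in_itv/= => /andP[t1 t2].
rewrite (le_trans _ t1)/= ?divr_ge0//; apply: (lt_le_trans t2).
rewrite ler_pdivrMr ?exprn_gt0// mul1r -natrX natr1 ler_nat.
exact: im.
Qed.

Lemma unif_dyadic m i : (i < 2 ^ m)%N -> unif (dyadic m i%:R) = ((2 ^+ m)^-1)%:E.
Proof.
move=> im; rewrite /unif /mrestr setIidl; last first.
  move=> t /(dyadic_sub01 im) /=; rewrite !in_itv/= => /andP[-> /ltW]//.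
rewrite /dyadic lebesgue_measure_itv/= lte_fin ltr_pM2r ?invr_gt0 ?exprn_gt0//.
by rewrite ltrDl ltr01 -EFinB; congr EFin; ring.
Qed.

Let integrable_dyadic h m k : unif.-integrable setT (EFin \o h) ->
  unif.-integrable (dyadic m k) (EFin \o h).
Proof. by apply: integrableS => //; exact: measurable_dyadic. Qed.

Lemma dint_split h m i : unif.-integrable setT (EFin \o h) ->
  dint h m i = dint h m.+1 i.*2 + dint h m.+1 i.*2.+1.
Proof.
move=> ih; have e1 : 2 * i%:R = i.*2%:R :> R by rewrite -muln2 natrM mulrC.
have e2 : 2 * i%:R + 1 = i.*2.+1%:R :> R by rewrite e1 natr1.
rewrite /dint dyadic_split e2 e1 Rintegral_setU//.
- exact: measurable_dyadic.
- exact: measurable_dyadic.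
- by rewrite -e1 -e2 -dyadic_split; exact: integrable_dyadic.
- apply/disj_setPS => t [h1 h2]; have := dyadic_disj h2 h1.
  by rewrite -natr1 ltxx.
Qed.

Lemma sum_double (F : nat -> R) n :
  \sum_(0 <= j < n.*2) F j = \sum_(0 <= i < n) (F i.*2 + F i.*2.+1).
Proof.
elim: n => [|n IH]; first by rewrite !big_geq.
by rewrite doubleS big_nat_recr//= big_nat_recr//= IH [RHS]big_nat_recr//= addrA.
Qed.

(** The right-hand side is the squared L_2 norm of [h] averaged over the cells of level [m]. Passing
    to the next level is the identity (x - y)^2 + (x + y)^2 = 2 (x^2 + y^2) on the two halves of
    each cell. *)
Lemma sum_haar h m : unif.-integrable setT (EFin \o h) ->
  \sum_(0 <= n < 2 ^ m) haar h n ^+ 2 = 2 ^+ m * \sum_(0 <= i < 2 ^ m) dint h m i ^+ 2.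
Proof.
move=> ih; elim: m => [|m IH].
  by rewrite !big_nat1 expr0 mul1r /haar eqxx.
have mm : (2 ^ m <= 2 ^ m.+1)%N by rewrite leq_exp2l.
rewrite (big_cat_nat _ mm)//= IH -{2}[(2 ^ m)%N]add0n big_addn.
rewrite expnS mul2n -addnn addnK addnn sum_double.
rewrite !mulr_sumr -big_split/= exprS !big_nat; apply: eq_bigr => i /andP[_ im].
rewrite addnC haar_node// exprMn exprAC sqr_sqrtr// (dint_split _ _ ih).
by ring.
Qed.

Lemma dint_sqr_le h m i : unif.-integrable setT (EFin \o h) -> (i < 2 ^ m)%N ->
  ((2 ^+ m * dint h m i ^+ 2)%:E <= \int[unif]_(t in dyadic m i%:R) (h t ^+ 2)%:E)%E.
Proof.
move=> ih im; have mD := measurable_dyadic m i%:R.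
have mh : measurable_fun setT h by apply/measurable_EFinP; case/integrableP: ih.
have ihD := @integrable_dyadic h m i%:R ih.
have mh2 : measurable_fun (dyadic m i%:R) (fun t => (h t ^+ 2)%:E).
  by apply/measurable_EFinP; apply: measurable_funX; exact: measurable_funS mh.
have I0 : (0 <= \int[unif]_(t in dyadic m i%:R) (h t ^+ 2)%:E)%E.
  by apply: integral_ge0 => t _; rewrite lee_fin sqr_ge0.
have [fin|] := ltP (\int[unif]_(t in dyadic m i%:R) (h t ^+ 2)%:E)%E +oo%E; last first.
  by rewrite leye_eq => /eqP ->; rewrite leey.
(* The mean of [h] on the cell: integrating 2ch - c^2 <= h^2 gives Cauchy-Schwarz without an inner
   product. *)
pose c := 2 ^+ m * dint h m i.
have ic : unif.-integrable (dyadic m i%:R) (cst (c ^+ 2)%:E).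
  by apply: finite_measure_integrable_cst.
have i2h : unif.-integrable (dyadic m i%:R) (fun t => (2 * c)%:E * (h t)%:E)%E.
  exact: integrableZl.
have : (\int[unif]_(t in dyadic m i%:R) ((2 * c)%:E * (h t)%:E - (c ^+ 2)%:E)
  <= \int[unif]_(t in dyadic m i%:R) (h t ^+ 2)%:E)%E.
  apply: le_integral => //.
  - exact: integrableB.
  - apply/integrableP; split => //.
    by under eq_integral do rewrite gee0_abs ?lee_fin ?sqr_ge0//.
  - by move=> t _; rewrite -EFinM -EFinB lee_fin; have := sqr_ge0 (h t - c); nra.
rewrite integralB//= integralZl//= integral_cst//=.
apply: le_trans.
have -> : (\int[unif]_(x in dyadic m i%:R) (h x)%:E = (dint h m i)%:E)%E.
  by rewrite fineK//; exact: integrable_fin_num.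
have -> := unif_dyadic im.
rewrite -!EFinM -EFinB lee_fin /c le_eqVlt; apply/orP; left; apply/eqP.
by field; rewrite gt_eqF// exprn_gt0.
Qed.

End haar.

#[global] Instance unif_ae_filter (R : realType) : Filter (almost_everywhere (@unif R)) :=
  ae_filter_ringOfSetsType (@unif R : {measure set (measurableTypeR R) -> \bar R}).

(** * Parseval's identity *)

Section parseval.
Context {R : realType}.
Local Notation TR := (measurableTypeR R).
Local Notation unif := (@unif R).
Local Notation lambda := (@lebesgue_measure R).
Variable h : R -> R.
Hypothesis ih : unif.-integrable setT (EFin \o h).

Let mh : measurable_fun setT (h : TR -> TR).
Proof. by apply/measurable_EFinP; case/integrableP: ih. Qed.

Let mh2 : measurable_fun setT (fun t : TR => (h t ^+ 2)%:E).
Proof. by apply/measurable_EFinP; exact: measurable_funX. Qed.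

Lemma unif_lebesgue_eq (A : set TR) (f : R -> \bar R) : A `<=` `[0, 1]%classic ->
  (\int[unif]_(t in A) f t = \int[lambda]_(t in A) f t)%E.
Proof.
move=> A01; apply: eq_measure_integral => B mB BA.
have E : lambda (B `&` `[0, 1]) = lambda B by rewrite setIidl//; exact: subset_trans A01.
exact: E.
Qed.

Lemma unif_ae (P : set R) : {ae lambda, forall t, P t} ->
  {ae (unif : {measure set TR -> \bar R}), forall t, 0 <= t < 1 /\ P t}.
Proof.
move=> [N [mN N0 PN]]; exists (N `|` ~` `[0, 1[%classic); split.
- by apply: measurableU => //; apply: measurableC.
- apply/eqP; rewrite -measure_le0 /unif /mrestr.
  apply: (@le_trans _ _ (lambda (N `|` [set 1]))).
    apply: le_measure; rewrite ?inE.
    + apply: measurableI => //; apply: measurableU => //; exact: measurableC.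
    + exact: measurableU.
    + move=> t [[|t1]]; first by left.
      move: t1; rewrite /= !in_itv/= => /negP; rewrite negb_and -ltNge -leNgt.
      move=> /orP[?|?] /andP[? ?]; first by lra.
      by right => /=; apply/eqP; rewrite eq_le; apply/andP; split.
  rewrite [leLHS](_ : _ = 0%E)//.
  exact: etrans (measureU0 mN (measurable_set1 1) (lebesgue_measure_set1 1)) N0.
- move=> t /= nP; have [t01|t01] := boolP (0 <= t < 1).
    by left; apply: PN => /= Pt; exact: nP.
  by right; rewrite /= in_itv/=; exact/negP.
Qed.

Let cell (x : R) (n : nat) : set TR := dyadic n (Num.floor (2 ^+ n * x))%:~R.

Let cell_nicely x : nicely_shrinking x (cell x).
Proof.
split; first by move=> n; exact: measurable_dyadic.
have e0 n : 0 < (2 ^+ n)^-1 :> R by rewrite invr_gt0 exprn_gt0.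
(* A cell lies in the ball of radius 2^-n around any of its points, and this ball has twice the
   measure of the cell. *)
exists (2, fun n => PosNum (e0 n)); split => //=.
- rewrite (_ : (fun n => _) = (fun n => 2^-1 ^+ n)); last by apply/funext => n; rewrite exprVn.
  by apply: cvg_expr; rewrite ger0_norm ?invr_ge0// invf_lt1// ltr1n.
- move=> n y; rewrite /cell /dyadic/= in_itv/= /ball/= => /andP[y1 y2].
  have /andP[x1 x2] := floor_itv (2 ^+ n * x).
  move: x2; rewrite intrD => x2.
  move: y1 y2; rewrite ler_pdivrMr ?exprn_gt0// ltr_pdivlMr ?exprn_gt0// => y1 y2.
  rewrite ltr_norml.
  have h1 (z : R) : (z < (2 ^+ n)^-1) = (z * 2 ^+ n < 1) by rewrite -ltr_pdivlMr ?exprn_gt0// div1r.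
  have h2 (z : R) : (- (2 ^+ n)^-1 < z) = (-1 < z * 2 ^+ n) by rewrite -ltr_pdivrMr ?exprn_gt0// mulN1r.
  by rewrite h1 h2 mulrBl; apply/andP; split; lra.
- move=> n; rewrite lebesgue_measure_ball ?invr_ge0 ?exprn_ge0//.
  rewrite /cell /dyadic lebesgue_measure_itv/= lte_fin ltr_pM2r// ltrDl ltr01 -EFinB -EFinM lee_fin.
  rewrite -mulrBl addrAC subrr add0r mul1r mulr2n.
  by rewrite mulr_natl mulr2n.
Qed.

Let cell_dyadic x n : 0 <= x < 1 -> (Num.truncn (2 ^+ n * x) < 2 ^ n)%N /\
  cell x n = dyadic n (Num.truncn (2 ^+ n * x))%:R.
Proof.
move=> /andP[x0 x1]; have e0 : 0 < 2 ^+ n :> R by rewrite exprn_gt0.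
have nx0 : 0 <= 2 ^+ n * x by rewrite mulr_ge0// ltW.
have /andP[t1 t2] := truncn_itv nx0; split.
  rewrite -(ltr_nat R) natrX; apply: (le_lt_trans t1).
  by rewrite gtr_pMr.
rewrite /cell; congr (dyadic _ _).
rewrite (@floor_def _ _ (Num.truncn (2 ^+ n * x))%:Z)//.
by rewrite intrD -pmulrn t1/= natr1.
Qed.

(** Integrability for [unif] says nothing outside [0, 1], whereas Lebesgue differentiation is
    applied to a locally integrable function on the line. *)
Let g : R -> R := h \_ `[0, 1]%classic.

Let g_locint : locally_integrable setT g.
Proof.
apply: integrable_locally_restrict => //.
apply/integrableP; split.
  by apply/measurable_EFinP; exact: measurable_funS mh.
rewrite -unif_lebesgue_eq//.
have /integrableP[_] := ih; apply: le_lt_trans.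
apply: ge0_subset_integral => //.
by apply: measurableT_comp => //; exact/measurable_EFinP.
Qed.

Let avg_cvg : {ae (unif : {measure set TR -> \bar R}), forall t, 0 <= t < 1 /\
  2 ^+ n * dint h n (Num.truncn (2 ^+ n * t)) @[n --> \oo] --> h t}.
Proof.
apply: filterS (unif_ae (lebesgue_differentiation g_locint)) => t [t01 pt]; split => //.
have := nice_lebesgue_differentiation cell_nicely g_locint pt.
have -> : g t = h t.
  by rewrite /g patchE mem_set//= in_itv/=; case/andP: t01 => -> /ltW ->.
have -> : (fun n => (lambda (cell t n))^-1 * \int[lambda]_(y in cell t n) (g y)%:E)%E =
    (fun n => (2 ^+ n * dint h n (Num.truncn (2 ^+ n * t)))%:E).
  apply/funext => n; have [im ->] := cell_dyadic n t01.
  have sub : dyadic n (Num.truncn (2 ^+ n * t))%:R `<=` (`[0, 1]%classic : set TR).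
    move=> u ud; have := dyadic_sub01 im ud; rewrite /= !in_itv/= => /andP[u0 u1].
    by rewrite u0 ltW.
  have -> : lambda (dyadic n (Num.truncn (2 ^+ n * t))%:R) = ((2 ^+ n)^-1)%:E.
    by rewrite -(unif_dyadic im) /unif /mrestr setIidl.
  rewrite EFinM; congr (_ * _)%E.
    by rewrite inver gt_eqF ?invr_gt0 ?exprn_gt0// invrK.
  transitivity (\int[lambda]_(u in dyadic n (Num.truncn (2 ^+ n * t))%:R) (h u)%:E)%E.
    by apply: eq_integral => u /[!inE] /sub u01; rewrite /g patchE mem_set.
  rewrite -unif_lebesgue_eq// /dint /Rintegral fineK//.
  apply: integrable_fin_num; first exact: measurable_dyadic.
  by apply: integrableS ih => //; exact: measurable_dyadic.
by move=> /fine_cvgP[_].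
Qed.

Let q m (t : R) : \bar R :=
  (\sum_(0 <= i < 2 ^ m) ((2 ^+ m * dint h m i) ^+ 2)%:E * (\1_(dyadic m i%:R) t)%:E)%E.

Let qE m t : 0 <= t < 1 ->
  q m t = ((2 ^+ m * dint h m (Num.truncn (2 ^+ m * t))) ^+ 2)%:E.
Proof.
move=> t01; have [im cE] := cell_dyadic m t01.
have tc : dyadic m (Num.truncn (2 ^+ m * t))%:R t.
  rewrite -cE /cell /dyadic/= in_itv/= ler_pdivrMr ?exprn_gt0// ltr_pdivlMr ?exprn_gt0//.
  by have := floor_itv (2 ^+ m * t); rewrite intrD [t * _]mulrC.
rewrite /q (bigD1_seq (Num.truncn (2 ^+ m * t)))/= ?iota_uniq ?mem_index_iota//.
rewrite indicE mem_set// mule1 big1_seq ?adde0// => i /andP[ii _].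
rewrite indicE memNset ?mule0// => ti.
have := dyadic_disj ti tc; have := dyadic_disj tc ti.
by rewrite !natr1 !ltr_nat !ltnS => h1 h2; move: ii; rewrite eqn_leq h1 h2.
Qed.

Let mq1 m i : measurable_fun setT (fun t : TR => 
  ((2 ^+ m * dint h m i) ^+ 2)%:E * (\1_(dyadic m i%:R) t)%:E)%E.
Proof.
apply: measurable_funeM; apply/measurable_EFinP.
by apply: measurable_indic; exact: measurable_dyadic.
Qed.

Let q1_ge0 m i (t : R) : (0 <= ((2 ^+ m * dint h m i) ^+ 2)%:E * (\1_(dyadic m (i%:R : R)) t : R)%:E)%E.
Proof. by rewrite mule_ge0 ?lee_fin ?sqr_ge0. Qed.

Let integral_q m : (\int[unif]_t q m t = (\sum_(0 <= n < 2 ^ m) haar h n ^+ 2)%:E)%E.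
Proof.
rewrite /q ge0_integral_sum//.
rewrite sum_haar// mulr_sumr -sumEFin !big_nat; apply: eq_bigr => i /andP[_ im].
rewrite ge0_integralZl_EFin ?sqr_ge0//; last first.
  by apply/measurable_EFinP; apply: measurable_indic; exact: measurable_dyadic.
rewrite integral_indic//; last exact: measurable_dyadic.
rewrite setIT; transitivity (((2 ^+ m * dint h m i) ^+ 2)%:E * ((2 ^+ m)^-1)%:E)%E.
  by congr (_ * _)%E; exact: unif_dyadic.
by rewrite -EFinM; congr EFin; field; rewrite gt_eqF ?exprn_gt0.
Qed.

(** The sum is at most the integral by [sum_haar] and Cauchy-Schwarz on each cell. Conversely, the
    squared cell averages [q m] tend to h^2 almost everywhere by Lebesgue differentiation, and Fatou
    applies. *)
Lemma parseval : (\sum_(n <oo) (haar h n ^+ 2)%:E = \int[unif]_t (h t ^+ 2)%:E)%E.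
Proof.
have u0 n : (0 <= (haar h n ^+ 2)%:E)%E by rewrite lee_fin sqr_ge0.
apply/eqP; rewrite eq_le; apply/andP; split.
- apply: nneseries_le => // n.
  have n2 : (n <= 2 ^ n)%N by rewrite ltnW// ltn_expl.
  apply: (@le_trans _ _ (\sum_(0 <= k < 2 ^ n) (haar h k ^+ 2)%:E)%E).
    by rewrite (big_cat_nat _ n2)//= leeDl// sume_ge0.
  rewrite sumEFin sum_haar// mulr_sumr -sumEFin.
  pose D : set TR := \big[setU/set0]_(0 <= i < 2 ^ n) dyadic n (i%:R : R).
  have mD : measurable D by apply: bigsetU_measurable => i _; exact: measurable_dyadic.
  have h0 t : (0 <= (h t ^+ 2)%:E)%E by rewrite lee_fin sqr_ge0.
  apply: (@le_trans _ _ (\int[unif]_(t in D) (h t ^+ 2)%:E)%E); last first.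
    exact: ge0_subset_integral.
  rewrite ge0_integral_bigsetU//.
  + rewrite !big_nat; apply: lee_sum => i /andP[_ im]; exact: dint_sqr_le.
  + by move=> i; exact: measurable_dyadic.
  + exact: iota_uniq.
  + move=> i j _ _ [t [ti tj]].
    have := dyadic_disj ti tj; have := dyadic_disj tj ti.
    by rewrite !natr1 !ltr_nat !ltnS => h1 h2; apply/eqP; rewrite eqn_leq h1 h2.
  + exact: measurable_funS mh2.
- apply: (@fatou_le _ TR R unif q (fun t => (h t ^+ 2)%:E)).
  + by move=> n; apply: emeasurable_sum => i; exact: mq1.
  + exact: mh2.
  + by move=> n t; apply: sume_ge0 => i _; exact: q1_ge0.
  + apply: filterS avg_cvg => t [t01 ct].
    rewrite (_ : (fun n => q n t) = fun n =>
      ((2 ^+ n * dint h n (Num.truncn (2 ^+ n * t))) ^+ 2)%:E); last first.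
      by apply/funext => n; rewrite qE.
    apply: cvg_EFin; first exact: nearW.
    by rewrite expr2; apply: cvgM.
  + move=> n; rewrite integral_q -sumEFin.
    exact: (nneseries_ge (2 ^ n) u0).
Qed.

End parseval.

Section L2_ell2.
Context {R : realType}.
Local Notation TR := (measurableTypeR R).
Local Notation unif := (@unif R).

Lemma unif_integrable (r : R) (f : R -> R) : 1 <= r -> measurable_fun setT (f : TR -> TR) ->
  (\int[unif]_t (`|f t| `^ r)%:E < +oo)%E -> unif.-integrable setT (EFin \o f).
Proof.
move=> r1 mf fin; have r0 : 0 < r by exact: lt_le_trans r1.
have mfr : measurable_fun setT (fun t : TR => (`|f t| `^ r)%:E) by exact: measurable_powR_norm.
apply/integrableP; split; first exact/measurable_EFinP.
apply: (@le_lt_trans _ _ (\int[unif]_t ((1 : R)%:E + (`|f t| `^ r)%:E))%E).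
  apply: ge0_le_integral => //.
  - by apply: measurableT_comp => //; exact/measurable_EFinP.
  - exact: emeasurable_funD.
  - move=> t _ /=; rewrite lee_fin; have [f1|f1] := leP `|f t| 1.
      by rewrite (le_trans f1)// lerDl powR_ge0.
    by rewrite (le_trans (le1r_powR (ltW f1) r1))// lerDr.
rewrite ge0_integralD//; apply: lte_add_pinfty => //.
by rewrite integral_unif_cst ltry.
Qed.

Lemma haarB (f g : R -> R) n : unif.-integrable setT (EFin \o f) ->
  unif.-integrable setT (EFin \o g) ->
  haar f n - haar g n = haar (fun t => f t - g t) n.
Proof.
move=> hf hg; have dB m i : dint (fun t => f t - g t) m i = dint f m i - dint g m i.
  have mD := measurable_dyadic m (i%:R : R).
  by rewrite /dint; apply: RintegralB => //; [exact: integrableS hf|exact: integrableS hg].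
by rewrite /haar !dB; case: ifP => // _; ring.
Qed.

Lemma Lunit2_embeds_ell2 :
  power_embeds (Lunit (ler1n R 2)) (ell (ler1n R 2)) 2 2.
Proof.
have intf (f : R -> R) : measurable_fun setT (f : TR -> TR) ->
    (\int[unif]_t (`|f t| `^ 2)%:E < +oo)%E -> unif.-integrable setT (EFin \o f).
  by apply: unif_integrable; rewrite ler1n.
have sq (x : R) : `|x| `^ 2 = x ^+ 2 by rewrite powR_mulrn// real_normK// num_real.
have int0 : unif.-integrable setT (EFin \o (fun=> 0 : R)).
  by apply: intf => //; under eq_integral do rewrite sq expr0n; rewrite integral0 ltry.
apply: (@Lspace_power_embeds _ TR _ nat R unif counting 2 2 _ _ (fun f => haar f) 1 1) => //.
- apply/funext => n; rewrite -[RHS](subrr (haar (fun=> 0) n)) haarB//.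
  by congr (haar _ n); apply/funext => t; rewrite subr0.
- move=> f g mf mg finf fing.
  have i1 := intf _ mf finf; have i2 := intf _ mg fing.
  rewrite !mul1e ge0_integral_count//.
  rewrite (eq_eseriesr (g := fun n => (haar (fun t => f t - g t) n ^+ 2)%:E)); last first.
    by move=> n _; rewrite sq haarB.
  rewrite parseval; last first.
    by rewrite [EFin \o _](_ : _ = (EFin \o f) \- (EFin \o g))%E//; exact: integrableB.
  under eq_integral do rewrite sq.
  by rewrite lexx.
Qed.

End L2_ell2.

(** * Snowflake embeddings *)

Section two_sided_geometric.
Context {R : realType}.
Implicit Types (a b rho u : R) (n : nat).

(** A profile decaying like u^a at 0 and like u^(-b) at infinity; its sums along a geometric
    progression are bounded independently of the starting point. *)
Definition bump a b u : R := Num.min (u `^ a) (u `^ (- b)).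

Lemma bump_ge0 a b u : 0 <= bump a b u.
Proof. by rewrite le_min !powR_ge0. Qed.

Lemma bump_inv a b u : 0 < u -> bump a b u^-1 = bump b a u.
Proof.
move=> u0; have e x : u^-1 `^ x = u `^ (- x).
  by rewrite -powR_inv1 ?ltW// -powRrM mulN1r.
by rewrite /bump !e opprK minC.
Qed.

Lemma geometric_le (x : R) n : 0 < x < 1 -> \sum_(0 <= i < n) x ^+ i <= (1 - x)^-1.
Proof.
move=> /andP[x0 x1].
have := @geometric_le_lim R n 1 x ler01 x0; rewrite gtr0_norm// => /(_ x1).
by rewrite /series/=; under eq_bigr do rewrite mul1r; rewrite div1r.
Qed.

Lemma powR_exprn (x y : R) n : 0 <= x -> (x ^+ n) `^ y = (x `^ y) ^+ n.
Proof.
move=> x0; elim: n => [|n IH]; first by rewrite !expr0 powR1.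
by rewrite !exprS powRM ?exprn_ge0// IH.
Qed.

Lemma sum_bump_le a b rho : 0 < a -> 0 < b -> 1 < rho ->
  exists2 D : R, 0 < D & forall u n, 0 < u ->
    \sum_(0 <= i < n) bump a b (u / rho ^+ i) <= D.
Proof.
move=> a0 b0 rho1; have rho0 : 0 < rho by exact: lt_trans rho1.
have powR1x y : 1 `^ y = 1 :> R by rewrite powR1.
have powR_gt1 y : 0 < y -> 1 < rho `^ y.
  by move=> y0; rewrite -[ltLHS](powR1x y) gt0_ltr_powR ?nnegrE// ltW.
pose x := rho `^ (- a).
have x01 : 0 < x < 1 by rewrite powR_gt0//= /x powRN invf_lt1 ?powR_gt0// powR_gt1.
(* Above 1 the induction needs the stronger bound D - E u^(-b). Since E rho^b = E + 1, replacing u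
   by u / rho frees exactly the u^(-b) that the new term may cost; [D1] covers the terms below 1. *)
pose E := (rho `^ b - 1)^-1; pose D1 := (1 - x)^-1; pose D := E + 1 + D1.
have E0 : 0 < E by rewrite invr_gt0 subr_gt0 powR_gt1.
have D10 : 0 < D1 by rewrite invr_gt0; case/andP: x01; lra.
have small u n : 0 < u -> u <= 1 -> \sum_(0 <= i < n) bump a b (u / rho ^+ i) <= D1.
  move=> u0 u1; apply: le_trans (geometric_le n x01); apply: ler_sum => i _.
  rewrite ge_min; apply/orP; left.
  rewrite powRM ?invr_ge0 ?exprn_ge0 ?(ltW u0) ?(ltW rho0)//.
  rewrite (_ : _^-1 `^ a = x ^+ i); last first.
    by rewrite -powR_inv1 ?exprn_ge0 ?ltW// -powRrM mulN1r powR_exprn// ltW.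
  rewrite ler_piMl// ?exprn_ge0 ?powR_ge0//.
  by rewrite -[leRHS](powR1x a) ge0_ler_powR ?nnegrE// ltW.
have large n u : 1 <= u -> \sum_(0 <= i < n) bump a b (u / rho ^+ i) <= D - E * u `^ (- b).
  elim: n u => [|n IH] u u1.
    have : u `^ (- b) <= 1 by rewrite powRN invf_le1 ?powR_gt0 ?(lt_le_trans ltr01 u1)//
        -[leLHS](powR1x b) ge0_ler_powR ?nnegrE ?(le_trans ler01 u1)// ltW.
    have := powR_ge0 u (- b).
    by rewrite big_geq// /D; nra.
  have u0 : 0 < u by exact: lt_le_trans u1.
  have ub1 : u `^ (- b) <= 1.
    by rewrite powRN invf_le1 ?powR_gt0// -[leLHS](powR1x b) ge0_ler_powR ?nnegrE// ltW.
  have ub0 := powR_ge0 u (- b).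
  rewrite big_nat_recl//= expr0 divr1.
  have -> : \sum_(0 <= i < n) bump a b (u / rho ^+ i.+1) =
      \sum_(0 <= i < n) bump a b (u / rho / rho ^+ i).
    by apply: eq_bigr => i _; rewrite exprS invfM mulrA.
  have b1 : bump a b u <= u `^ (- b) by rewrite ge_min lexx orbT.
  have [ur|ur] := leP 1 (u / rho).
    have := IH _ ur; rewrite powRM ?invr_ge0 ?(ltW u0) ?(ltW rho0)//.
    have -> : rho^-1 `^ (- b) = rho `^ b.
      by rewrite -powR_inv1 ?ltW// -powRrM mulrNN mul1r.
    have : E * rho `^ b = E + 1.
      by rewrite /E; field; rewrite subr_eq0 gt_eqF// powR_gt1.
    move=> e; have -> : E * (u `^ (- b) * rho `^ b) = u `^ (- b) * (E * rho `^ b) by ring.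
    by rewrite e; lra.
  have := small _ n (divr_gt0 u0 rho0) (ltW ur).
  have : bump a b u <= 1 by exact: le_trans ub1.
  by rewrite /D; nra.
exists D; first by rewrite /D; lra.
move=> u n u0; have [u1|u1] := leP u 1.
  by apply: (le_trans (small _ n u0 u1)); rewrite /D; lra.
apply: (le_trans (large n u (ltW u1))).
by have := powR_ge0 u (- b); nra.
Qed.

Lemma sum_bump_ge a b rho : 0 < a -> 0 < b -> 1 < rho ->
  exists2 D : R, 0 < D & forall u n, 0 < u ->
    \sum_(0 <= i < n) bump a b (u * rho ^+ i) <= D.
Proof.
move=> a0 b0 rho1; have [D D0 DP] := sum_bump_le b0 a0 rho1.
exists D => // u n u0; apply: le_trans (DP u^-1 n _); last by rewrite invr_gt0.
apply: ler_sum => i _; rewrite -bump_inv; last first.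
  by rewrite mulr_gt0// exprn_gt0// (lt_trans ltr01).
by rewrite invfM.
Qed.

End two_sided_geometric.

Section trigonometric_increments.
Context {R : realType}.
Implicit Types u v w : R.

Lemma sin_lipschitz u v : `|sin u - sin v| <= `|u - v|.
Proof.
wlog vu : u v / v <= u.
  move=> H; have [/H//|/ltW uv] := leP v u.
  by rewrite distrC [leRHS]distrC H.
have [c _ ->] := @MVT_segment R sin cos v u vu (fun x _ => is_derive_sin x)
  (continuous_subspaceT (@continuous_sin R)).
by rewrite normrM ler_piMl// cos_max.
Qed.

Lemma cos_lipschitz u v : `|cos u - cos v| <= `|u - v|.
Proof. by rewrite -!sinDpihalf (le_trans (sin_lipschitz _ _))// opprD addrACA subrr addr0. Qed.

(** The squared increments of cos and sin add up to 2 (1 - cos (u - v)), which is at least 2 (1 -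
    cos 1) because cosine decreases on [1, 2], inside [0, pi]. So one of them is at least half of
    that. *)
Lemma trig_increment u v (s : R) : 0 < s -> 1 <= `|u - v| <= 2 ->
  Num.sqrt (1 - cos 1) `^ s <= `|cos u - cos v| `^ s + `|sin u - sin v| `^ s.
Proof.
move=> s0 /andP[w1 w2]; set k := Num.sqrt _.
have pi2 := @pi_ge2 R.
have cw : cos (u - v) <= cos 1.
  have -> : cos (u - v) = cos `|u - v| by case: (ger0P (u - v)) => // _; rewrite cosN.
  by rewrite leNgt ltr_cos ?in_itv/= ?ler01//; [lra|apply/andP; split; lra|apply/andP; split; lra].
have sq : (cos u - cos v) ^+ 2 + (sin u - sin v) ^+ 2 = 2 * (1 - cos (u - v)).
  by rewrite cosB; have := cos2Dsin2 u; have := cos2Dsin2 v; lra.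
have c1 := @cos_le1 R 1.
have k0 : 0 <= k by exact: sqrtr_ge0.
have k2 : k ^+ 2 = 1 - cos 1 by rewrite sqr_sqrtr//; lra.
have [h|h] := leP k `|cos u - cos v|.
  apply: (@le_trans _ _ (`|cos u - cos v| `^ s)); last by rewrite lerDl powR_ge0.
  by rewrite ge0_ler_powR ?nnegrE// ltW.
apply: (@le_trans _ _ (`|sin u - sin v| `^ s)); last by rewrite lerDr powR_ge0.
rewrite ge0_ler_powR ?nnegrE// ?(ltW s0)//.
rewrite -ler_sqr ?nnegrE// k2 real_normK ?num_real//.
have : `|cos u - cos v| ^+ 2 <= k ^+ 2 by rewrite ler_sqr ?nnegrE// ltW.
by rewrite real_normK ?num_real// k2; lra.
Qed.

End trigonometric_increments.

Section snowflake.
Context {R : realType}.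
Implicit Types (i j k n : nat) (x y : R).

(* [k] runs over the dyadic scales, negative powers of 2 for [k] even and
   nonnegative ones for [k] odd. *)
Definition scale k : R := if odd k then 2 ^+ k./2 else (2 ^+ k./2.+1)^-1.

(** A lacunary series split into coordinates, with [al] the snowflake exponent. The [- 1] does not
    affect increments and makes every coordinate vanish at 0, as [Lspace_power_embeds] requires. *)
Definition snow (al : R) j x : R :=
  scale j./2 `^ (- al) *
  (if odd j then sin (scale j./2 * x) else cos (scale j./2 * x) - 1).

Lemma scale_gt0 k : 0 < scale k.
Proof. by rewrite /scale; case: ifP => _; rewrite ?invr_gt0 exprn_gt0. Qed.

Lemma snow0 al j : snow al j 0 = 0.
Proof. by rewrite /snow mulr0 sin0 cos0 subrr; case: ifP; rewrite mulr0. Qed.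

Lemma measurable_snow al j : measurable_fun setT (snow al j : measurableTypeR R -> measurableTypeR R).
Proof.
rewrite /snow; case: (odd j); apply: measurable_funM => //.
  apply: measurableT_comp; last exact: measurable_funM.
  by apply: continuous_measurable_fun; exact: continuous_sin.
apply: measurable_funB => //; apply: measurableT_comp; last exact: measurable_funM.
by apply: continuous_measurable_fun; exact: continuous_cos.
Qed.

Lemma scale_ex (e : R) : 0 < e -> exists k, 1 <= scale k * e <= 2.
Proof.
have log2 x : 1 <= x -> exists n, 2 ^+ n <= x < 2 ^+ n.+1.
  move=> x1; have x0 : 0 <= x by exact: le_trans x1.
  have /andP[t1 t2] := truncn_itv x0.
  have t0 : (0 < Num.truncn x)%N by rewrite truncn_gt0.
  have /andP[l1 l2] := trunc_log_bounds (isT : (1 < 2)%N) t0.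
  exists (trunc_log 2 (Num.truncn x)); apply/andP; split.
    by apply: le_trans t1; rewrite -natrX ler_nat.
  by apply: (lt_le_trans t2); rewrite -natrX ler_nat.
move=> e0; have [e1|e1] := leP 1 e.
  have [[|n] /andP[n1 n2]] := log2 _ e1.
    (* Scale 1 has the odd index 1, since the even indices start at 1/2. *)
    exists 1%N; rewrite /scale/= expr0 mul1r; apply/andP; split; [lra|].
    by rewrite expr1 in n2; exact: ltW.
  exists n.*2; rewrite /scale odd_double doubleK mulrC ler_pdivlMr ?exprn_gt0//.
  rewrite mul1r n1/= ler_pdivrMr ?exprn_gt0//.
  by rewrite -exprS ltW.
have e1' : 1 <= e^-1 by rewrite invf_ge1// ltW.
have [n /andP[n1 n2]] := log2 _ e1'.
exists n.+1.*2.+1; rewrite /scale/= odd_double/= uphalf_double.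
rewrite -[e]invrK ler_pdivlMr ?invr_gt0// mul1r ltW//=.
rewrite ler_pdivrMr ?invr_gt0// exprS ler_pM2l//.
Qed.

Lemma snow_term (r s : R) j x y : 0 < r -> 0 < s ->
  `|snow (r / s) j x - snow (r / s) j y| `^ s = scale j./2 `^ (- r) *
  `|if odd j then sin (scale j./2 * x) - sin (scale j./2 * y)
    else cos (scale j./2 * x) - cos (scale j./2 * y)| `^ s.
Proof.
move=> r0 s0; rewrite /snow -mulrBr normrM powRM// ger0_norm ?powR_ge0// -powRrM.
have -> : - (r / s) * s = - r by field; rewrite gt_eqF.
by case: ifP => // _; congr (_ * `|_| `^ _); ring.
Qed.

(** With e = |x - y|, the increment at scale L costs at most L^-r min(Le, 2)^s, bounded by 2^s e^r
    times a [bump] at Le with exponents s - r and r. Below, the one scale with 1 <= Le <= 2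
    suffices. *)
Lemma snow_bounds (r s : R) : 0 < r -> r < s -> exists c C : R, [/\ 0 < c, 0 <= C &
  forall x y, ((c * `|x - y| `^ r)%:E <= \sum_(j <oo) (`|snow (r / s) j x - snow (r / s) j y| `^ s)%:E
               <= (C * `|x - y| `^ r)%:E)%E].
Proof.
move=> r0 rs; have s0 : 0 < s by exact: lt_trans rs.
have sr0 : 0 < s - r by rewrite subr_gt0.
have two1 : 1 < 2 :> R by rewrite ltr1n.
have [D1 D10 D1P] := sum_bump_le sr0 r0 two1.
have [D2 D20 D2P] := sum_bump_ge sr0 r0 two1.
pose kap : R := Num.sqrt (1 - cos 1) `^ s.
have kap0 : 0 < kap.
  rewrite powR_gt0// sqrtr_gt0 subr_gt0 -[ltRHS]cos0 ltr_cos ?ltr01// in_itv/= ?lexx ?ler01/=.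
    by rewrite pi_ge0.
  by have := @pi_ge2 R; lra.
(* The factor 2 counts sine and cosine; [D1] bounds the scales below 1 and [D2] the others. *)
pose C := 2 * 2 `^ s * (D1 + D2).
exists (kap * (2 `^ r)^-1), C; split.
- by rewrite mulr_gt0// invr_gt0 powR_gt0.
- by rewrite !mulr_ge0 ?powR_ge0// addr_ge0 ?ltW.
move=> x y; pose F j := `|snow (r / s) j x - snow (r / s) j y| `^ s.
have F0 j : 0 <= F j by exact: powR_ge0.
have F0E j : (0 <= (F j)%:E)%E by rewrite lee_fin.
have [->|xy] := eqVneq x y.
  rewrite subrr normr0 powR0 ?gt_eqF// !mulr0 eseries0 ?lexx// => j _ _.
  by rewrite subrr normr0 powR0 ?gt_eqF.
pose e := `|x - y|; have e0 : 0 < e by rewrite normr_gt0 subr_eq0.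
have ler (a b : R) : 0 <= a -> a <= b -> a `^ s <= b `^ s.
  by move=> a0 ab; rewrite ge0_ler_powR ?nnegrE ?(ltW s0)// (le_trans a0).
apply/andP; split.
- have [k /andP[k1 k2]] := scale_ex e0.
  apply: le_trans (nneseries_ge k.+1.*2 F0E).
  rewrite sumEFin lee_fin sum_double big_nat_recr//=.
  apply: (@le_trans _ _ (F k.*2 + F k.*2.+1)); last by rewrite lerDr sumr_ge0// => i _; rewrite addr_ge0.
  rewrite /F !snow_term//= odd_double/= uphalf_double doubleK -mulrDr.
  have t : 1 <= `|scale k * x - scale k * y| <= 2.
    by rewrite -mulrBr normrM gtr0_norm ?scale_gt0// k1.
  apply: (@le_trans _ _ (scale k `^ (- r) * kap)); last first.
    by rewrite ler_wpM2l ?powR_ge0// trig_increment.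
  rewrite -mulrA mulrC ler_wpM2r ?(ltW kap0)// mulrC ler_pdivrMr ?powR_gt0//.
  rewrite powRN mulrC ler_pdivlMr ?powR_gt0 ?scale_gt0// -powRM ?(ltW e0) ?(ltW (scale_gt0 _))//.
  rewrite ge0_ler_powR ?nnegrE ?(ltW r0) ?mulr_ge0 ?(ltW e0) ?(ltW (scale_gt0 _))//.
  by rewrite mulrC.
- pose B k := 2 `^ s * e `^ r * bump (s - r) r (scale k * e).
  have B0 k : 0 <= B k by rewrite !mulr_ge0 ?powR_ge0 ?bump_ge0.
  have FB j : F j <= B j./2.
    rewrite /F snow_term//; set L := scale _.
    have L0 : 0 < L by exact: scale_gt0.
    have Le0 : 0 < L * e by exact: mulr_gt0.
    set z := (if _ then _ else _).
    have z1 : `|z| <= L * e.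
      rewrite /z; case: ifP => _.
        by rewrite (le_trans (sin_lipschitz _ _))// -mulrBr normrM gtr0_norm.
      by rewrite (le_trans (cos_lipschitz _ _))// -mulrBr normrM gtr0_norm.
    have z2 : `|z| <= 2.
      have h (p q : R) : `|p| <= 1 -> `|q| <= 1 -> `|p - q| <= 2.
        by move=> p1 q1; rewrite (le_trans (ler_normB _ _))// -[2]/(1 + 1) lerD.
      by rewrite /z; case: ifP => _; apply: h; rewrite ?cos_max ?sin_max.
    have -> : L `^ (- r) = e `^ r * (L * e) `^ (- r).
      rewrite powRM ?(ltW L0) ?(ltW e0)// mulrCA -powRD ?subrr ?powRr0 ?mulr1//.
      by rewrite eqxx (gt_eqF e0).
    have -> : B j./2 = e `^ r * (2 `^ s * bump (s - r) r (L * e)) by rewrite /B /L; ring.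
    rewrite -mulrA ler_wpM2l ?powR_ge0// /bump.
    rewrite minr_pMr ?powR_ge0// le_min; apply/andP; split.
      apply: (@le_trans _ _ (1 * (L * e) `^ (s - r))).
        rewrite mul1r addrC powRD; last by rewrite (gt_eqF Le0) implybT.
        by rewrite ler_wpM2l ?powR_ge0// ler.
      rewrite ler_wpM2r ?powR_ge0//.
      by rewrite -[leLHS](powRr0 2) ler_powR// ?ler1n// ltW.
    by rewrite mulrC ler_wpM2r ?powR_ge0// ler.
  apply: nneseries_le => // n; rewrite sumEFin lee_fin.
  have nn : (n <= n.*2.*2)%N by rewrite -!addnn -addnA leq_addr.
  apply: (@le_trans _ _ (\sum_(0 <= j < n.*2.*2) F j)).
    by rewrite (big_cat_nat _ nn)//= lerDl sumr_ge0.
  rewrite sum_double.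
  apply: (@le_trans _ _ (\sum_(0 <= k < n.*2) (B k + B k))).
    apply: ler_sum => k _; rewrite lerD//.
      by have := FB k.*2; rewrite doubleK.
    by have := FB k.*2.+1; rewrite /= uphalf_double.
  rewrite sum_double /C.
  under eq_bigr => i _.
    rewrite /B /scale/= odd_double/= uphalf_double doubleK.
    rewrite [X in X + _](_ : _ = 2 * 2 `^ s * e `^ r * bump (s - r) r (e / 2 / 2 ^+ i)); last first.
      by rewrite (_ : (2 ^+ i.+1)^-1 * e = e / 2 / 2 ^+ i) ?exprS ?invfM; ring.
    rewrite [X in _ + X](_ : _ = 2 * 2 `^ s * e `^ r * bump (s - r) r (e * 2 ^+ i)); last first.
      by rewrite [2 ^+ i * e]mulrC; ring.
    rewrite -mulrDr; over.
  rewrite -mulr_sumr big_split/= -!mulrA ler_wpM2l// ler_wpM2l ?powR_ge0//.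
  rewrite mulrC ler_wpM2r ?powR_ge0// lerD ?D2P// D1P//.
  by rewrite divr_gt0.
Qed.

End snowflake.

Lemma measurable_fun_nat_index d (T : measurableType d) d' (T' : measurableType d')
    (k : T -> nat) (F : nat -> T -> T') :
  (forall j, measurable (k @^-1` [set j])) -> (forall j, measurable_fun setT (F j)) ->
  measurable_fun setT (fun t => F (k t) t).
Proof.
move=> mk mF _ B mB; rewrite setTI.
rewrite (_ : _ @^-1` B = \bigcup_j (k @^-1` [set j] `&` F j @^-1` B)).
  apply: bigcupT_measurable => j; apply: measurableI => //.
  by rewrite -[X in measurable X]setTI; exact: mF.
by apply/seteqP; split => t /= => [h|[j _ /= [<-]]//]; exists (k t).
Qed.

(** One enumeration serves all double series: it enters the definition of maps, so it must not
    depend on the terms. *)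
Lemma nneseries_pair : exists b : nat -> nat * nat, forall (R : realType)
    (a : nat -> nat -> \bar R), (forall i j, 0 <= a i j)%E ->
  (\sum_(n <oo) a (b n).1 (b n).2 = \sum_(i <oo) \sum_(j <oo) a i j)%E.
Proof.
have /card_set_bijP[b bij] : ([set: nat] #= [set: nat * nat])%card by rewrite card_eq_sym card_nat2.
exists b => R a a0; rewrite !nneseries_esumT//; last first.
  by move=> i; apply: nneseries_ge0 => *; exact: a0.
under [RHS]eq_esum do rewrite nneseries_esumT//.
rewrite esum_esum//.
rewrite (reindex_esum setT _ b)// (_ : setT `*`` _ = setT)//.
by apply/seteqP; split.
Qed.

(** * Measures that absorb countable sums of themselves *)

Section absorbing.
Context d (T : measurableType d) (R : realType) (mu : {measure set T -> \bar R}).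

(* [mu] contains countably many disjoint copies of itself, the copy [j] being
   [kap = j] with the measure rescaled by [c j]. *)
Definition absorbing := exists (kap : T -> nat) (psi : T -> T) (c : nat -> R),
  [/\ forall j, measurable (kap @^-1` [set j]), measurable_fun setT psi,
      forall j, 0 < c j &
      forall H : nat -> T -> \bar R, (forall j, measurable_fun setT (H j)) ->
        (forall j t, 0 <= H j t)%E ->
        (\int[mu]_t ((c (kap t))%:E * H (kap t) (psi t)) = \sum_(j <oo) \int[mu]_t H j t)%E].

Lemma absorbing_snow_embeds (r s : R) (r1 : 1 <= r) (s1 : 1 <= s) : absorbing -> r < s ->
  power_embeds (LspaceType mu (lee1_fin r1)) (LspaceType mu (lee1_fin s1)) r s.
Proof.
move=> [kap [psi [c [mkap mpsi c0 absorb]]]] rs.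
have r0 : 0 < r by exact: lt_le_trans r1.
have s0 : 0 < s by exact: lt_le_trans s1.
have [l [C [l0 C0 bnd]]] := snow_bounds r0 rs.
(* The j-th snowflake coordinate of f is placed on the j-th copy; the power 1/s of the weight makes
   the rescaling of the measure disappear from the s-th moment. *)
pose Phi (f : T -> R) t := c (kap t) `^ s^-1 * snow (r / s) (kap t) (f (psi t)).
have mD (f g : T -> R) j : measurable_fun setT f -> measurable_fun setT g ->
    measurable_fun setT (fun t => (`|snow (r / s) j (f t) - snow (r / s) j (g t)| `^ s)%:E).
  move=> mf mg; apply: measurable_powR_norm; apply: measurable_funB.
    by apply: (measurableT_comp (measurable_snow (r / s) j)).
  by apply: (measurableT_comp (measurable_snow (r / s) j)).
apply: (@Lspace_power_embeds _ T _ T R mu mu r s r1 s1 Phi l C) => //.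
- move=> f mf; apply: (measurable_fun_nat_index
    (F := fun j t => c j `^ s^-1 * snow (r / s) j (f (psi t)))) => // j.
  apply: measurable_funM => //; apply: (measurableT_comp (measurable_snow (r / s) j)).
  exact: measurableT_comp.
- by apply/funext => t; rewrite /Phi snow0 mulr0.
move=> f g mf mg _ _.
have -> : (\int[mu]_t (`|Phi f t - Phi g t| `^ s)%:E = \int[mu]_t
    \sum_(j <oo) (`|snow (r / s) j (f t) - snow (r / s) j (g t)| `^ s)%:E)%E.
  rewrite integral_nneseries//; last by move=> j; exact: mD.
  rewrite -absorb; [|by move=> j; exact: mD|by move=> j t; rewrite lee_fin powR_ge0].
  apply: eq_integral => t _; rewrite /Phi -mulrBr normrM powRM// ger0_norm ?powR_ge0//.
  by rewrite -powRrM mulVf ?gt_eqF// powRr1// ltW.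
have mfg : measurable_fun setT (fun t => (`|f t - g t| `^ r)%:E).
  by apply: measurable_powR_norm; exact: measurable_funB.
have mS : measurable_fun setT (fun t =>
    \sum_(j <oo) (`|snow (r / s) j (f t) - snow (r / s) j (g t)| `^ s)%:E)%E.
  by apply: measurable_nneseries => // j; exact: mD.
apply/andP; split.
  rewrite -ge0_integralZl_EFin ?(ltW l0)//; apply: ge0_le_integral => //.
  - by move=> t _; rewrite mule_ge0 ?lee_fin ?(ltW l0) ?powR_ge0.
  - exact: measurable_funeM.
  - by move=> t _; have /andP[] := bnd (f t) (g t); rewrite EFinM.
rewrite -ge0_integralZl_EFin//; apply: ge0_le_integral => //.
- by move=> t _; apply: nneseries_ge0 => *; rewrite lee_fin powR_ge0.
- exact: measurable_funeM.
- by move=> t _; have /andP[] := bnd (f t) (g t); rewrite EFinM.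
Qed.

End absorbing.

Lemma counting_absorbing (R : realType) : absorbing (@counting nat R : {measure set nat -> \bar R}).
Proof.
have [b bE] := nneseries_pair.
exists (fun n => (b n).1), (fun n => (b n).2), (fun=> 1); split=> // H _ H0.
rewrite ge0_integral_count; last by move=> n; rewrite mule_ge0.
under eq_eseriesr do rewrite mul1e.
rewrite (bE R)//; apply: eq_eseriesr => j _; rewrite ge0_integral_count//.
Qed.

Section Lunit_copies.
Context {R : realType}.
Local Notation TR := (measurableTypeR R).
Local Notation unif := (@unif R).
Local Notation lambda := (@lebesgue_measure R).

(* The copies live on the intervals [](j + 2)^-1, (j + 1)^-1]]. *)
Definition copy (t : R) : nat := (Num.truncn t^-1).-1.

Lemma copy_gt n : [set t : TR | (n < copy t)%N] = `]0, (n.+2%:R)^-1]%classic.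
Proof.
apply/seteqP; split => t; rewrite /copy/= in_itv/= ltn_predRL truncn_gt_nat.
  move=> h; have t0 : 0 < t by rewrite -invr_gt0 (lt_le_trans _ h).
  by rewrite t0/= -[t]invrK lef_pV2 ?posrE ?invr_gt0.
by move=> /andP[t0 tn]; rewrite -[_%:R]invrK lef_pV2 ?posrE ?invr_gt0.
Qed.

Lemma measurable_copy_eq j : measurable ((copy : TR -> nat) @^-1` [set j]).
Proof.
have mgt n : measurable [set t : TR | (n < copy t)%N] by rewrite copy_gt; exact: measurable_itv.
(* The fibre over 0 also collects every point outside ]0, 1], so it is handled as a complement. *)
case: j => [|j].
  rewrite (_ : _ @^-1` _ = ~` [set t : TR | (0 < copy t)%N]); first exact: measurableC.
  by apply/seteqP; split => t /=; [move=> ->|case: (copy t)].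
rewrite (_ : _ @^-1` _ = [set t : TR | (j < copy t)%N] `\` [set t : TR | (j.+1 < copy t)%N]).
  exact: measurableD.
apply/seteqP; split => t /=; first by move=> ->; rewrite ltnS leqnn ltnn.
by move=> [h1 /negP]; rewrite -leqNgt => h2; apply/eqP; rewrite eqn_leq h1 h2.
Qed.

Lemma unif_copy_gt0 j : (0 < unif (copy @^-1` [set j]))%E.
Proof.
apply: (@lt_le_trans _ _ (unif `]j.+2%:R^-1, j.+1%:R^-1]%classic)).
  rewrite /unif /mrestr setIidl.
    rewrite lebesgue_measure_itv/= lte_fin.
    have h : j.+2%:R^-1 < j.+1%:R^-1 :> R by rewrite ltf_pV2 ?posrE ?ltr_nat.
    by rewrite h -EFinB lte_fin subr_gt0.
  move=> t /=; rewrite !in_itv/= => /andP[h1 h2]; apply/andP; split.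
    by apply: le_trans (ltW h1); rewrite invr_ge0.
  by apply: (le_trans h2); rewrite invf_le1// ler1n.
apply: le_measure; rewrite ?inE; [exact: measurable_itv|exact: measurable_copy_eq|].
move=> t /=; rewrite in_itv/= => /andP[h1 h2].
have t0 : 0 < t by apply: lt_trans h1; rewrite invr_gt0.
have tn : Num.truncn t^-1 = j.+1.
  apply: truncn_def; rewrite -[j.+1%:R]invrK lef_pV2 ?posrE ?invr_gt0// h2/=.
  by rewrite -[j.+2%:R]invrK ltf_pV2 ?posrE ?invr_gt0.
by rewrite /copy tn.
Qed.

Definition copy_weight j : R := (fine (unif (copy @^-1` [set j])))^-1.

Lemma copy_weight_gt0 j : 0 < copy_weight j.
Proof.
rewrite invr_gt0 fine_gt0// unif_copy_gt0/=.
by apply: (le_lt_trans (unif_fin (measurable_copy_eq j))); exact: ltry.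
Qed.

Lemma integral_copy (H : nat -> \bar R) : (forall j, 0 <= H j)%E ->
  (\int[unif]_t ((copy_weight (copy t))%:E * H (copy t)) = \sum_(j <oo) H j)%E.
Proof.
move=> H0; pose A j : set TR := copy @^-1` [set j].
have UA : \bigcup_j A j = setT by apply/seteqP; split => t // _; exists (copy t).
have mA j : measurable (A j) by exact: measurable_copy_eq.
have w0 t : (0 <= (copy_weight (copy t))%:E * H (copy t))%E.
  by rewrite mule_ge0// lee_fin ltW// copy_weight_gt0.
rewrite -[in LHS]UA ge0_integral_bigcup//.
- apply: eq_eseriesr => j _.
  rewrite (eq_integral (fun=> (copy_weight j)%:E * H j)%E); last first.
    by move=> t; rewrite inE /A/= => ->.
  rewrite integral_cst// muleAC -[RHS]mul1e; congr (_ * _)%E.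
  have fj : unif (A j) \is a fin_num by rewrite fin_num_measure.
  transitivity ((copy_weight j)%:E * unif (A j))%E; first by [].
  rewrite -[unif (A j)]fineK// -EFinM mulVf// gt_eqF// -invr_gt0.
  exact: copy_weight_gt0.
- rewrite UA; apply: (measurable_fun_nat_index (k := (copy : TR -> nat))
    (F := fun j _ => (copy_weight j)%:E * H j)%E) => j; first exact: mA.
  exact: measurable_cst.
- by move=> i j _ _ [t [<- <-]].
Qed.

(** [psi1] selects the copy and the independent [psi2] the point in it. *)
Lemma unif_absorbing : absorbing unif.
Proof.
exists (fun t => copy (psi1 t)), psi2, copy_weight; split.
- move=> j; have -> : (fun t => copy (psi1 t)) @^-1` [set j] = psi1 @^-1` (copy @^-1` [set j]) by [].
  rewrite -[X in measurable X]setTI; apply: measurable_psi1 => //.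
  exact: measurable_copy_eq.
- exact: measurable_psi2.
- exact: copy_weight_gt0.
move=> H mH H0.
pose G (z : TR * TR) := ((copy_weight (copy z.1))%:E * H (copy z.1) z.2)%E.
have w0 j : (0 <= (copy_weight j)%:E)%E by rewrite lee_fin ltW// copy_weight_gt0.
transitivity (\int[unif]_t G (psi1 t, psi2 t))%E; first by [].
rewrite integral_psi; last 2 first.
- apply: (measurable_fun_nat_index (k := fun z : TR * TR => copy z.1)
    (F := fun j z => (copy_weight j)%:E * H j z.2)%E) => j.
    rewrite (_ : _ @^-1` _ = (fst : TR * TR -> TR) @^-1` (copy @^-1` [set j]))//.
    by rewrite -[X in measurable X]setTI; apply: measurable_fst => //; exact: measurable_copy_eq.
  apply: measurable_funeM; apply: (measurableT_comp (mH j)); exact: measurable_snd.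
- by move=> z; rewrite mule_ge0.
rewrite -integral_copy; last by move=> j; exact: integral_ge0.
apply: eq_integral => x _; rewrite /G/= ge0_integralZl_EFin//.
by rewrite ltW// copy_weight_gt0.
Qed.

Lemma ell_embeds_Lunit (r : R) (r1 : 1 <= r) : power_embeds (ell r1) (Lunit r1) r r.
Proof.
have r0 : 0 < r by exact: lt_le_trans r1.
pose Phi (a : nat -> R) (t : TR) : R := copy_weight (copy t) `^ r^-1 * a (copy t).
apply: (@Lspace_power_embeds _ nat _ TR R counting unif r r r1 r1 Phi 1 1) => //.
- move=> a _; apply: (measurable_fun_nat_index (k := (copy : TR -> nat))
    (F := fun j _ => copy_weight j `^ r^-1 * a j : TR)) => j; first exact: measurable_copy_eq.
  exact: measurable_cst.
- by apply/funext => t; rewrite /Phi mulr0.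
move=> a b _ _ _ _; rewrite !mul1e ge0_integral_count//.
have -> : (\int[unif]_t (`|Phi a t - Phi b t| `^ r)%:E = \sum_(k <oo) (`|a k - b k| `^ r)%:E)%E.
  rewrite -integral_copy//; apply: eq_integral => t _.
  rewrite /Phi -mulrBr normrM powRM// ger0_norm ?powR_ge0// -powRrM mulVf ?gt_eqF//.
  by rewrite powRr1// ltW// copy_weight_gt0.
by rewrite lexx.
Qed.

End Lunit_copies.

(** * Random sums with weights 1 / k^(1/r) *)

Section coordinates.
Context {R : realType}.
Local Notation TR := (measurableTypeR R).
Local Notation unif := (@unif R).

Let mpre (f : TR -> TR) (A : set TR) : measurable_fun setT f -> measurable A ->
  measurable (f @^-1` A).
Proof. by move=> mf mA; rewrite -[X in measurable X]setTI; exact: mf. Qed.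

Lemma unif_psi1 (A : set TR) : measurable A -> unif (psi1 @^-1` A) = unif A.
Proof.
move=> mA; have := unif_psi mA (@measurableT _ TR).
by rewrite preimage_setT setIT unif_setT mule1. Qed.

Lemma unif_psi2 (A : set TR) : measurable A -> unif (psi2 @^-1` A) = unif A.
Proof.
move=> mA; have := unif_psi (@measurableT _ TR) mA.
by rewrite preimage_setT setTI unif_setT mul1e. Qed.

Lemma unif_iter_psi2 k (A : set TR) : measurable A -> unif (iter k psi2 @^-1` A) = unif A.
Proof.
elim: k A => // k IH A mA.
rewrite -[LHS]/(unif (iter k psi2 @^-1` (psi2 @^-1` A))) IH ?unif_psi2//.
by apply: mpre => //; exact: measurable_psi2.
Qed.

Lemma unif_coord k (A : set TR) : measurable A -> unif (coord k @^-1` A) = unif A.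
Proof.
move=> mA; rewrite -[LHS]/(unif (iter k psi2 @^-1` (psi1 @^-1` A))) unif_iter_psi2 ?unif_psi1//.
by apply: mpre => //; exact: measurable_psi1.
Qed.

(** For k < l both coordinates are read on the k-th iterate of [psi2]: the first through [psi1], the
    second through [psi2]. Pairs suffice for the second moment method. *)
Lemma unif_coord_indep k l (A B : set TR) : measurable A -> measurable B -> k != l ->
  unif (coord k @^-1` A `&` coord l @^-1` B) = (unif A * unif B)%E.
Proof.
wlog kl : k l A B / (k < l)%N.
  move=> H mA mB; rewrite neq_ltn => /orP[kl|lk].
    by apply: H => //; rewrite neq_ltn kl.
  by rewrite setIC muleC; apply: H => //; rewrite neq_ltn lk.
move=> mA mB _; have m1 := @measurable_psi1 R; have m2 := @measurable_psi2 R.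
have mcB : measurable (coord (l - k.+1) @^-1` B) by apply: mpre => //; exact: measurable_coord.
have -> : coord k @^-1` A `&` coord l @^-1` B =
    iter k psi2 @^-1` (psi1 @^-1` A `&` psi2 @^-1` (coord (l - k.+1) @^-1` B)).
  have lE t : coord l t = coord (l - k.+1) (psi2 (iter k psi2 t)).
    by rewrite /coord -iterS -iterD subnK.
  by apply/seteqP; split => t /=; rewrite lE.
rewrite unif_iter_psi2; last by apply: measurableI; apply: mpre.
by rewrite unif_psi// unif_coord.
Qed.

Lemma integral_coord k (F : R -> \bar R) : measurable_fun setT (F : TR -> \bar R) ->
  (forall x, 0 <= F x)%E -> (\int[unif]_x F (coord k x) = \int[unif]_x F x)%E.
Proof.
move=> mF F0; have mc := @measurable_coord R k.
rewrite [RHS](eq_measure_integral (image_measure unif mc)).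
  by rewrite ge0_integral_pushforward.
by move=> A mA _; exact: esym (unif_coord k mA).
Qed.

(** Makes random sums well defined on classes: changing f on a null set changes its values at the
    sample points with probability 0. *)
Lemma ae_coord_psi1 (P : R -> Prop) : {ae (unif : {measure set TR -> \bar R}), forall x, P x} ->
  {ae (unif : {measure set TR -> \bar R}), forall t, forall k, P (coord k (psi1 t))}.
Proof.
move=> [N [mN N0 PN]].
have m1 := @measurable_psi1 R.
pose F k : set TR := psi1 @^-1` (coord k @^-1` N).
have mF k : measurable (F k) by do 2 apply: mpre => //; exact: measurable_coord.
have mUF : measurable (\bigcup_k F k) by exact: bigcupT_measurable.
have B : (unif (\bigcup_k F k) <= \sum_(k <oo) unif (F k))%E.
  exact: (generalized_Boole_inequality (unif : {measure set TR -> \bar R})).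
exists (\bigcup_k F k); split => //.
- apply/eqP; rewrite -measure_le0; apply: (le_trans B).
  apply: nneseries_le => // n; rewrite big1// => k _.
  rewrite /F unif_psi1; last by apply: mpre => //; exact: measurable_coord.
  by rewrite unif_coord.
- move=> t /= /existsNP[k nP]; exists k => //=; exact: PN.
Qed.

End coordinates.

Section chung_erdos.
Context d (T : measurableType d) (R : realType) (P : probability T R).

(* Second moment method: [2 * l * N <= \1_(N > 0) + l ^+ 2 * N ^+ 2]. *)
Lemma probability_bigcup_ge (n : nat) (A : nat -> set T) (m : R) :
  (forall k, measurable (A k)) ->
  (\sum_(k < n) P (A k) = m%:E)%E ->
  (forall k l, k != l -> P (A k `&` A l) = P (A k) * P (A l))%E ->
  ((m / (1 + m))%:E <= P (\bigcup_(k in `I_n) A k))%E.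
Proof.
move=> mA mE indep.
have m0 : 0 <= m by rewrite -lee_fin -mE sume_ge0.
(* The value maximizing 2lm - l^2 (m + m^2), the lower bound obtained by integrating the pointwise
   inequality. *)
pose l := (1 + m)^-1; have l0 : 0 <= l by rewrite invr_ge0 addr_ge0.
pose U := \bigcup_(k in `I_n) A k.
have mU : measurable U by apply: bigcup_measurable.
pose N (x : T) : R := \sum_(k < n) \1_(A k) x.
have N0 x : 0 <= N x by apply: sumr_ge0.
have m1 k : measurable_fun setT (fun x => (\1_(A k) x)%:E : \bar R).
  by apply/measurable_EFinP; exact: measurable_indic.
have mN : measurable_fun setT N by apply: measurable_sum => k; exact: measurable_indic.
have IN : (\int[P]_x (N x)%:E = m%:E)%E.
  rewrite -mE; under eq_integral do rewrite /N -sumEFin.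
  rewrite ge0_integral_sum//; apply: eq_bigr => k _.
  by rewrite integral_indic// setIT.
have IN2 : (\int[P]_x (N x ^+ 2)%:E <= (m + m ^+ 2)%:E)%E.
  have -> : (\int[P]_x (N x ^+ 2)%:E = \sum_(k < n) \sum_(l < n) P (A k `&` A l))%E.
    under eq_integral.
      move=> x _; rewrite expr2 {1}/N mulr_suml -sumEFin.
      under eq_bigr do rewrite /N mulr_sumr -sumEFin; over.
    rewrite ge0_integral_sum//; last 2 first.
      move=> k; apply: emeasurable_sum => j; apply/measurable_EFinP.
      by apply: measurable_funM; exact: measurable_indic.
      by move=> k x _; apply: sume_ge0 => j _; rewrite lee_fin.
    apply: eq_bigr => k _; rewrite ge0_integral_sum//; last first.
      by move=> j; apply/measurable_EFinP; apply: measurable_funM; exact: measurable_indic.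
    apply: eq_bigr => j _.
    under eq_integral do rewrite -[(_ * _)%R]/((\1_(A k) \* \1_(A j)) _) -indicI.
    by rewrite integral_indic ?setIT//; exact: measurableI.
  apply: (@le_trans _ _ (\sum_(k < n) (P (A k) + P (A k) * m%:E))%E).
    apply: lee_sum => k _; rewrite (bigD1 k)//= setIid leeD2l//.
    rewrite -mE ge0_sume_distrr//; rewrite [leRHS](bigD1 k)//=.
    rewrite (eq_bigr (fun i : 'I_n => (P (A k) * P (A i))%E)); last first.
      by move=> i ik; rewrite indep// eq_sym.
    by rewrite leeDr// mule_ge0.
  rewrite big_split/= mE -ge0_sume_distrl// mE -EFinM -EFinD lee_fin expr2//.
have key : ((2 * l * m)%:E <= P U + (l ^+ 2 * (m + m ^+ 2))%:E)%E.
  have -> : ((2 * l * m)%:E = \int[P]_x (2 * l * N x)%:E)%E.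
    under eq_integral do rewrite EFinM.
    rewrite ge0_integralZl_EFin ?mulr_ge0// ?IN//.
      by move=> x _; rewrite lee_fin.
    by apply/measurable_EFinP.
  apply: (@le_trans _ _ (\int[P]_x ((\1_U x)%:E + (l ^+ 2 * N x ^+ 2)%:E))%E).
    apply: ge0_le_integral => //.
    - by move=> x _; rewrite lee_fin !mulr_ge0.
    - by apply/measurable_EFinP; apply: measurable_funM.
    - apply: emeasurable_funD; apply/measurable_EFinP; first exact: measurable_indic.
      by apply: measurable_funM => //; exact: measurable_funX.
    - move=> x _; rewrite -EFinD lee_fin indicE.
      have [xU|xU] := boolP (x \in U).
        by have := sqr_ge0 (1 - l * N x); rewrite /=; nra.
      have -> : N x = 0.
        rewrite /N big1// => k _; rewrite indicE memNset// => Ak.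
        by move: xU; rewrite notin_setE; apply; exists k => //=.
      by rewrite mulr0 expr0n mulr0 addr0.
  rewrite ge0_integralD//; last 3 first.
    by apply/measurable_EFinP; exact: measurable_indic.
    by move=> x _; rewrite lee_fin mulr_ge0 ?exprn_ge0 ?sqr_ge0.
    by apply/measurable_EFinP; apply: measurable_funM => //; exact: measurable_funX.
  rewrite integral_indic// setIT leeD2l//.
  under eq_integral do rewrite EFinM.
  rewrite ge0_integralZl_EFin ?exprn_ge0//; last 2 first.
    by move=> x _; rewrite lee_fin sqr_ge0.
    by apply/measurable_EFinP; exact: measurable_funX.
  by rewrite [leRHS]EFinM lee_wpmul2l ?lee_fin ?exprn_ge0.
have PU : P U = (fine (P U))%:E by rewrite fineK// fin_num_measure.
move: key; rewrite PU -EFinD !lee_fin => key.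
have -> : m / (1 + m) = 2 * l * m - l ^+ 2 * (m + m ^+ 2).
  by rewrite /l; field; rewrite gt_eqF// ltr_pwDl.
lra.
Qed.

End chung_erdos.

(** * Truncated moments and dyadic weights *)

Section truncated_moments.
Context {R : realType}.
Local Notation TR := (measurableTypeR R).
Local Notation unif := (@unif R).
Implicit Types (r s x z : R) (n k i : nat).

Definition trunc_pow s x : R := Num.min (`|x| ^+ 2) (`|x| `^ s).

Lemma trunc_pow_ge0 s x : 0 <= trunc_pow s x.
Proof. by rewrite le_min sqr_ge0 powR_ge0. Qed.

Lemma measurable_trunc_pow s : measurable_fun setT (trunc_pow s : TR -> TR).
Proof.
apply: measurable_minr; first by apply: measurable_funX; exact: normr_measurable.
apply: (@measurableT_comp _ _ _ _ _ _ (fun x : R => x `^ s)) => //.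
Qed.

(* Chebyshev at the level [l = maxr 1 V]^1/2, where [V] is the variance. *)
Lemma integral_rsum_trunc n (a : R^nat) s : 1 <= s -> s <= 2 ->
  (\int[unif]_t (`|rsum n a t| `^ s)%:E <= (2 * (1 + \sum_(k < n) trunc_pow s (a k)))%:E)%E.
Proof.
move=> s1 s2; have s0 : 0 < s by exact: lt_le_trans s1.
set V := \sum_(k < n) a k ^+ 2.
have V0 : 0 <= V by apply: sumr_ge0 => k _; exact: sqr_ge0.
have aV k : (k < n)%N -> `|a k| ^+ 2 <= V.
  move=> kn; rewrite real_normK ?num_real// /V (bigD1 (Ordinal kn))//= lerDl sumr_ge0// => j _.
  exact: sqr_ge0.
have pw (l x : R) : 0 < l -> `|x| `^ s <= l `^ s + l `^ (s - 2) * x ^+ 2.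
  move=> l0; have [xl|lx] := leP `|x| l.
    apply: (@le_trans _ _ (l `^ s)).
      by rewrite ge0_ler_powR ?nnegrE ?(ltW s0) ?(ltW l0).
    by rewrite lerDl mulr_ge0 ?powR_ge0 ?sqr_ge0.
  have x0 : 0 < `|x| by exact: lt_trans lx.
  apply: (@le_trans _ _ (l `^ (s - 2) * x ^+ 2)); last by rewrite lerDr powR_ge0.
  rewrite -[x ^+ 2]real_normK ?num_real// -powR_mulrn// -[in leLHS](subrK 2 s).
  rewrite (@powRD _ `|x| (s - 2) 2); last by rewrite (gt_eqF x0) implybT.
  rewrite ler_wpM2r ?powR_ge0// (_ : s - 2 = - (2 - s)) ?powRN; last by ring.
  rewrite lef_pV2 ?posrE ?powR_gt0//.
  by rewrite ge0_ler_powR ?nnegrE ?(ltW l0) ?(ltW lx)//; lra.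
have step l : 0 < l -> (\int[unif]_t (`|rsum n a t| `^ s)%:E <= (l `^ s + l `^ (s - 2) * V)%:E)%E.
  move=> l0.
  have m2 : measurable_fun setT (fun t : TR => (rsum n a t ^+ 2)%:E).
    by apply/measurable_EFinP; apply: measurable_funX; exact: measurable_rsum.
  apply: (@le_trans _ _ (\int[unif]_t ((l `^ s)%:E + (l `^ (s - 2))%:E * (rsum n a t ^+ 2)%:E))%E).
    apply: ge0_le_integral => //.
    - exact: measurable_rsum_powR.
    - by apply: emeasurable_funD => //; exact: measurable_funeM.
    - by move=> t _; rewrite -EFinM -EFinD lee_fin pw.
  rewrite ge0_integralD//; last 3 first.
  - by move=> t _; rewrite lee_fin powR_ge0.
  - by move=> t _; rewrite mule_ge0 ?lee_fin ?powR_ge0 ?sqr_ge0.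
  - exact: measurable_funeM.
  rewrite integral_unif_cst ge0_integralZl_EFin ?powR_ge0//; last first.
    by move=> t _; rewrite lee_fin sqr_ge0.
  by rewrite integral_rsum_sqr -EFinM -EFinD.
have [V1|V1] := leP V 1.
  apply: (le_trans (step 1 ltr01)); rewrite !powR1 mul1r lee_fin.
  (* When V <= 1 no coefficient exceeds 1 in absolute value, so every truncation is a square. *)
  have -> : V = \sum_(k < n) trunc_pow s (a k).
    apply: eq_bigr => k _; rewrite /trunc_pow min_l ?real_normK ?num_real//.
    have ak1 : `|a k| <= 1.
      by rewrite -[leRHS]ger0_norm// -ler_sqr ?nnegrE// ger0_norm// expr1n (le_trans (aV k _)).
    have [->|ak0] := eqVneq (a k) 0; first by rewrite expr0n powR_ge0.
    rewrite -real_normK ?num_real// -powR_mulrn// ger_powR// normr_gt0 ak0//.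
  have h : 0 <= \sum_(k < n) trunc_pow s (a k) by apply: sumr_ge0 => *; exact: trunc_pow_ge0.
  by lra.
have V0' : 0 < V by exact: lt_trans V1.
pose l := V `^ 2^-1; have l0 : 0 < l by exact: powR_gt0.
have l2 : l ^+ 2 = V by rewrite -powR_mulrn ?(ltW l0)// -powRrM mulVf// powRr1.
have l1 : 1 <= l.
  rewrite -[leLHS]ger0_norm// -[leRHS]ger0_norm ?(ltW l0)// -ler_sqr ?nnegrE//.
  by rewrite !ger0_norm ?(ltW l0)// expr1n l2 ltW.
apply: (le_trans (step l l0)); rewrite lee_fin.
have -> : l `^ s = l `^ (s - 2) * V.
  by rewrite -l2 -powR_mulrn ?(ltW l0)// -powRD ?subrK// (gt_eqF l0) implybT.
(* When V > 1 both Chebyshev terms equal l^(s-2) V. Each summand is below the truncation because s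
   <= 2, l >= 1 and |a_k| <= l. *)
suff h : l `^ (s - 2) * V <= \sum_(k < n) trunc_pow s (a k).
  by lra.
rewrite /V mulr_sumr; apply: ler_sum => k _.
have lp0 := powR_ge0 l (s - 2).
rewrite /trunc_pow le_min; apply/andP; split.
  rewrite real_normK ?num_real// ler_piMl ?sqr_ge0//.
  by rewrite -[leRHS](powRr0 l) ler_powR//; lra.
have [->|ak0] := eqVneq (a k) 0; first by rewrite expr0n mulr0 powR_ge0.
have nak : 0 < `|a k| by rewrite normr_gt0.
rewrite -[a k ^+ 2]real_normK ?num_real// -powR_mulrn// -[in leRHS](subrK 2 s).
rewrite (@powRD _ `|a k| (s - 2) 2); last by rewrite (gt_eqF nak) implybT.
rewrite ler_wpM2r ?powR_ge0// (_ : s - 2 = - (2 - s)) ?powRN; last by ring.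
  rewrite lef_pV2 ?posrE ?powR_gt0//.
rewrite ge0_ler_powR ?nnegrE ?(ltW l0)//; first by lra.
by rewrite -ler_sqr ?nnegrE ?(ltW l0)// l2 aV.
Qed.

(** Index 0 gets weight 0: [trunc_log] would put it in block 0, which must have exactly one index
    for block i to have 2^i. *)
Definition wt r k : R :=
  if k == 0%N then 0 else ((2 ^+ trunc_log 2 k)^-1) `^ r^-1.

Lemma wt_ge0 r k : 0 <= wt r k.
Proof. by rewrite /wt; case: ifP => // _; rewrite powR_ge0. Qed.

Lemma sum_trunc_log (G : nat -> R) n :
  \sum_(0 <= k < 2 ^ n) (if k == 0%N then 0 else G (trunc_log 2 k)) =
  \sum_(0 <= i < n) 2 ^+ i * G i.
Proof.
elim: n => [|n IH]; first by rewrite big_nat1/= big_geq.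
have nn : (2 ^ n <= 2 ^ n.+1)%N by rewrite leq_exp2l.
rewrite (big_cat_nat _ nn)//= IH big_nat_recr//=; congr (_ + _).
rewrite (eq_big_nat _ _ (F2 := fun=> G n)); last first.
  move=> k /andP[k1 k2]; rewrite -[k == _]negbK -lt0n (leq_trans _ k1) ?expn_gt0//=.
  by rewrite (@trunc_log_eq 2 n)// k1.
rewrite sumr_const_nat expnS mul2n -addnn addnK.
by rewrite -[LHS]mulr_natl natrX.
Qed.

(** Block i has 2^i = rho^(ir) equal weights rho^-i, with rho = 2^(1/r). For u = |z| / rho^i it
    contributes |z|^r u^-r min(u^2, u^s), that is |z|^r times a [bump] with exponents 2 - r and r -
    s, both positive. *)
Lemma sum_wt_trunc_le r s : 0 < s -> s < r -> r < 2 -> exists2 D : R, 0 < D &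
  forall z n, \sum_(0 <= k < 2 ^ n) trunc_pow s (wt r k * z) <= D * `|z| `^ r.
Proof.
move=> s0 sr r2; have r0 : 0 < r by exact: lt_trans sr.
have rs : 0 < r - s by lra.
have r2' : 0 < 2 - r by lra.
pose rho : R := 2 `^ r^-1.
have rho0 : 0 < rho by exact: powR_gt0.
have rho1 : 1 < rho.
  by rewrite -[ltLHS](powRr0 2) /rho /powR pnatr_eq0/= ltr_expR ltr_pM2r ?invr_gt0// ln_gt0// ltr1n.
have rhor : rho `^ r = 2 by rewrite -powRrM mulVf ?gt_eqF// powRr1.
have [D D0 DP] := sum_bump_le r2' rs rho1.
exists D => // z n.
have [->|z0] := eqVneq z 0.
  rewrite normr0 powR0 ?gt_eqF// mulr0 big1// => k _.
  by rewrite mulr0 /trunc_pow normr0 expr0n/= powR0 ?gt_eqF// minxx.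
have nz : 0 < `|z| by rewrite normr_gt0.
rewrite (eq_bigr (fun k => if k == 0%N then 0 else trunc_pow s ((rho ^+ trunc_log 2 k)^-1 * z))); last first.
  move=> k _; rewrite /wt; case: ifP => _.
    by rewrite mul0r /trunc_pow normr0 expr0n/= powR0 ?gt_eqF// minxx.
  congr (trunc_pow _ (_ * _)); rewrite /rho -powR_exprn//.
  by rewrite -powR_inv1 ?exprn_ge0// -powRrM mulN1r powRN.
rewrite (sum_trunc_log (fun i => trunc_pow s ((rho ^+ i)^-1 * z))).
rewrite (eq_bigr (fun i => `|z| `^ r * bump (2 - r) (r - s) (`|z| / rho ^+ i))); last first.
  move=> i _; pose u := `|z| / rho ^+ i.
  have u0 : 0 < u by rewrite divr_gt0// exprn_gt0.
  have -> : trunc_pow s ((rho ^+ i)^-1 * z) = u `^ r * bump (2 - r) (r - s) u.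
    rewrite /trunc_pow normrM normfV (ger0_norm (exprn_ge0 _ (ltW rho0))) mulrC -/u.
    rewrite /bump minr_pMr ?powR_ge0// -!powRD; [|by rewrite (gt_eqF u0) implybT..].
    by rewrite [r + (2 - r)]addrC subrK opprB [r + (s - r)]addrC subrK powR_mulrn// ltW.
  rewrite mulrA; congr (_ * _).
  rewrite /u powRM ?invr_ge0 ?exprn_ge0 ?(ltW rho0)//.
  rewrite -powR_inv1 ?exprn_ge0 ?(ltW rho0)// -powRrM mulN1r powRN powR_exprn ?(ltW rho0)// rhor.
  by rewrite mulrCA mulfV ?mulr1// gt_eqF// exprn_gt0.
rewrite -mulr_sumr mulrC ler_wpM2r ?powR_ge0//.
exact: DP.
Qed.

(** The powers counted are 1, 2, ..., 2^(j-1), where 2^j is the first power not below y, or j = n;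
    they add up to 2^j - 1. *)
Lemma sum_pow2_ge (y : R) n : 0 <= y ->
  Num.min y (2 ^+ n) - 1 <= \sum_(0 <= i < n) 2 ^+ i * (2 ^+ i < y)%R%:R.
Proof.
move=> y0; elim: n => [|n IH].
  by rewrite big_geq// expr0 subr_le0 ge_min lexx orbT.
rewrite big_nat_recr//=.
have e0 : 0 < 2 ^+ n :> R by rewrite exprn_gt0.
have [yn|yn] := ltP (2 ^+ n) y.
  rewrite mulr1; have -> : \sum_(0 <= i < n) 2 ^+ i * (2 ^+ i < y)%R%:R = 2 ^+ n - 1 :> R.
    rewrite (eq_big_nat _ _ (F2 := fun i => 2 ^+ i)); last first.
      move=> i /andP[_ iln]; rewrite (le_lt_trans _ yn) ?mulr1// ler_eXn2l ?ltr1n//.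
      exact: ltnW.
    elim: n {IH e0 yn} => [|n IH]; first by rewrite big_geq// expr0 subrr.
    by rewrite big_nat_recr//= IH exprS; lra.
  rewrite exprS; have : Num.min y (2 * 2 ^+ n) <= 2 * 2 ^+ n by rewrite ge_min lexx orbT.
  lra.
rewrite mulr0 addr0; apply: le_trans IH; rewrite lerD2r (min_l yn).
by rewrite ge_min lexx.
Qed.

End truncated_moments.

Section random_sums.
Context {R : realType}.
Local Notation TR := (measurableTypeR R).
Local Notation unif := (@unif R).
Implicit Types (v : R^nat) (f : R -> R) (n k : nat).

(** The sample points are read on [psi1 t] and the signs on [psi2 t], so that the two families are
    independent. *)
Definition ransum v n f (t : R) : R :=
  rsum n (fun k => v k * f (coord k (psi1 t))) (psi2 t).

Let joint v n f (z : TR * TR) : R := rsum n (fun k => v k * f (coord k z.1)) z.2.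

Let mjoint v n f : measurable_fun setT (f : TR -> TR) ->
  measurable_fun setT (joint v n f : TR * TR -> TR).
Proof.
move=> mf; apply: measurable_sum => k; apply: measurable_funM.
  apply: measurable_funM => //; apply: measurableT_comp => //.
  by apply: (measurableT_comp (measurable_coord k)); exact: measurable_fst.
by apply: (measurableT_comp (measurable_rad k)); exact: measurable_snd.
Qed.

Lemma measurable_ransum v n f : measurable_fun setT (f : TR -> TR) ->
  measurable_fun setT (ransum v n f : TR -> TR).
Proof.
move=> mf.
have mp : measurable_fun setT (fun t : TR => (psi1 t : TR, psi2 t : TR)).
  exact: measurable_fun_pair measurable_psi1 measurable_psi2.
have H : measurable_fun setT (joint v n f \o (fun t : TR => (psi1 t : TR, psi2 t : TR))).
  by apply: measurableT_comp => //; exact: mjoint.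
exact: H.
Qed.

Lemma integral_ransum (s : R) v n f : measurable_fun setT (f : TR -> TR) ->
  (\int[unif]_t (`|ransum v n f t| `^ s)%:E =
   \int[unif]_x \int[unif]_y (`|rsum n (fun k => v k * f (coord k x)) y| `^ s)%:E)%E.
Proof.
move=> mf; apply: (integral_psi (H := fun z => (`|joint v n f z| `^ s)%:E)).
  by apply: measurable_powR_norm; exact: mjoint.
by move=> z; rewrite lee_fin powR_ge0.
Qed.

Lemma measurable_inner (s : R) v n f : measurable_fun setT (f : TR -> TR) ->
  measurable_fun setT (fun x : TR =>
    \int[unif]_y (`|rsum n (fun k => v k * f (coord k x)) y| `^ s)%:E)%E.
Proof.
move=> mf; apply: (@measurable_fun_fubini_tonelli_F _ _ TR TR R unif
  (fun z => (`|joint v n f z| `^ s)%:E)) => //.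
  by apply: measurable_powR_norm; exact: mjoint.
Qed.

Lemma ransumZ v n f (l : R) t : ransum v n (fun u => l * f u) t = l * ransum v n f t.
Proof. by rewrite /ransum -rsumZ; apply: eq_bigr => k _; rewrite mulrCA. Qed.

Lemma integral_ransumZ (s l : R) v n f : 0 < l -> measurable_fun setT (f : TR -> TR) ->
  (\int[unif]_t (`|ransum v n (fun u => l * f u) t| `^ s)%:E =
   (l `^ s)%:E * \int[unif]_t (`|ransum v n f t| `^ s)%:E)%E.
Proof.
move=> l0 mf; rewrite -ge0_integralZl_EFin ?powR_ge0//; last first.
  by apply: measurable_powR_norm; exact: measurable_ransum.
apply: eq_integral => t _.
by rewrite ransumZ normrM powRM// gtr0_norm// EFinM.
Qed.

Let measurable_trunc s v f k : measurable_fun setT (f : TR -> TR) ->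
  measurable_fun setT (fun u : TR => (trunc_pow s (v k * f u))%:E).
Proof.
move=> mf; apply/measurable_EFinP; apply: (measurableT_comp (measurable_trunc_pow s)).
exact: measurable_funM.
Qed.

(** The signs are integrated first, with the sample points fixed, by [integral_rsum_trunc]. The term
    1 breaks homogeneity, so the bound is useful only after rescaling f. *)
Lemma integral_ransum_le (s : R) v n f : 1 <= s -> s <= 2 -> measurable_fun setT (f : TR -> TR) ->
  (\int[unif]_t (`|ransum v n f t| `^ s)%:E <=
   2%:E * (1 + \sum_(k < n) \int[unif]_u (trunc_pow s (v k * f u))%:E))%E.
Proof.
move=> s1 s2 mf; rewrite integral_ransum//.
have mc k : measurable_fun setT (fun x : TR => (trunc_pow s (v k * f (coord k x)))%:E).
  apply: (measurableT_comp (f := fun u : TR => (trunc_pow s (v k * f u))%:E)).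
    exact: measurable_trunc.
  exact: measurable_coord.
have p0 x : (0 <= (trunc_pow s x)%:E)%E by rewrite lee_fin trunc_pow_ge0.
apply: (@le_trans _ _ (\int[unif]_x (2%:E * (1 + \sum_(k < n) (trunc_pow s (v k * f (coord k x)))%:E)))%E).
  apply: ge0_le_integral => //.
  - by move=> x _; apply: integral_ge0 => y _; rewrite lee_fin powR_ge0.
  - exact: measurable_inner.
  - by apply: measurable_funeM; apply: emeasurable_funD => //; exact: emeasurable_sum.
  - move=> x _; apply: (le_trans (integral_rsum_trunc _ _ s1 s2)).
    by rewrite sumEFin -EFinD -EFinM.
rewrite ge0_integralZl_EFin//; last 2 first.
- by move=> x _; rewrite adde_ge0// sume_ge0.
- by apply: emeasurable_funD => //; exact: emeasurable_sum.
rewrite lee_wpmul2l// ge0_integralD//; last 2 first.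
- by move=> x _; rewrite sume_ge0.
- exact: emeasurable_sum.
rewrite integral_unif_cst leeD2l// ge0_integral_sum//.
apply: lee_sum => k _.
by rewrite (integral_coord k (F := fun u => (trunc_pow s (v k * f u))%:E))//; exact: measurable_trunc.
Qed.

Lemma sum_integral_trunc_le (r s : R) : 0 < s -> s < r -> r < 2 -> exists2 D : R, 0 < D &
  forall f n, measurable_fun setT (f : TR -> TR) ->
  (\sum_(k < 2 ^ n) \int[unif]_u (trunc_pow s (wt r k * f u))%:E <=
   D%:E * \int[unif]_u (`|f u| `^ r)%:E)%E.
Proof.
move=> s0 sr r2; have [D D0 DP] := sum_wt_trunc_le s0 sr r2.
exists D => // f n mf.
have mfr : measurable_fun setT (fun u : TR => (`|f u| `^ r)%:E) by exact: measurable_powR_norm.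
rewrite -ge0_integral_sum//; last by move=> k u _; rewrite lee_fin trunc_pow_ge0.
rewrite -ge0_integralZl_EFin ?(ltW D0)//.
apply: ge0_le_integral => //.
- by move=> u _; rewrite sume_ge0// => k _; rewrite lee_fin trunc_pow_ge0.
- by apply: emeasurable_sum => k; exact: measurable_trunc.
- exact: measurable_funeM.
- move=> u _; rewrite sumEFin -EFinM lee_fin; apply: le_trans (DP (f u) n).
  by rewrite big_mkord.
- by move=> k; exact: measurable_trunc.
Qed.

Lemma ransum_diff v (m n : nat) f t : (m <= n)%N ->
  ransum v n f t - ransum v m f t = ransum (fun k => if (m <= k)%N then v k else 0) n f t.
Proof.
move=> mn; rewrite /ransum (rsum_nat_diff _ _ mn).
by apply: eq_bigr => k _; case: ifP => _; rewrite ?mul0r.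
Qed.

End random_sums.

(** * Lower bound for the random sums *)

Section random_sums_lower.
Context {R : realType}.
Local Notation TR := (measurableTypeR R).
Local Notation unif := (@unif R).
Variables (r s : R) (f : R -> R).
Hypotheses (r1 : 1 <= r) (s1 : 1 <= s) (mf : measurable_fun setT (f : TR -> TR)).
Hypothesis If : (\int[unif]_t (`|f t| `^ r)%:E = 1)%E.

Let r0 : 0 < r. Proof. exact: lt_le_trans r1. Qed.

(** The factor 2 gives [y] the integral 2, more than the 1 lost in [sum_pow2_ge]; so the expected
    number [mass] of large terms stays away from 0. *)
Let y (u : R) : R := 2 * `|f u| `^ r.

Let y0 u : 0 <= y u. Proof. by rewrite mulr_ge0// powR_ge0. Qed.

Let my : measurable_fun setT (y : TR -> TR).
Proof.
apply: measurable_funM => //; apply/measurable_EFinP; exact: measurable_powR_norm.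
Qed.

Let level i : set TR := [set u | 2 ^+ i < y u].

Let mlevel i : measurable (level i).
Proof.
rewrite (_ : level i = setT `&` y @^-1` `]2 ^+ i, +oo[%classic); first exact: my.
by rewrite setTI; apply/seteqP; split => u; rewrite /= in_itv/= andbT.
Qed.

Let event k : set TR := if k == 0%N then set0 else coord k @^-1` level (trunc_log 2 k).

Let mevent k : measurable (event k).
Proof.
rewrite /event; case: ifP => // _; rewrite -[X in measurable X]setTI.
exact: measurable_coord.
Qed.

Let mass n : R := \sum_(0 <= i < n) 2 ^+ i * fine (unif (level i)).

Let mass_event n : (\sum_(k < 2 ^ n) unif (event k) = (mass n)%:E)%E.
Proof.
rewrite /mass -(sum_trunc_log (fun i => fine (unif (level i)))) big_mkord -sumEFin.
apply: eq_bigr => k _; rewrite /event; case: ifP => _; first by rewrite measure0.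
by rewrite unif_coord// fineK// fin_num_measure.
Qed.

Let my_min n : measurable_fun setT (fun u : TR => (Num.min (y u) (2 ^+ n))%:E).
Proof. by apply/measurable_EFinP; exact: measurable_minr. Qed.

Let mass_ge n : (\int[unif]_u (Num.min (y u) (2 ^+ n))%:E <= (mass n + 1)%:E)%E.
Proof.
have ml i : measurable_fun setT (fun u : TR => (2 ^+ i)%:E * (\1_(level i) u)%:E : \bar R)%E.
  by apply: measurable_funeM; apply/measurable_EFinP; exact: measurable_indic.
have l0 i u : (0 <= (2 ^+ i)%:E * (\1_(level i) u)%:E :> \bar R)%E.
  by rewrite -EFinM lee_fin mulr_ge0// exprn_ge0.
apply: (@le_trans _ _ (\int[unif]_u (\sum_(0 <= i < n) (2 ^+ i)%:E * (\1_(level i) u)%:E + 1))%E).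
  apply: ge0_le_integral => //.
  - by move=> u _; rewrite lee_fin le_min y0 exprn_ge0.
  - by apply: emeasurable_funD => //; exact: emeasurable_sum.
  - move=> u _; under eq_bigr do rewrite -EFinM.
    rewrite sumEFin -EFinD lee_fin -lerBlDr; apply: le_trans (sum_pow2_ge n (y0 u)) _.
    apply: ler_sum => i _; rewrite indicE ler_wpM2l ?exprn_ge0//.
    by case: (ltP (2 ^+ i) (y u)) => h //; rewrite mem_set.
rewrite ge0_integralD//; last 2 first.
- by move=> u _; exact: sume_ge0.
- exact: emeasurable_sum.
rewrite integral_unif_cst EFinD leeD2r// ge0_integral_sum//.
rewrite /mass -sumEFin; apply: lee_sum => i _.
rewrite ge0_integralZl_EFin ?exprn_ge0//; last first.
  by apply/measurable_EFinP; exact: measurable_indic.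
by rewrite integral_indic// setIT EFinM fineK// fin_num_measure.
Qed.

Let mass_large : exists N, forall n, (N <= n)%N -> 2^-1 <= mass n.
Proof.
(* By Fatou the truncations recover the whole integral 2 of [y]; reaching 3/2 leaves a mass of
   1/2. *)
have [N hN] : exists N, ((3 / 2)%:E <= \int[unif]_u (Num.min (y u) (2 ^+ N))%:E)%E.
  apply: contrapT => /forallNP H.
  have : (\int[unif]_u (y u)%:E <= (3 / 2)%:E)%E.
    apply: (@fatou_le _ TR R unif (fun n u => (Num.min (y u) (2 ^+ n))%:E) (fun u => (y u)%:E)) => //.
    - exact/measurable_EFinP.
    - by move=> n u; rewrite lee_fin le_min y0 exprn_ge0.
    - apply: aeW => u; apply: cvg_near_cst.
      have [M hM] : exists M : nat, y u <= 2 ^+ M.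
        exists (Num.bound (y u)); rewrite ltW//.
        apply: (lt_trans (archi_boundP (y0 u))).
        by rewrite -natrX ltr_nat ltn_expl.
      exists M => // n /= Mn; rewrite min_l//; apply: (le_trans hM).
      by rewrite ler_weXn2l// ler1n.
    - by move=> n; rewrite leNgt; apply/negP => h; apply: (H n); exact: ltW.
  have -> : (\int[unif]_u (y u)%:E = 2%:E)%E.
    transitivity (\int[unif]_u (2%:E * (`|f u| `^ r)%:E))%E; first by apply: eq_integral.
    rewrite ge0_integralZl_EFin//; last exact: measurable_powR_norm.
    by rewrite If mule1.
  by rewrite lee_fin; lra.
exists N => n Nn.
have : ((3 / 2)%:E <= (mass n + 1)%:E)%E.
  apply: (le_trans hN); apply: le_trans (mass_ge n).
  apply: ge0_le_integral => //.
  - by move=> u _; rewrite lee_fin le_min y0 exprn_ge0.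
  - by move=> u _; rewrite lee_fin le_min2// ler_weXn2l// ler1n.
by rewrite lee_fin; lra.
Qed.

Let event_indep k l : k != l -> (unif (event k `&` event l) = unif (event k) * unif (event l))%E.
Proof.
move=> kl; have [->|k0] := eqVneq k 0%N.
  by rewrite {1 2}/event/= set0I measure0 mul0e.
have [->|l0] := eqVneq l 0%N.
  by rewrite {2 4}/event/= setI0 measure0 mule0.
rewrite /event (negbTE k0) (negbTE l0).
rewrite (unif_coord_indep (mlevel (trunc_log 2 k)) (mlevel (trunc_log 2 l)) kl).
exact: esym (congr2 mule (unif_coord k (mlevel _)) (unif_coord l (mlevel _))).
Qed.

Let event_large k x : event k x -> 2^-1 `^ r^-1 <= wt r k * `|f (coord k x)|.
Proof.
rewrite /event /wt; case: ifP => // _; set z := f (coord k x) => h.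
have hz : `|z| = (`|z| `^ r) `^ r^-1 by rewrite -powRrM mulfV ?gt_eqF// powRr1.
have e0 : 0 < 2 ^+ trunc_log 2 k :> R by rewrite exprn_gt0.
rewrite hz -powRM ?powR_ge0 ?invr_ge0 ?(ltW e0)//.
rewrite ge0_ler_powR ?nnegrE ?invr_ge0 ?(ltW r0) ?mulr_ge0 ?powR_ge0 ?(ltW e0)//.
rewrite mulrC ler_pdivlMr// mulrC.
by have : 2 ^+ trunc_log 2 k < 2 * `|z| `^ r by []; lra.
Qed.

(** On the union of the events some weighted value is at least (1/2)^(1/r). Averaging over the signs
    with the sample points fixed bounds the first moment by it, [Lp_ge_L1] takes half of it, and the
    union has probability at least 1/3. *)
Lemma integral_ransum_ge : exists N, forall n, (N <= n)%N ->
  (((2^-1 `^ r^-1 / 2 * 3^-1 `^ s^-1) `^ s)%:E <=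
   \int[unif]_t (`|ransum (wt r) (2 ^ n) f t| `^ s)%:E)%E.
Proof.
have s0 : 0 < s by exact: lt_le_trans s1.
have [N NP] := mass_large; exists N => n Nn.
have mass1 := NP n Nn.
pose t : R := 2^-1 `^ r^-1 / 2; have t0 : 0 < t by rewrite divr_gt0// powR_gt0// invr_gt0.
pose U := \bigcup_(k in `I_(2 ^ n)) event k.
have mU : measurable U by exact: bigcup_measurable.
(* m / (1 + m) increases with m, and it is 1/3 at m = 1/2. *)
have PU : ((3^-1)%:E <= unif U)%E.
  apply: le_trans (probability_bigcup_ge mevent (mass_event n) event_indep).
  by rewrite lee_fin ler_pdivlMr; lra.
rewrite integral_ransum// -/t powRM ?powR_ge0 ?(ltW t0)//.
rewrite -[_ `^ s^-1 `^ s]powRrM mulVf ?gt_eqF// powRr1 ?invr_ge0//.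
apply: (@le_trans _ _ (\int[unif]_x ((t `^ s)%:E * (\1_U x)%:E))%E).
  rewrite ge0_integralZl_EFin ?powR_ge0//; last first.
    by apply/measurable_EFinP; exact: measurable_indic.
  by rewrite integral_indic// setIT EFinM lee_wpmul2l ?lee_fin ?powR_ge0.
apply: ge0_le_integral => //.
- by move=> x _; rewrite -EFinM lee_fin mulr_ge0 ?powR_ge0.
- by apply: measurable_funeM; apply/measurable_EFinP; exact: measurable_indic.
- exact: measurable_inner.
- move=> x _; rewrite indicE; case: (boolP (x \in U)) => [|_]; last first.
    by rewrite mule0 integral_ge0// => z _; rewrite lee_fin powR_ge0.
  rewrite inE mule1 => -[k /= kn ekx].
  apply: Lp_ge_L1 => //; first exact: measurable_rsum.
  apply: le_trans (integral_rsum_abs_ge (fun k => wt r k * f (coord k x)) kn).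
  rewrite lee_fin normrM (ger0_norm (wt_ge0 _ _)) /t mulrC divfK//.
  exact: event_large.
Qed.

End random_sums_lower.

(** * The embedding of L_r in L_s for s < r < 2 *)

Section stable.
Context {R : realType}.
Local Notation TR := (measurableTypeR R).
Local Notation unif := (@unif R).

Lemma stable_embeds (r s : R) (r1 : 1 <= r) (s1 : 1 <= s) : s < r -> r < 2 ->
  power_embeds (Lunit r1) (Lunit s1) 1 1.
Proof.
move=> sr r2; have r0 : 0 < r by exact: lt_le_trans r1.
have s0 : 0 < s by exact: lt_le_trans s1.
have s2 : s <= 2 by lra.
have [D D0 DP] := sum_integral_trunc_le (R := R) s0 sr r2.
pose c : R := 2^-1 `^ r^-1 / 2 * 3^-1 `^ s^-1.
have c0 : 0 < c by rewrite mulr_gt0// ?divr_gt0// powR_gt0// invr_gt0.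
pose C : R := (2 * (1 + D)) `^ s^-1.
have C0 : 0 <= C by exact: powR_ge0.
have Cs : C `^ s = 2 * (1 + D) by rewrite -powRrM mulVf ?gt_eqF// powRr1//; lra.
have Phiae n (f g : TR -> TR) : measurable_fun setT f -> measurable_fun setT g ->
    {ae (unif : {measure set TR -> \bar R}), forall t, f t = g t} ->
    (\int[unif]_t (`|ransum (wt r) n f t| `^ s)%:E =
     \int[unif]_t (`|ransum (wt r) n g t| `^ s)%:E)%E.
  move=> mf mg fg; apply: ae_eq_integral => //.
  - by apply: measurable_powR_norm; exact: measurable_ransum.
  - by apply: measurable_powR_norm; exact: measurable_ransum.
  - apply: filterS (ae_coord_psi1 fg) => t h _.
    by congr (`|_| `^ _)%:E; apply: eq_bigr => k _; rewrite h.
have normalize (f : TR -> TR) (A : R) : measurable_fun setT f -> 0 < A ->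
    (\int[unif]_t (`|f t| `^ r)%:E = (A `^ r)%:E)%E ->
    exists g : TR -> TR, [/\ measurable_fun setT g, (\int[unif]_t (`|g t| `^ r)%:E = 1)%E &
      forall n, (\int[unif]_t (`|ransum (wt r) n f t| `^ s)%:E =
        (A `^ s)%:E * \int[unif]_t (`|ransum (wt r) n g t| `^ s)%:E)%E].
  move=> mf A0 fA; exists (fun u => A^-1 * f u).
  have mg : measurable_fun setT (fun u : TR => A^-1 * f u : TR) by exact: measurable_funM.
  split=> //.
    transitivity (\int[unif]_t ((A^-1 `^ r)%:E * (`|f t| `^ r)%:E))%E.
      apply: eq_integral => t _; rewrite normrM powRM// gtr0_norm ?invr_gt0//.
    rewrite ge0_integralZl_EFin ?powR_ge0//; last exact: measurable_powR_norm.
    by rewrite fA -EFinM -powRM ?invr_ge0 ?(ltW A0)// mulVf ?gt_eqF// powR1.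
  move=> n; apply: etrans (integral_ransumZ s (wt r) n A0 mg); apply: eq_integral => t _.
  congr (`|_| `^ _)%:E; apply: eq_bigr => k _.
  by congr (_ * _ * _); rewrite mulVKf ?gt_eqF.
apply: (@Lspace_limit_embeds _ TR _ TR R unif unif r s r1 s1
   (fun n f => ransum (wt r) (2 ^ n) f) c C c0 C0).
- by move=> n f mf; exact: measurable_ransum.
- move=> n f g t; rewrite /ransum rsumB.
  by apply: eq_bigr => k _; rewrite mulrBr.
- by move=> n; exact: Phiae.
(* At A = 0 there is no normalization; f vanishes almost everywhere and is replaced by the zero
   function. *)
- move=> f A n mf; rewrite le_eqVlt => /predU1P[<-|A0].
    rewrite mulr0 !powR0 ?gt_eqF// => f0.
    rewrite (Phiae _ f (fun=> 0))//.
      rewrite integral0_eq// => t _.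
      by rewrite /ransum /rsum big1 ?normr0 ?powR0 ?gt_eqF// => k _; rewrite mulr0 mul0r.
    have mfr : measurable_fun setT (fun t : TR => (`|f t| `^ r)%:E) by exact: measurable_powR_norm.
    have : (\int[unif]_t `|(`|f t| `^ r)%:E| = 0)%E.
      by apply: etrans f0; apply: eq_integral => t _; rewrite gee0_abs// lee_fin powR_ge0.
    move/(ae_eq_integral_abs unif measurableT mfr); apply: filterS => t /(_ I)/= [].
    by move/powR_eq0_eq0/normr0_eq0.
  move=> fA; have [g [mg gI ->]] := normalize f A mf A0 fA.
  rewrite powRM ?(ltW A0)// mulrC EFinM lee_wpmul2l ?lee_fin ?powR_ge0// Cs.
  apply: (le_trans (integral_ransum_le _ _ s1 s2 mg)).
  rewrite EFinM lee_wpmul2l// EFinD leeD2l//.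
  by apply: (le_trans (DP g n mg)); rewrite gI mule1.
- move=> f A mf A0 fA; have [g [mg gI gE]] := normalize f A mf A0 fA.
  have [N NP] := integral_ransum_ge r1 s1 mg gI.
  exists N => n Nn; rewrite gE powRM ?(ltW A0) ?(ltW c0)// mulrC EFinM.
  by rewrite lee_wpmul2l ?lee_fin ?powR_ge0//; exact: NP.
move=> f mf fin e e0.
(* The bound 2 (1 + tail) never falls below 2, so it cannot show smallness directly. It is applied
   to l f with l^s = 4 / e: once the tail of l f is at most 1 the bound is 4, and dividing by l^s
   leaves [e]. *)
pose l : R := (4 / e) `^ s^-1.
have l0 : 0 < l by rewrite powR_gt0// divr_gt0.
have ls : l `^ s = 4 / e by rewrite -powRrM mulVf ?gt_eqF// powRr1// divr_ge0// ltW.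
pose g (u : TR) : TR := l * f u.
have mg : measurable_fun setT g by exact: measurable_funM.
have gfin : (\int[unif]_t (`|g t| `^ r)%:E < +oo)%E.
  rewrite (_ : \int[unif]_t _ = (l `^ r)%:E * \int[unif]_t (`|f t| `^ r)%:E)%E.
    by rewrite lte_mul_pinfty ?lee_fin ?powR_ge0.
  rewrite -ge0_integralZl_EFin ?powR_ge0//; last exact: measurable_powR_norm.
  by apply: eq_integral => t _; rewrite normrM powRM// gtr0_norm.
pose b k : R := fine (\int[unif]_u (trunc_pow s (wt r k * g u))%:E)%E.
have I0 k : (0 <= \int[unif]_u (trunc_pow s (wt r k * g u))%:E)%E.
  by apply: integral_ge0 => u _; rewrite lee_fin trunc_pow_ge0.
have Ile n : (\sum_(k < 2 ^ n) \int[unif]_u (trunc_pow s (wt r k * g u))%:E < +oo)%E.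
  by apply: (le_lt_trans (DP g n mg)); rewrite lte_mul_pinfty// lee_fin ltW.
have bE k : ((b k)%:E = \int[unif]_u (trunc_pow s (wt r k * g u))%:E)%E.
  rewrite /b fineK// ge0_fin_numE//; apply: le_lt_trans (Ile k).
  by rewrite (bigD1 (Ordinal (ltn_expl k (ltnSn 1))))//= leeDl// sume_ge0.
have b0 k : 0 <= b k by rewrite fine_ge0.
have [B BE] : exists B : R, (\sum_(k <oo) (b k)%:E = B%:E)%E.
  exists (fine (\sum_(k <oo) (b k)%:E)%E); rewrite fineK// ge0_fin_numE//; last first.
    by apply: nneseries_ge0 => *; rewrite lee_fin.
  apply: (@le_lt_trans _ _ (D%:E * \int[unif]_u (`|g u| `^ r)%:E)%E); last first.
    by rewrite lte_mul_pinfty// lee_fin ltW.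
  apply: nneseries_le => [k|n]; first by rewrite lee_fin.
  apply: le_trans (DP g n mg); rewrite big_mkord.
  under [leRHS]eq_bigr do rewrite -bE.
  rewrite -(big_mkord xpredT (fun k => (b k)%:E)) -(big_mkord xpredT (fun k => (b k)%:E)).
  have nn : (n <= 2 ^ n)%N by rewrite ltnW// ltn_expl.
  rewrite [leRHS](big_cat_nat _ nn)//= leeDl// sume_ge0// => k _.
  by rewrite lee_fin.
have [fB BN] := nneseries_partial b0 BE.
have [N NP] := BN 1 ltr01.
exists N => m n Nm Nn.
wlog mn : m n Nm Nn / (m <= n)%N.
  move=> H; have [/H|/ltnW nm] := leqP m n; first exact.
  by under eq_integral do rewrite distrC; exact: H.
pose v k : R := if (2 ^ m <= k)%N then wt r k else 0.
have mn2 : (2 ^ m <= 2 ^ n)%N by rewrite leq_exp2l.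
have -> : (\int[unif]_t (`|ransum (wt r) (2 ^ m) f t - ransum (wt r) (2 ^ n) f t| `^ s)%:E =
   \int[unif]_t (`|ransum v (2 ^ n) f t| `^ s)%:E)%E.
  by apply: eq_integral => t _; rewrite distrC ransum_diff.
have key : (\int[unif]_t (`|ransum v (2 ^ n) g t| `^ s)%:E <= 4%:E)%E.
  apply: (le_trans (integral_ransum_le _ _ s1 s2 mg)).
  rewrite (_ : 4%:E = 2%:E * (1 + 1))%E; last by rewrite -EFinD -EFinM; congr EFin; clear; lra.
  rewrite lee_wpmul2l// leeD2l//.
  have vE k : (\int[unif]_u (trunc_pow s (v k * g u))%:E = (if (2 ^ m <= k)%N then b k else 0)%:E)%E.
    rewrite /v; case: ifP => _; first by rewrite bE.
    rewrite integral0_eq// => u _.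
    by rewrite mul0r /trunc_pow normr0 expr0n/= powR0 ?gt_eqF// minxx.
  under eq_bigr do rewrite vE.
  rewrite sumEFin lee_fin.
  have e1 : \sum_(k < 2 ^ n) (if (2 ^ m <= k)%N then b k else 0) + \sum_(k < 2 ^ m) b k
      = \sum_(k < 2 ^ n) b k.
    rewrite -!(big_mkord xpredT b).
    rewrite -(big_mkord xpredT (fun k => if (2 ^ m <= k)%N then b k else 0)).
    rewrite (big_cat_nat _ mn2)//= [RHS](big_cat_nat _ mn2)//=.
    rewrite (@big1_seq _ _ _ _ (index_iota 0 (2 ^ m))) ?add0r; last first.
      by move=> k; rewrite mem_index_iota /= => km; rewrite leqNgt km.
    rewrite addrC.
    by congr (_ + _); rewrite !big_nat; apply: eq_bigr => k /andP[-> _].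
  have N2m : (N <= 2 ^ m)%N by rewrite (leq_trans Nm)// ltnW// ltn_expl.
  by move: (NP _ N2m) (fB (2 ^ n)%N) e1; clear; lra.
move: key; rewrite integral_ransumZ// ls.
rewrite (_ : 4%:E = (4 / e)%:E * e%:E)%E; last by rewrite -EFinM divfK// gt_eqF.
by rewrite lee_pmul2l// lte_fin divr_gt0.
Qed.

End stable.

(** * Sequences of real numbers *)

Section ell_real.
Context {R : realType}.

Lemma ell_distE (r : R) (r1 : 1 <= r) (x y : ell r1) :
  ((`|x - y| `^ r)%:E = \sum_(k <oo) (`|Lspace_repr x k - Lspace_repr y k| `^ r)%:E)%E.
Proof.
rewrite (@Lspace_distE _ nat R counting r r1 x y _ _ (measurable_Lspace_repr x)
  (measurable_Lspace_repr y) (aeW _ (fun=> erefl)) (aeW _ (fun=> erefl))).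
by rewrite ge0_integral_count.
Qed.

Lemma real_embeds_ell (r : R) (r1 : 1 <= r) : power_embeds R (ell r1) r r.
Proof.
have r0 : 0 < r by exact: lt_le_trans r1.
pose u (a : R) k : R := if k == 0%N then a else 0.
have uE (a : R) : (\sum_(k <oo) (`|u a k| `^ r)%:E = (`|a| `^ r)%:E)%E.
  rewrite (nneseries_split 0 1)//= big_nat1.
  by rewrite eseries0 ?adde0// => -[|k]//= _ _; rewrite /u/= normr0 powR0 ?gt_eqF.
have /choice[T TP] a : exists x : ell r1, forall k, Lspace_repr x k = u a k.
  by apply: ell_mem; rewrite uE ltry.
exists T, 1, 1; split=> // a b; rewrite mul1r; apply/andP.
have -> : `|T a - T b| `^ r = `|a - b| `^ r; last by [].
apply: EFin_inj; rewrite ell_distE -uE; apply: eq_eseriesr => k _.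
by rewrite !TP /u; case: ifP => // _; rewrite subrr.
Qed.

(** The exponent of the norm is that of the sum, so E(l_p, p) is about a double series of
    nonnegative terms, equal to its enumeration. Each coordinate map is 1-Lipschitz, hence the
    reduction is continuous. *)
Lemma Esum_ell_reducible_real (p : R) (p1 : 1 <= p) :
  borel_reducible (Esum (ell p1) p) (Esum R p).
Proof.
have p0 : 0 < p by exact: lt_le_trans p1.
have [b bE] := nneseries_pair.
exists (fun (x : {ptws nat -> ell p1}) n => Lspace_repr (x (b n).1) (b n).2); split.
  apply: borel_map_continuous; apply: (@continuous_ptws R _ R) => n x.
  apply: (@continuous_comp _ _ _ (fun x : {ptws nat -> ell p1} => x (b n).1)
    (fun z : ell p1 => Lspace_repr z (b n).2 : R)).
    exact: continuous_ptws_eval.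
  apply: (@holder_continuous R (ell p1) R p p 1) => // u v.
  rewrite mul1r -lee_fin ell_distE.
  by apply: (@nneseries_term_le R (fun k => (`|Lspace_repr u k - Lspace_repr v k| `^ p)%:E)).
move=> x y; rewrite /Esum/=.
rewrite (bE R (fun i j => (`|Lspace_repr (x i) j - Lspace_repr (y i) j| `^ p)%:E)%E)//.
by under [X in (X < _)%E <-> _]eq_eseriesr do rewrite ell_distE.
Qed.

End ell_real.

Unset Implicit Arguments.

Theorem theorem6p3 (R : realType) (r s p q : R)
    (r1 : 1 <= r) (s1 : 1 <= s) (p1 : 1 <= p) (q1 : 1 <= q) :
  [/\ borel_reducible (Esum (ell r1) p) (Esum (Lunit r1) p),
      borel_bireducible (Esum (ell p1) p) (Esum R p) /\
      borel_reducible (Esum R p) (Esum (ell r1) p),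
      borel_bireducible (Esum (ell (ler1n R 2)) p) (Esum (Lunit (ler1n R 2)) p) /\
      borel_reducible (Esum (Lunit (ler1n R 2)) p) (Esum (Lunit r1) p),
      (s <= r -> r <= 2 ->
        borel_reducible (Esum (Lunit r1) p) (Esum (Lunit s1) p)) &
      (r / p = s / q -> p <= q ->
        borel_reducible (Esum (ell r1) p) (Esum (ell s1) q) /\
        borel_reducible (Esum (Lunit r1) p) (Esum (Lunit s1) q))].
Proof.
have r0 : 0 < r by exact: lt_le_trans r1.
have s0 : 0 < s by exact: lt_le_trans s1.
have p0 : 0 < p by exact: lt_le_trans p1.
have q0 : 0 < q by exact: lt_le_trans q1.
have same (X Y : normedModType R) (a : R) : 0 < a -> power_embeds X Y a a ->
    borel_reducible (Esum X p) (Esum Y p).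
  by move=> a0; exact: Esum_reducible_power.
have refl (X : normedModType R) : borel_reducible (Esum X p) (Esum X p).
  by exists id; split.
have hilbert t (t1 : 1 <= t) :
    borel_reducible (Esum (Lunit (ler1n R 2)) p) (Esum (Lunit t1) p).
  apply: borel_reducible_trans (same _ _ 1 ltr01 (ell2_embeds t1)).
  by apply: same (@Lunit2_embeds_ell2 R).
split.
- exact: same (ell_embeds_Lunit r1).
- split; [split|].
  + exact: Esum_ell_reducible_real.
  + exact: same (real_embeds_ell p1).
  + exact: same (real_embeds_ell r1).
- split; [split|] => //.
  + by apply: same (@ell_embeds_Lunit R 2 _).
  + by apply: same (@Lunit2_embeds_ell2 R).
- rewrite le_eqVlt => /predU1P[sr|sr].
    by subst s; rewrite (bool_irrelevance s1 r1) => _; exact: refl.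
  rewrite le_eqVlt => /predU1P[r2|r2]; last exact: same (stable_embeds r1 s1 sr r2).
  by subst r; rewrite (bool_irrelevance r1 (ler1n R 2)); exact: hilbert.
(* p = q forces r = s and the identity serves; p < q gives r < s, the strict inequality that the
   snowflakes need. *)
move=> rs; rewrite le_eqVlt => /predU1P[pq|pq].
  subst q; have sr : r = s by apply: (mulIf (invr_neq0 (lt0r_neq0 p0))).
  by subst s; rewrite (bool_irrelevance s1 r1); split; exact: refl.
have rls : r < s.
  have -> : r = s * (p / q) by rewrite [p / q]mulrC mulrA -rs divfK// gt_eqF.
  by rewrite gtr_pMr// ltr_pdivrMr// mul1r.
split; apply: (Esum_reducible_power r0 s0 p0 q0 rs).
- exact: absorbing_snow_embeds (@counting_absorbing R) rls.
- exact: absorbing_snow_embeds (@unif_absorbing R) rls.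
Qed.
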